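(* Let $(M,g)$ be a closed Riemannian 3-manifold whose scalar curvature vanishes identically. Suppose there exists a smooth vector field $X$ on $M$ with $g(X,X)=1$ such that $\mathrm{Ric}(X,\cdot)=0$ (i.e. $X$ lies in the zero eigenspace of the Ricci tensor at every point), $\nabla_X X=0$ (the flow of $X$ is geodesic), and $\operatorname{div} X=0$ (the flow of $X$ is divergence-free). Then $(M,g)$ is flat.
   Context: Closed means compact without boundary; manifolds are connected. $\nabla$ is the Levi-Civita connection of $g$ and $\mathrm{Ric}$ its Ricci tensor. The zero eigenspace of the Ricci tensor at $p$ is the kernel of the endomorphism $\widehat{\mathrm{Ric}}_p\colon T_pM\to T_pM$ defined by $g(\widehat{\mathrm{Ric}}_p(X),Y)=\mathrm{Ric}_p(X,Y)$ for all $Y\in T_pM$. *)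

(* Defs.v *)
From mathcomp Require Import all_boot all_order all_algebra.
From mathcomp Require Import boolp classical_sets functions reals.
From mathcomp Require Import topology normedtype derive.
From mathcomp Require Import ring.
Set Implicit Arguments.
Unset Strict Implicit.
Unset Printing Implicit Defensive.
Import Order.TTheory GRing.Theory Num.Theory numFieldNormedType.Exports.
Local Open Scope classical_set_scope.
Local Open Scope ring_scope.

Section Calculus.
Context {R : realType} {n : nat} {W : normedModType R}.

Definition partial (k : 'I_n) (f : 'rV[R]_n -> W) : 'rV[R]_n -> W :=
  fun x => 'D_(delta_mx 0 k) f x.

(* Smoothness on an open set U: every iterated partial derivative is
   (Frechet) differentiable at every point of U. The values of f outside U
   are irrelevant, since U is open. *)
Definition smooth_on (U : set 'rV[R]_n) (f : 'rV[R]_n -> W) : Prop :=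
  forall (s : seq 'I_n) x, U x -> differentiable (foldr partial f s) x.

End Calculus.

(* Charts are total functions [coord i], [param i]; only the values of
   [coord i] on the open set [dom i] and those of [param i] on its image are
   meaningful. Images of charts are open in R^n, so there is no boundary. *)
Record smooth_atlas (R : realType) (n : nat) (M : topologicalType) :=
  SmoothAtlas {
    chart : Type;
    dom : chart -> set M;
    coord : chart -> M -> 'rV[R]_n;
    param : chart -> 'rV[R]_n -> M;
    dom_open : forall i, open (dom i);
    dom_cover : forall p, exists i, dom i p;
    range_open : forall i, open (coord i @` dom i);
    coordK : forall i p, dom i p -> param i (coord i p) = p;
    coord_continuous : forall i p, dom i p -> {for p, continuous (coord i)};
    param_continuous : forall i x, (coord i @` dom i) x ->
      {for x, continuous (param i)};
    transition_smooth : forall i j,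
      smooth_on (coord i @` (dom i `&` dom j)) (coord j \o param i)
  }.

(* Second countability need not be required: it follows from compactness. *)
Definition closed_manifold (M : topologicalType) : Prop :=
  [/\ hausdorff_space M, compact [set: M] & connected [set: M]].

Section Tensors.
Context {R : realType} {n : nat} {M : topologicalType}.
Variable A : smooth_atlas R n M.

Definition range_of (i : chart A) : set 'rV[R]_n := coord i @` dom i.

Definition overlap (i j : chart A) : set 'rV[R]_n :=
  coord i @` (dom i `&` dom j).

Definition transition (i j : chart A) : 'rV[R]_n -> 'rV[R]_n :=
  coord j \o param i.

Definition inner (G : 'M[R]_n) (u v : 'rV[R]_n) : R := (u *m G *m v^T) 0 0.

(* [gram i x] is the Gram matrix, in the coordinate frame of the chart i, of
   the inner product on the tangent space at the point of coordinates x. *)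
Record riemannian_metric := RiemannianMetric {
  gram : chart A -> 'rV[R]_n -> 'M[R]_n;
  gram_smooth : forall i k l, smooth_on (range_of i) (fun x => gram i x k l);
  gram_sym : forall i x, range_of i x -> (gram i x)^T = gram i x;
  gram_pos : forall i x, range_of i x ->
    forall v, v != 0 -> 0 < inner (gram i x) v v;
  gram_transition : forall i j x, overlap i j x -> forall u v,
    inner (gram i x) u v =
    inner (gram j (transition i j x))
      ('d (transition i j) x u) ('d (transition i j) x v)
}.

(* [coef i x] is the row of components of the field in the coordinate frame. *)
Record vector_field := VectorField {
  coef : chart A -> 'rV[R]_n -> 'rV[R]_n;
  coef_smooth : forall i k, smooth_on (range_of i) (fun x => coef i x 0 k);
  coef_transition : forall i j x, overlap i j x ->
    coef j (transition i j x) = 'd (transition i j) x (coef i x)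
}.

End Tensors.

(* Riemannian geometry of a metric G given in local coordinates. *)
Section LocalGeometry.
Context {R : realType} {n : nat}.
Variable G : 'rV[R]_n -> 'M[R]_n.
Implicit Types (V W : 'rV[R]_n -> 'rV[R]_n) (u v w x : 'rV[R]_n).

(* The coefficient of the k-th coordinate field in the covariant derivative
   of the j-th coordinate field along the i-th one, for the Levi-Civita
   connection; see [christoffel_sym] and [christoffel_metric]. *)
Definition christoffel (i j k : 'I_n) x : R :=
  2^-1 * \sum_(l < n) invmx (G x) k l *
    (partial i (fun y => G y j l) x + partial j (fun y => G y i l) x
     - partial l (fun y => G y i j) x).

Definition nabla V W : 'rV[R]_n -> 'rV[R]_n := fun x =>
  \row_(k < n) (\sum_(i < n) V x 0 i * partial i (fun y => W y 0 k) x
    + \sum_(i < n) \sum_(j < n) V x 0 i * W x 0 j * christoffel i j k x).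

(* Trace of the endomorphism u |-> nabla_u W. *)
Definition divergence W x : R :=
  \sum_(k < n) nabla (fun=> delta_mx 0 k) W x 0 k.

(* R(u, v) w, where u, v and w are extended to fields with constant
   coefficients, so that the term involving the bracket [u, v] vanishes. *)
Definition riemann u v w x : 'rV[R]_n :=
  nabla (fun=> u) (nabla (fun=> v) (fun=> w)) x
  - nabla (fun=> v) (nabla (fun=> u) (fun=> w)) x.

(* Ric(v, w) is the trace of u |-> R(u, v) w. *)
Definition ricci v w x : R :=
  \sum_(k < n) riemann (delta_mx 0 k) v w x 0 k.

Definition scalar_curvature x : R :=
  \sum_(k < n) \sum_(l < n)
    invmx (G x) k l * ricci (delta_mx 0 k) (delta_mx 0 l) x.

(* Torsion-freeness. *)
Lemma christoffel_sym i j k x :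
  (\forall y \near x, (G y)^T = G y) ->
  christoffel i j k x = christoffel j i k x.
Proof.
move=> Gs; rewrite /christoffel; congr (_ * _); apply: eq_bigr => l _.
congr (_ * _); congr (_ - _); first exact: addrC.
by apply: near_eq_derive; apply: filterS Gs => y Gy; rewrite -[in LHS]Gy mxE.
Qed.

(* Metric compatibility, on coordinate fields. *)
Lemma christoffel_metric i j k x :
  (\forall y \near x, (G y)^T = G y) -> G x \in unitmx ->
  partial k (fun y => G y i j) x =
  \sum_(l < n) (christoffel k i l x * G x l j + christoffel k j l x * G x i l).
Proof.
move=> Gs Gu; have Gx := nbhs_singleton Gs.
have pS a b c : partial c (fun y => G y a b) x = partial c (fun y => G y b a) x.
  by apply: near_eq_derive; apply: filterS Gs => y Gy; rewrite -[in LHS]Gy mxE.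
have lower a b c : \sum_(l < n) christoffel a b l x * G x l c = 2^-1 *
    (partial a (fun y => G y b c) x + partial b (fun y => G y a c) x
     - partial c (fun y => G y a b) x).
  under eq_bigr => l _ do rewrite /christoffel -mulrA mulr_suml mulr_sumr.
  rewrite exchange_big (bigD1 c) //= [X in _ + X]big1 => [|m mc].
    rewrite addr0 -mulr_sumr; congr (_ * _).
    under eq_bigr => l _ do rewrite -mulrA mulrCA -{2}Gx mxE [_ * G x c l]mulrC.
    rewrite -mulr_sumr.
    have /matrixP/(_ c c) := mulmxV Gu; rewrite !mxE eqxx => ->.
    by rewrite mulr1.
  rewrite -mulr_sumr.
  under eq_bigr => l _ do rewrite -mulrA mulrCA -{2}Gx mxE [_ * G x c l]mulrC.
  rewrite -mulr_sumr.
  have /matrixP/(_ c m) := mulmxV Gu; rewrite !mxE eq_sym (negbTE mc) => ->.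
  by rewrite !mulr0.
rewrite big_split /= lower.
under [X in _ + X]eq_bigr => l _ do rewrite -Gx mxE.
rewrite lower -mulrDr (pS j i k) (pS k i j) (pS k j i).
set a := partial k _ _; set b := partial i _ _; set c := partial j _ _.
have -> : a + b - c + (a + c - b) = a *+ 2 by ring.
by rewrite -[a *+ 2]mulr_natl mulKf // pnatr_eq0.
Qed.

End LocalGeometry.

(* Main.v *)
(* Let B v = nabla_v X. Since Ric(X, X) = 0 and div X = 0, both tr B and tr B^2
   vanish, so B is nilpotent; where B <> 0 there is an orthonormal frame
   (e1, e2, X) with B e1 = B X = 0 and B e2 = b e1. Write mu and beta for the
   coefficients <nabla_X e1, e2> and <nabla_e2 e1, e2>. The curvature conditions
   give the structure equations
     e1 b = - beta b,  X b = 0,  e1 mu = - beta mu,  e2 mu = X beta,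
     e1 beta = lambda - beta^2,
   where lambda = b mu is the eigenvalue of Ric on e1. Applying the commutators
   of the frame to b, lambda and beta shows that, with zeta = (e2 beta) / b, the
   functions
     beta^2 / lambda + ln b^2   and   zeta^2 / lambda + ln (mu / b) + mu / b
   are locally constant where lambda > 0. Globally, F = tr (B^T R(B _, X)X),
   which is b^2 lambda in the frame, is a smooth function on M. It has no local
   minimum with nonzero value, because e1 e1 F = - 4 lambda F at a critical point;
   hence F >= 0. The two conserved quantities bound grad (ln lambda) and mu / b,
   so F cannot reach 0 along a segment starting where F > 0: the set F > 0 is
   open and closed. As M is connected and F attains its minimum, F = 0. Then
   R(_, X)X = 0 where B <> 0, thus everywhere, and in dimension 3 the vanishing
   of Ric(X, _) and of the scalar curvature leaves no other component. *)
Require Import Defs.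
From mathcomp Require Import all_boot all_order all_algebra.
From mathcomp Require Import boolp classical_sets functions reals.
From mathcomp Require Import topology normedtype derive.
From mathcomp Require Import sequences realfun exp landau ring lra.
Set Implicit Arguments.
Unset Strict Implicit.
Unset Printing Implicit Defensive.
Import Order.TTheory GRing.Theory Num.Theory numFieldNormedType.Exports.
Local Open Scope classical_set_scope.
Local Open Scope ring_scope.

(** * Smooth functions on open sets of R^n *)

(** An adapted frame is only local, and b, mu and beta are fixed only up to the signs of e1 and e2.
    Everything transported between points is therefore rewritten through b^2 = |B|^2, lambda = F /
    |B|^2, beta^2 and zeta = (X lambda) / (2 lambda). F itself involves no division, so it is smooth
    even where B vanishes.

    The commutator algebra closes because b (X mu) = 2 mu (e2 beta), differentiated along e1, forces
    beta (e2 beta) = b (X beta). From then on, where mu is nonzero, zeta is the only unknown in the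
    first derivatives of b, mu and beta.

    The bounds come from the shape of the conserved quantities. With value K0 for the second one, r
    = mu / b is at most 1 + |K0|, since ln r cannot compensate a large r. With value E0 for the
    first, b^2 is at most exp E0. Since - x ln x is bounded above near 0, beta^2 and zeta^2 are
    bounded, and |grad ln lambda|^2 = 4 (beta^2 + zeta^2).

    Propagation runs along straight segments of a chart, so it uses only the mean value theorem,
    with no flow and no geodesics. *)

Section SmoothFunctions.
Context {R : realType} {n : nat}.
Implicit Types (U : set 'rV[R]_n) (f g : 'rV[R]_n -> R).

(** Differentiability depends only on the germ: the differential of [f] satisfies the same little-o
    expansion for [g]. This lets functions with arbitrary values outside an open set be rewritten
    inside it. *)
Lemma near_eq_differentiable (V W : normedModType R) (f g : V -> W) (x : V) :
  (\forall y \near x, f y = g y) -> differentiable f x -> differentiable g x.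
Proof.
move=> fg df.
have near0P : (\forall y \near (0 : V), f (y + x) = g (y + x)).
  by move: fg; rewrite (near_shift 0 x) /=; apply: filterS => y; rewrite subr0.
have E : g \o shift x = cst (g x) + 'd f x +o_ 0 id.
  apply/eqaddoP => e e0.
  have /eqaddoP/(_ _ e0) := diff_locally df.
  apply: filterS2 near0P => y /= fgy.
  by rewrite !fctE /= -fgy -(nbhs_singleton fg).
have dgE : 'd g x = 'd f x :> (V -> W).
  by apply: diff_unique E => //; exact: diff_continuous.
apply/diff_locallyP; rewrite dgE; split => //; exact: diff_continuous.
Qed.

Lemma open_near U x (P : 'rV[R]_n -> Prop) :
  open U -> U x -> (forall y, U y -> P y) -> \forall y \near x, P y.
Proof. by move=> oU Ux UP; apply: filterS (open_nbhs_nbhs (conj oU Ux)). Qed.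

Lemma eq_partial U f g k x : open U -> U x -> (forall y, U y -> f y = g y) ->
  partial k f x = partial k g x.
Proof. by move=> oU Ux fg; apply: near_eq_derive; exact: open_near Ux fg. Qed.

Lemma eq_differentiable U f g x : open U -> U x ->
  (forall y, U y -> f y = g y) -> differentiable f x -> differentiable g x.
Proof. by move=> oU Ux fg; apply: near_eq_differentiable; exact: open_near Ux fg. Qed.

Lemma eq_foldr_partial U f g s x : open U -> U x ->
  (forall y, U y -> f y = g y) -> foldr partial f s x = foldr partial g s x.
Proof.
move=> oU Ux fg; elim: s x Ux => [|k s IH] x Ux /=; first exact: fg.
exact: (eq_partial _ oU Ux IH).
Qed.

Lemma smooth_on_eq U f g : open U -> (forall y, U y -> f y = g y) ->
  smooth_on U f -> smooth_on U g.
Proof.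
move=> oU fg sf s x Ux; apply: (eq_differentiable oU Ux _ (sf s x Ux)) => y Uy.
exact: eq_foldr_partial fg.
Qed.

Lemma smooth_differentiable U f x : smooth_on U f -> U x -> differentiable f x.
Proof. by move=> /(_ [::] x) /= H /H. Qed.

Lemma smooth_partial U f k : smooth_on U f -> smooth_on U (partial k f).
Proof. by move=> sf s x Ux; have := sf (rcons s k) x Ux; rewrite foldr_rcons. Qed.

Lemma smooth_on_sub U V f : V `<=` U -> smooth_on U f -> smooth_on V f.
Proof. by move=> VU sf s x /VU; exact: sf. Qed.

(** Coinduction for smoothness: it suffices to find a class of differentiable functions stable under
    partial derivatives, up to equality on [U]. *)
Lemma smooth_coind U (P : ('rV[R]_n -> R) -> Prop) : open U ->
  (forall f, P f -> (forall x, U x -> differentiable f x) /\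
     forall k, exists2 g, P g & forall x, U x -> partial k f x = g x) ->
  forall f, P f -> smooth_on U f.
Proof.
(* The last entry of [s] is the innermost derivative; peeling it off replaces [f] by [partial k f],
   which agrees on [U] with a member of [P]. *)
move=> oU PU f Pf s; elim/last_ind: s f Pf => [|s k IH] f Pf x Ux /=.
  by have [+ _] := PU f Pf; exact.
rewrite foldr_rcons; have [_ /(_ k)[g Pg fg]] := PU f Pf.
apply: (eq_differentiable oU Ux _ (IH g Pg x Ux)) => y Uy.
by apply: (eq_foldr_partial _ oU Uy) => z Uz; rewrite fg.
Qed.

End SmoothFunctions.

Section PartialRules.
Context {R : realType} {n : nat}.
Implicit Types (U : set 'rV[R]_n) (f g : 'rV[R]_n -> R) (x : 'rV[R]_n) (k : 'I_n).

Lemma partial_cst (c : R) k x : partial k (fun=> c) x = 0.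
Proof. exact: derive_cst. Qed.

Lemma partialD f g k x : differentiable f x -> differentiable g x ->
  partial k (fun y => f y + g y) x = partial k f x + partial k g x.
Proof. by move=> df dg; apply: deriveD; exact: diff_derivable. Qed.

Lemma partialN f k x : differentiable f x ->
  partial k (fun y => - f y) x = - partial k f x.
Proof. by move=> df; apply: deriveN; exact: diff_derivable. Qed.

Lemma partialM f g k x : differentiable f x -> differentiable g x ->
  partial k (fun y => f y * g y) x = partial k f x * g x + f x * partial k g x.
Proof.
move=> df dg; rewrite /partial.
have /= E := deriveM (@diff_derivable _ _ _ _ _ (delta_mx 0 k) df) (@diff_derivable _ _ _ _ _ _ dg).
by rewrite fctE in E; rewrite E addrC /GRing.scale /= mulrC.
Qed.

Lemma differentiable_bigsum (I : Type) (r : seq I) (F : I -> 'rV[R]_n -> R) x :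
  (forall i, differentiable (F i) x) ->
  differentiable (fun y => \sum_(i <- r) F i y) x.
Proof.
move=> dF; elim: r => [|i r IH].
  rewrite (_ : (fun y => _) = cst 0); first exact: differentiable_cst.
  by apply/funext => y; rewrite big_nil.
rewrite (_ : (fun y => _) = F i + (fun y => \sum_(i <- r) F i y)).
  exact: differentiableD.
by apply/funext => y; rewrite big_cons.
Qed.

Lemma partial_sum (I : Type) (r : seq I) (F : I -> 'rV[R]_n -> R) k x :
  (forall i, differentiable (F i) x) ->
  partial k (fun y => \sum_(i <- r) F i y) x = \sum_(i <- r) partial k (F i) x.
Proof.
move=> dF; elim: r => [|i r IH].
  rewrite big_nil -[RHS](partial_cst 0 k x); congr (partial k _ x).
  by apply/funext => y; rewrite big_nil.
rewrite big_cons -IH -partialD //; last exact: differentiable_bigsum.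
by congr (partial k _ x); apply/funext => y; rewrite big_cons.
Qed.

Lemma partialV f k x : differentiable f x -> f x != 0 ->
  partial k (fun y => (f y)^-1) x = - (f x)^-1 ^+ 2 * partial k f x.
Proof.
move=> df f0; rewrite /partial; have := @deriveV R _ f x (delta_mx 0 k) f0.
rewrite /= => -> //; last exact: diff_derivable.
by rewrite exprVn.
Qed.

Lemma is_derive_sqrt (a : R) : 0 < a ->
  is_derive a 1 (@Num.sqrt R) (2^-1 * (Num.sqrt a)^-1).
Proof.
move=> a0; have s0 : 0 < Num.sqrt a by rewrite sqrtr_gt0.
have := @is_derive_inverse R (fun y => y ^+ 2) (@Num.sqrt R)
  (2 * Num.sqrt a) (Num.sqrt a).
rewrite invfM sqr_sqrtr ?ltW //; apply.
- near=> y; rewrite sqrtr_sqr ger0_norm //.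
  by apply: ltW; near: y; exact: lt_nbhsr.
- by near=> y; exact: exprn_continuous.
- by apply: is_derive_eq; rewrite /GRing.scale /= mulr1 mulr2n mulrDl mul1r.
- by rewrite mulf_neq0 ?pnatr_eq0 // gt_eqF.
Unshelve. all: by end_near. Qed.

Lemma partial_comp1 (h : R -> R) (dh : R) f k x :
  differentiable f x -> is_derive (f x) 1 h dh ->
  partial k (fun y => h (f y)) x = dh * partial k f x.
Proof.
move=> df [hd he]; have dh1 : differentiable h (f x) by exact/derivable1_diffP.
rewrite /partial deriveE; last exact: (differentiable_comp df dh1).
rewrite (diff_comp df dh1) /= deriv1E //= -deriveE // /GRing.scale /=.
by rewrite derive1E he mulrC.
Qed.

Lemma differentiable_comp1 (h : R -> R) (dh : R) f x :
  differentiable f x -> is_derive (f x) 1 h dh ->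
  differentiable (fun y => h (f y)) x.
Proof.
by move=> df [hd he]; apply: (differentiable_comp df); exact/derivable1_diffP.
Qed.

End PartialRules.

Section ChainRule.
Context {R : realType} {m n : nat}.
Implicit Types (t : 'rV[R]_m -> 'rV[R]_n) (x : 'rV[R]_m).

Lemma rowE_delta (v : 'rV[R]_n) : v = \sum_l v 0 l *: delta_mx 0 l.
Proof. exact: row_sum_delta. Qed.

Lemma differentiable_row t x : (forall l, differentiable (fun y => t y 0 l) x) ->
  differentiable t x.
Proof.
move=> dt; rewrite (_ : t = \sum_(l < n) (fun y => t y 0 l *: delta_mx 0 l)).
  by apply: differentiable_sum => l; apply: differentiableZl.
by apply/funext => y; rewrite [LHS]rowE_delta fct_sumE.
Qed.

Lemma differentiable_entry t x l : differentiable t x ->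
  differentiable (fun y => t y 0 l) x.
Proof.
move=> dt; apply: (differentiable_comp (g := fun N : 'rV[R]_n => N 0 l) dt).
exact: differentiable_coord.
Qed.

Lemma derive_entry t x v l : differentiable t x ->
  ('D_v t x) 0 l = 'D_v (fun y => t y 0 l) x.
Proof.
by move=> dt; rewrite derive_mx ?mxE //; exact: diff_derivable.
Qed.

Lemma derive_partial (f : 'rV[R]_n -> R) (y v : 'rV[R]_n) : differentiable f y ->
  'D_v f y = \sum_k v 0 k * partial k f y.
Proof.
move=> df; rewrite deriveE // [in LHS](rowE_delta v) linear_sum /=.
by apply: eq_bigr => k _; rewrite linearZ /= /partial deriveE.
Qed.

Lemma partial_comp (f : 'rV[R]_n -> R) t k x :
  differentiable f (t x) -> differentiable t x ->
  partial k (fun y => f (t y)) x =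
  \sum_l partial l f (t x) * partial k (fun y => t y 0 l) x.
Proof.
move=> df dt; rewrite /partial deriveE; last exact: (differentiable_comp dt df).
rewrite (diff_comp dt df) /= -!deriveE // derive_partial //.
by apply: eq_bigr => l _; rewrite derive_entry // mulrC.
Qed.

End ChainRule.

Section SmoothClosure.
Context {R : realType} {m : nat}.
Variable U : set 'rV[R]_m.
Implicit Types (f g : 'rV[R]_m -> R).

(* The expressions obtained from smooth functions by the operations below are
   closed under partial derivatives, hence smooth by coinduction. *)
Inductive smooth_expr : ('rV[R]_m -> R) -> Prop :=
| expr_base f of smooth_on U f : smooth_expr f
| expr_cst c : smooth_expr (fun=> c)
| exprD f g of smooth_expr f & smooth_expr g : smooth_expr (fun y => f y + g y)
| exprN f of smooth_expr f : smooth_expr (fun y => - f y)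
| exprM f g of smooth_expr f & smooth_expr g : smooth_expr (fun y => f y * g y)
| exprV f of smooth_expr f & (forall y, U y -> f y != 0) :
    smooth_expr (fun y => (f y)^-1)
| expr_sqrt f of smooth_expr f & (forall y, U y -> 0 < f y) :
    smooth_expr (fun y => Num.sqrt (f y))
| expr_comp n (V : set 'rV[R]_n) (h : 'rV[R]_n -> R) (t : 'rV[R]_m -> 'rV[R]_n)
    of smooth_on V h &
    (forall l, smooth_on U (fun y => t y 0 l)) & (forall y, U y -> V (t y)) :
    smooth_expr (fun y => h (t y)).

Lemma smooth_expr_sum (I : Type) (r : seq I) (F : I -> 'rV[R]_m -> R) :
  (forall i, smooth_expr (F i)) -> smooth_expr (fun y => \sum_(i <- r) F i y).
Proof.
move=> sF; elim: r => [|i r IH].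
  rewrite (_ : (fun y => _) = fun=> 0); first exact: expr_cst.
  by apply/funext => y; rewrite big_nil.
rewrite (_ : (fun y => _) = (fun y => F i y + \sum_(i <- r) F i y)).
  exact: exprD.
by apply/funext => y; rewrite big_cons.
Qed.

Lemma smooth_expr_smooth f : open U -> smooth_expr f -> smooth_on U f.
Proof.
move=> oU; move: f; apply: smooth_coind => // f.
elim=> {f}.
- move=> f sf; split=> [x|k]; first exact: smooth_differentiable.
  by exists (partial k f) => //; apply: expr_base; exact: smooth_partial.
- move=> c; split=> [x _|k]; first exact: differentiable_cst.
  by exists (fun=> 0) => [|x _]; [exact: expr_cst | rewrite partial_cst].
- move=> f g sf [df Pf] sg [dg Pg]; split=> [x Ux|k].
    by apply: differentiableD; [exact: df | exact: dg].
  have [f' sf' fE] := Pf k; have [g' sg' gE] := Pg k.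
  exists (fun y => f' y + g' y) => [|x Ux]; first exact: exprD.
  by rewrite partialD ?fE ?gE //; [exact: df | exact: dg].
- move=> f sf [df Pf]; split=> [x Ux|k].
    by apply: differentiableN; exact: df.
  have [f' sf' fE] := Pf k.
  exists (fun y => - f' y) => [|x Ux]; first exact: exprN.
  by rewrite partialN ?fE //; exact: df.
- move=> f g sf [df Pf] sg [dg Pg]; split=> [x Ux|k].
    by apply: differentiableM; [exact: df | exact: dg].
  have [f' sf' fE] := Pf k; have [g' sg' gE] := Pg k.
  exists (fun y => f' y * g y + f y * g' y) => [|x Ux].
    by apply: exprD; exact: exprM.
  by rewrite partialM ?fE ?gE //; [exact: df | exact: dg].
- move=> f sf [df Pf] f0; split=> [x Ux|k].
    by apply: differentiableV; [exact: df | exact: f0].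
  have [f' sf' fE] := Pf k.
  exists (fun y => - ((f y)^-1 * (f y)^-1) * f' y) => [|x Ux].
    by apply: exprM => //; apply: exprN; apply: exprM; exact: exprV.
  by rewrite partialV ?fE ?f0 // ?expr2 //; exact: df.
- move=> f sf [df Pf] f0; split=> [x Ux|k].
    exact: (differentiable_comp1 (df x Ux) (is_derive_sqrt (f0 x Ux))).
  have [f' sf' fE] := Pf k.
  exists (fun y => 2^-1 * (Num.sqrt (f y))^-1 * f' y) => [|x Ux].
    apply: exprM => //; apply: exprM; first exact: expr_cst.
    apply: exprV => [|y Uy]; first exact: expr_sqrt.
    by rewrite gt_eqF // sqrtr_gt0 f0.
  by rewrite (partial_comp1 _ (df x Ux) (is_derive_sqrt (f0 x Ux))) fE.
- move=> n V f t sf st UV.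
  have dt x : U x -> differentiable t x.
    by move=> Ux; apply: differentiable_row => l; exact: smooth_differentiable Ux.
  split=> [x Ux|k].
    by apply: (differentiable_comp (dt x Ux)); exact: smooth_differentiable (UV _ Ux).
  exists (fun y => \sum_l partial l f (t y) * partial k (fun z => t z 0 l) y) => [|x Ux].
    apply: smooth_expr_sum => l; apply: exprM.
      by apply: (@expr_comp _ V (partial l f)) => //; exact: smooth_partial.
    by apply: expr_base; exact: smooth_partial.
  by rewrite partial_comp //; [exact: smooth_differentiable (UV _ Ux) | exact: dt].
Qed.

Hypothesis oU : open U.

Lemma smooth_cst (c : R) : smooth_on U (fun=> c).
Proof. by apply: smooth_expr_smooth => //; exact: expr_cst. Qed.

Lemma smoothD f g : smooth_on U f -> smooth_on U g ->
  smooth_on U (fun y => f y + g y).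
Proof. by move=> sf sg; apply: smooth_expr_smooth => //; apply: exprD; exact: expr_base. Qed.

Lemma smoothN f : smooth_on U f -> smooth_on U (fun y => - f y).
Proof. by move=> sf; apply: smooth_expr_smooth => //; apply: exprN; exact: expr_base. Qed.

Lemma smoothM f g : smooth_on U f -> smooth_on U g ->
  smooth_on U (fun y => f y * g y).
Proof. by move=> sf sg; apply: smooth_expr_smooth => //; apply: exprM; exact: expr_base. Qed.

Lemma smoothV f : smooth_on U f -> (forall y, U y -> f y != 0) ->
  smooth_on U (fun y => (f y)^-1).
Proof. by move=> sf f0; apply: smooth_expr_smooth => //; apply: exprV => //; exact: expr_base. Qed.

Lemma smooth_sqrt f : smooth_on U f -> (forall y, U y -> 0 < f y) ->
  smooth_on U (fun y => Num.sqrt (f y)).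
Proof.
by move=> sf f0; apply: smooth_expr_smooth => //; apply: expr_sqrt => //; exact: expr_base.
Qed.

Lemma smooth_comp n (V : set 'rV[R]_n) (f : 'rV[R]_n -> R) (t : 'rV[R]_m -> 'rV[R]_n) :
  smooth_on V f -> (forall l, smooth_on U (fun y => t y 0 l)) ->
  (forall y, U y -> V (t y)) -> smooth_on U (fun y => f (t y)).
Proof. by move=> sf st UV; apply: smooth_expr_smooth => //; exact: expr_comp UV. Qed.

Lemma smooth_sum (I : Type) (r : seq I) (F : I -> 'rV[R]_m -> R) :
  (forall i, smooth_on U (F i)) -> smooth_on U (fun y => \sum_(i <- r) F i y).
Proof.
move=> sF; apply: smooth_expr_smooth => //; apply: smooth_expr_sum => i.
exact: expr_base.
Qed.

Lemma smooth_prod (I : Type) (r : seq I) (F : I -> 'rV[R]_m -> R) :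
  (forall i, smooth_on U (F i)) -> smooth_on U (fun y => \prod_(i <- r) F i y).
Proof.
move=> sF; elim: r => [|i r IH].
  rewrite (_ : (fun y => _) = fun=> 1); first exact: smooth_cst.
  by apply/funext => y; rewrite big_nil.
rewrite (_ : (fun y => _) = (fun y => F i y * \prod_(i <- r) F i y)).
  exact: smoothM.
by apply/funext => y; rewrite big_cons.
Qed.

End SmoothClosure.

Section Lines.
Context {R : realType} {V : normedModType R}.

Lemma is_derive_line (f : V -> R) (p v : V) (s : R) :
  differentiable f (p + s *: v) ->
  is_derive s 1 (fun r => f (p + r *: v)) ('D_v f (p + s *: v)).
Proof.
move=> df; have dv := diff_derivable (v := v) df.
have E : (fun h : R => h^-1 *: (((fun r => f (p + r *: v)) \o shift s) (h *: 1)
            - f (p + s *: v))) =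
         (fun h : R => h^-1 *: ((f \o shift (p + s *: v)) (h *: v)
            - f (p + s *: v))).
  apply/funext => h /=; congr (_ *: (f _ - _)).
  by rewrite [h *: 1]mulr1 scalerDl addrCA.
by apply: DeriveDef; rewrite /derivable /derive E.
Qed.

Lemma MVT_line (f : V -> R) (p v : V) (t : R) : 0 < t ->
  (forall s, 0 <= s <= t -> differentiable f (p + s *: v)) ->
  exists2 s, 0 < s < t & f (p + t *: v) - f p = t * 'D_v f (p + s *: v).
Proof.
move=> t0 df; pose g r := f (p + r *: v).
have [||s] := @MVT R g (fun s => 'D_v f (p + s *: v)) 0 t t0.
- move=> s; rewrite in_itv /= => /andP[s0 st]; apply: is_derive_line; apply: df.
  by rewrite !ltW.
- apply: derivable_within_continuous => s; rewrite in_itv /= => sI.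
  by have [] := is_derive_line (df s sI).
rewrite in_itv /= => sI; rewrite /g scale0r addr0 subr0 => ->.
by exists s => //; rewrite mulrC.
Qed.

End Lines.

(** * Symmetry of second partial derivatives *)

Section Schwarz.
Context {R : realType} {n : nat}.
Variables (U : set 'rV[R]_n) (f : 'rV[R]_n -> R).
Hypotheses (oU : open U) (sf : smooth_on U f).

(** The mean value theorem is used twice: in direction [i] for the increment of [f] in direction
    [j], then in direction [j] for [partial i f]. The step [t] is chosen so that the whole
    parallelogram stays in the ball. *)
Lemma second_difference (i j : 'I_n) (x : 'rV[R]_n) (d : R) : 0 < d ->
  ball x d `<=` U ->
  let t := d / (1 + (`|delta_mx 0 i : 'rV[R]_n| + `|delta_mx 0 j : 'rV[R]_n|)) in
  let ei := t *: delta_mx 0 i : 'rV[R]_n in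
  let ej := t *: delta_mx 0 j : 'rV[R]_n in
  exists2 y, ball x d y &
  f (x + ei + ej) - f (x + ei) - f (x + ej) + f x
    = t * (t * partial j (partial i f) y).
Proof.
move=> d0 bU.
set ui := delta_mx 0 i; set uj := delta_mx 0 j; set N := 1 + _.
move=> t; have N0 : 0 < N by rewrite ltr_wpDr // addr_ge0.
have t0 : 0 < t by rewrite divr_gt0.
have inb a b : 0 <= a <= t -> 0 <= b <= t -> ball x d (x + a *: ui + b *: uj).
  move=> /andP[a0 at_] /andP[b0 bt].
  rewrite -ball_normE /= -addrA opprD addrA subrr add0r normrN.
  apply: (le_lt_trans (ler_normD _ _)); rewrite !normrZ !ger0_norm //.
  apply: (@le_lt_trans _ _ (t * (`|ui| + `|uj|))).
    by rewrite mulrDr lerD // ler_wpM2r.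
  by rewrite /t mulrAC -mulrA gtr_pMr // ltr_pdivrMr // mul1r /N ltrDr.
move=> ei ej.
pose phi y := f (y + ej) - f y.
have dphi s : 0 <= s <= t -> is_derive s 1 (fun r => phi (x + r *: ui))
    ('D_ui f (x + s *: ui + ej) - 'D_ui f (x + s *: ui)).
  move=> sI; apply: is_deriveB.
    have -> : (fun r => f (x + r *: ui + ej)) = (fun r => f (x + ej + r *: ui)).
      by apply/funext => r; rewrite addrAC.
    rewrite addrAC; apply: is_derive_line.
    rewrite addrAC; apply: (smooth_differentiable sf); apply: bU; apply: inb => //.
    by rewrite ltW //= lexx.
  apply: is_derive_line; apply: (smooth_differentiable sf); apply: bU.
  by have := inb s 0 sI; rewrite scale0r addr0; apply; rewrite lexx ltW.
have [||s] := @MVT R (fun r => phi (x + r *: ui)) (fun s =>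
    'D_ui f (x + s *: ui + ej) - 'D_ui f (x + s *: ui)) 0 t t0.
- move=> s; rewrite in_itv /= => /andP[s0 st]; apply: dphi.
  by rewrite !ltW.
- apply: derivable_within_continuous => s; rewrite in_itv /= => sI.
  by have [] := dphi s sI.
rewrite in_itv /= => /andP[s0 st]; rewrite scale0r addr0 subr0 => E1.
have sI : 0 <= s <= t by rewrite !ltW.
have [r rI|r /andP[r0 rt] E2] :=
    @MVT_line R _ (partial i f) (x + s *: ui) uj t t0.
  by apply: (smooth_differentiable (smooth_partial i sf)); apply: bU; exact: inb.
exists (x + s *: ui + r *: uj); first by apply: inb => //; rewrite !ltW.
rewrite /partial -/ui -/uj -E2 mulrC [in RHS]/partial -/ui -E1 /phi.
by rewrite -/ei opprB addrA addrAC.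
Qed.

Lemma partialC (i j : 'I_n) (x : 'rV[R]_n) : U x ->
  partial i (partial j f) x = partial j (partial i f) x.
Proof.
move=> Ux; apply/eqP; rewrite -subr_eq0 -normr_eq0; apply/eqP/le_anti.
rewrite normr_ge0 andbT; apply/ler_addgt0Pr => e e0; rewrite add0r.
have cnt a b : \forall y \near x,
    `|partial a (partial b f) x - partial a (partial b f) y| < e / 2.
  have /differentiable_continuous C : differentiable (partial a (partial b f)) x.
    by apply: smooth_differentiable Ux; do 2![apply: smooth_partial].
  by move/cvgrPdist_lt : C; apply; rewrite divr_gt0.
have : \forall y \near x, [/\ U y,
    `|partial i (partial j f) x - partial i (partial j f) y| < e / 2 &
    `|partial j (partial i f) x - partial j (partial i f) y| < e / 2].
  apply: filterS3 (open_nbhs_nbhs (conj oU Ux)) (cnt i j) (cnt j i) => y Uy h1 h2.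
  by split.
move=> /nbhs_ballP[d /= d0 bd].
have [|y by_ E1] := @second_difference i j x d d0; first by move=> z /bd[].
have [|z bz E2] := @second_difference j i x d d0; first by move=> w /bd[].
(* Exchanging [i] and [j] does not change the step size, so both expressions equal the same second
   difference. *)
move: E1 E2; rewrite [X in 1 + X]addrC.
set t := d / _ => E1 E2.
have t0 : t != 0 by rewrite gt_eqF // divr_gt0 // ltr_wpDr // addr_ge0.
have E : partial j (partial i f) y = partial i (partial j f) z.
  apply: (mulfI t0); apply: (mulfI t0).
  have sym (a b c w : R) : a - b - c + w = a - c - b + w by ring.
  apply: etrans E2; apply: etrans (esym E1) _.
  by rewrite sym [x + _ + _]addrAC.
have [_ _ h1] := bd y by_; have [_ h2 _] := bd z bz.
apply: (le_trans (ler_distD (partial i (partial j f) z) _ _)).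
rewrite (splitr e); apply: lerD; first exact: ltW h2.
by rewrite -E distrC; exact: ltW h1.
Qed.

End Schwarz.

(** * Connection and curvature in a chart *)

Section DirectionalDerivative.
Context {R : realType} {n : nat}.
Implicit Types (U : set 'rV[R]_n) (f g : 'rV[R]_n -> R) (u v x : 'rV[R]_n)
  (V W : 'rV[R]_n -> 'rV[R]_n).

Definition smooth_field U V := forall k, smooth_on U (fun x => V x 0 k).

(* Unlike ['D_v f x], this is linear in [v] for every [f]. *)
Definition along v f x : R := \sum_k v 0 k * partial k f x.

Definition along_row v V x : 'rV[R]_n := \row_k along v (fun y => V y 0 k) x.

Lemma along_derive v f x : differentiable f x -> along v f x = 'D_v f x.
Proof. by move=> df; rewrite derive_partial. Qed.

Lemma alongDl u v f x : along (u + v) f x = along u f x + along v f x.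
Proof. by rewrite -big_split; apply: eq_bigr => k _; rewrite mxE mulrDl. Qed.

Lemma alongZl a v f x : along (a *: v) f x = a * along v f x.
Proof. by rewrite mulr_sumr; apply: eq_bigr => k _; rewrite mxE mulrA. Qed.

Lemma alongNl v f x : along (- v) f x = - along v f x.
Proof. by rewrite -scaleN1r alongZl mulN1r. Qed.

Lemma along0l f x : along 0 f x = 0.
Proof. by rewrite -(scale0r 0) alongZl mul0r. Qed.

Lemma alongBl u v f x : along (u - v) f x = along u f x - along v f x.
Proof. by rewrite alongDl alongNl. Qed.

Lemma eq_along U v f g x : open U -> U x -> (forall y, U y -> f y = g y) ->
  along v f x = along v g x.
Proof.
by move=> oU Ux fg; apply: eq_bigr => k _; congr (_ * _); exact: eq_partial fg.
Qed.

Lemma along_cst v (c : R) x : along v (fun=> c) x = 0.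
Proof. by rewrite /along big1 // => k _; rewrite partial_cst mulr0. Qed.

Lemma alongD v f g x : differentiable f x -> differentiable g x ->
  along v (fun y => f y + g y) x = along v f x + along v g x.
Proof.
move=> df dg; rewrite -big_split; apply: eq_bigr => k _ /=.
by rewrite partialD // mulrDr.
Qed.

Lemma alongN v f x : differentiable f x ->
  along v (fun y => - f y) x = - along v f x.
Proof.
move=> df; rewrite /along -sumrN; apply: eq_bigr => k _.
by rewrite partialN // mulrN.
Qed.

Lemma alongM v f g x : differentiable f x -> differentiable g x ->
  along v (fun y => f y * g y) x = along v f x * g x + f x * along v g x.
Proof.
move=> df dg; rewrite mulr_suml mulr_sumr -big_split; apply: eq_bigr => k _ /=.
by rewrite partialM // mulrDr mulrA [X in _ + X]mulrCA.
Qed.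

Lemma along_sum (I : Type) (r : seq I) (F : I -> 'rV[R]_n -> R) v x :
  (forall i, differentiable (F i) x) ->
  along v (fun y => \sum_(i <- r) F i y) x = \sum_(i <- r) along v (F i) x.
Proof.
move=> dF; rewrite exchange_big; apply: eq_bigr => k _ /=.
by rewrite partial_sum // mulr_sumr.
Qed.

Lemma along_comp1 (h : R -> R) (dh : R) v f x :
  differentiable f x -> is_derive (f x) 1 h dh ->
  along v (fun y => h (f y)) x = dh * along v f x.
Proof.
move=> df hd; rewrite mulr_sumr; apply: eq_bigr => k _.
by rewrite (partial_comp1 k df hd) mulrCA.
Qed.

Lemma smooth_along U V f : open U -> smooth_field U V -> smooth_on U f ->
  smooth_on U (fun x => along (V x) f x).
Proof.
move=> oU sV sf; apply: smooth_sum => // k; apply: smoothM => //.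
exact: smooth_partial.
Qed.

Lemma smooth_field_cst U v : open U -> smooth_field U (fun=> v).
Proof. by move=> oU k; exact: smooth_cst. Qed.

Lemma smooth_fieldD U V W : open U -> smooth_field U V -> smooth_field U W ->
  smooth_field U (fun y => V y + W y).
Proof.
move=> oU sV sW k; apply: (smooth_on_eq oU (f := fun y => V y 0 k + W y 0 k)).
  by move=> y _; rewrite mxE.
exact: smoothD.
Qed.

Lemma smooth_fieldZ U V f : open U -> smooth_field U V -> smooth_on U f ->
  smooth_field U (fun y => f y *: V y).
Proof.
move=> oU sV sW k; apply: (smooth_on_eq oU (f := fun y => f y * V y 0 k)).
  by move=> y _; rewrite mxE.
exact: smoothM.
Qed.

Lemma smooth_fieldN U V : open U -> smooth_field U V ->
  smooth_field U (fun y => - V y).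
Proof.
move=> oU sV k; apply: (smooth_on_eq oU (f := fun y => - V y 0 k)).
  by move=> y _; rewrite mxE.
exact: smoothN.
Qed.

Lemma smooth_fieldB U V W : open U -> smooth_field U V -> smooth_field U W ->
  smooth_field U (fun y => V y - W y).
Proof. by move=> oU sV sW; apply: smooth_fieldD => //; exact: smooth_fieldN. Qed.

Lemma smooth_along_row U V W : open U -> smooth_field U V -> smooth_field U W ->
  smooth_field U (fun x => along_row (V x) W x).
Proof.
move=> oU sV sW k.
apply: (smooth_on_eq oU (f := fun x => along (V x) (fun y => W y 0 k) x)).
  by move=> y _; rewrite mxE.
exact: smooth_along.
Qed.

Lemma smooth_fieldW U V x : smooth_field U V -> U x ->
  forall k, differentiable (fun y => V y 0 k) x.
Proof. by move=> sV Ux k; exact: smooth_differentiable Ux. Qed.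

(** The second-order parts are the matrix of second partials of [f] contracted with [V] and [W]; it
    is symmetric by [partialC], so they cancel. *)
Lemma along_commutator U V W f x : open U -> U x ->
  smooth_field U V -> smooth_field U W -> smooth_on U f ->
  along (V x) (fun y => along (W y) f y) x -
  along (W x) (fun y => along (V y) f y) x =
  along (along_row (V x) W x - along_row (W x) V x) f x.
Proof.
move=> oU Ux sV sW sf.
have E Y Z : smooth_field U Y -> smooth_field U Z ->
    along (Y x) (fun y => along (Z y) f y) x = along (along_row (Y x) Z x) f x +
      \sum_i \sum_k Y x 0 i * Z x 0 k * partial i (partial k f) x.
  move=> sY sZ; rewrite along_sum => [|k]; last first.
    apply: differentiableM; first exact: smooth_fieldW Ux k.
    exact: (smooth_differentiable (smooth_partial k sf) Ux).
  rewrite [X in _ + X]exchange_big -big_split /=; apply: eq_bigr => k _.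
  rewrite alongM; [|exact: smooth_fieldW Ux k|
    exact: (smooth_differentiable (smooth_partial k sf) Ux)].
  rewrite mxE; congr (_ + _); rewrite mulr_sumr; apply: eq_bigr => i _.
  by rewrite mulrCA mulrA.
rewrite !E // alongBl.
suff -> : \sum_i \sum_k V x 0 i * W x 0 k * partial i (partial k f) x =
          \sum_i \sum_k W x 0 i * V x 0 k * partial i (partial k f) x by ring.
rewrite exchange_big; apply: eq_bigr => i _; apply: eq_bigr => k _.
by rewrite (partialC oU sf k i Ux) [V x 0 k * _]mulrC.
Qed.

End DirectionalDerivative.

Section SmoothMatrices.
Context {R : realType} {n : nat}.
Variable U : set 'rV[R]_n.
Hypothesis oU : open U.

Lemma smooth_det p (A : 'rV[R]_n -> 'M[R]_p) :
  (forall i j, smooth_on U (fun x => A x i j)) -> smooth_on U (fun x => \det (A x)).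
Proof.
move=> sA; apply: smooth_sum => // s; apply: smoothM => //; first exact: smooth_cst.
exact: smooth_prod.
Qed.

(** Cramer's rule reduces the inverse to determinants, which are polynomial in the entries. *)
Lemma smooth_invmx p (A : 'rV[R]_n -> 'M[R]_p) :
  (forall i j, smooth_on U (fun x => A x i j)) ->
  (forall x, U x -> A x \in unitmx) ->
  forall i j, smooth_on U (fun x => invmx (A x) i j).
Proof.
move=> sA uA i j.
apply: (smooth_on_eq oU (f := fun x => (\det (A x))^-1 * cofactor (A x) j i)).
  by move=> x Ux; rewrite /invmx uA // !mxE.
apply: smoothM => //.
  apply: smoothV => // [|x /uA]; first exact: smooth_det.
  by rewrite unitmxE unitfE.
apply: smoothM => //; first exact: smooth_cst.
apply: smooth_det => // k l.
by apply: (smooth_on_eq oU _ (sA (lift j k) (lift i l))) => x _; rewrite !mxE.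
Qed.

End SmoothMatrices.

Section Trilinear.
Context {R : realType} {n : nat}.
Implicit Types (C : 'I_n -> 'I_n -> 'I_n -> R) (u v w : 'rV[R]_n).

(** Zeroth-order part of a connection. [C] is left abstract so as to cover both the Christoffel
    symbols and their directional derivatives. *)
Definition trilin C u w : 'rV[R]_n :=
  \row_k \sum_i \sum_j u 0 i * w 0 j * C i j k.

Lemma trilinDl C u v w : trilin C (u + v) w = trilin C u w + trilin C v w.
Proof.
apply/rowP => k; rewrite !mxE -big_split; apply: eq_bigr => i _ /=.
by rewrite -big_split; apply: eq_bigr => j _ /=; rewrite mxE !mulrDl.
Qed.

Lemma trilinDr C u v w : trilin C u (v + w) = trilin C u v + trilin C u w.
Proof.
apply/rowP => k; rewrite !mxE -big_split; apply: eq_bigr => i _ /=.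
by rewrite -big_split; apply: eq_bigr => j _ /=; rewrite mxE mulrDr !mulrDl.
Qed.

Lemma trilinZl C a u w : trilin C (a *: u) w = a *: trilin C u w.
Proof.
apply/rowP => k; rewrite !mxE mulr_sumr; apply: eq_bigr => i _ /=.
by rewrite mulr_sumr; apply: eq_bigr => j _ /=; rewrite mxE !mulrA.
Qed.

Lemma trilinZr C a u w : trilin C u (a *: w) = a *: trilin C u w.
Proof.
apply/rowP => k; rewrite !mxE mulr_sumr; apply: eq_bigr => i _ /=.
by rewrite mulr_sumr; apply: eq_bigr => j _ /=; rewrite mxE !mulrA [a * _]mulrC.
Qed.

Lemma trilinNl C u w : trilin C (- u) w = - trilin C u w.
Proof. by rewrite -scaleN1r trilinZl scaleN1r. Qed.

Lemma trilinC C u w : (forall i j k, C i j k = C j i k) -> trilin C u w = trilin C w u.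
Proof.
move=> CC; apply/rowP => k; rewrite !mxE exchange_big; apply: eq_bigr => i _ /=.
by apply: eq_bigr => j _; rewrite CC [_ * w 0 i]mulrC.
Qed.

Lemma smooth_trilin (U : set 'rV[R]_n) (C : 'I_n -> 'I_n -> 'I_n -> 'rV[R]_n -> R) V W :
  open U -> smooth_field U V -> smooth_field U W ->
  (forall i j k, smooth_on U (C i j k)) ->
  smooth_field U (fun x => trilin (fun i j k => C i j k x) (V x) (W x)).
Proof.
move=> oU sV sW sC k.
apply: (smooth_on_eq oU
  (f := fun x => \sum_i \sum_j V x 0 i * W x 0 j * C i j k x)).
  by move=> y _; rewrite mxE.
by do 2![apply: smooth_sum => // ?]; apply: smoothM => //; apply: smoothM.
Qed.

Lemma along_trilin (U : set 'rV[R]_n) (C : 'I_n -> 'I_n -> 'I_n -> 'rV[R]_n -> R) V W v x :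
  open U -> U x -> smooth_field U V -> smooth_field U W ->
  (forall i j k, smooth_on U (C i j k)) ->
  along_row v (fun x => trilin (fun i j k => C i j k x) (V x) (W x)) x =
  trilin (fun i j k => C i j k x) (along_row v V x) (W x) +
  trilin (fun i j k => C i j k x) (V x) (along_row v W x) +
  trilin (fun i j k => along v (C i j k) x) (V x) (W x).
Proof.
move=> oU Ux sV sW sC; apply/rowP => k; rewrite !mxE.
rewrite (eq_along v oU Ux
  (g := fun x => \sum_i \sum_j V x 0 i * W x 0 j * C i j k x)); last first.
  by move=> y _; rewrite mxE.
have dV := smooth_fieldW sV Ux; have dW := smooth_fieldW sW Ux.
have dC i j l := smooth_differentiable (sC i j l) Ux.
rewrite along_sum => [|i]; last first.
  apply: differentiable_bigsum => j; apply: differentiableM => //.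
  exact: differentiableM.
rewrite -!big_split; apply: eq_bigr => i _ /=.
rewrite along_sum => [|j]; last by do 2![apply: differentiableM => //].
rewrite -!big_split; apply: eq_bigr => j _ /=.
rewrite alongM //; last exact: differentiableM.
by rewrite alongM // !mxE; ring.
Qed.

End Trilinear.

Section Inner.
Context {R : realType} {n : nat}.
Implicit Types (G : 'M[R]_n) (u v w : 'rV[R]_n).

Lemma innerE G u v : inner G u v = \sum_i \sum_j u 0 i * G i j * v 0 j.
Proof.
rewrite /inner mxE exchange_big /=; apply: eq_bigr => j _.
by rewrite !mxE mulr_suml.
Qed.

Lemma innerDl G u v w : inner G (u + v) w = inner G u w + inner G v w.
Proof. by rewrite /inner !mulmxDl mxE. Qed.

Lemma innerDr G u v w : inner G u (v + w) = inner G u v + inner G u w.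
Proof. by rewrite /inner linearD mulmxDr mxE. Qed.

Lemma innerZl G a u w : inner G (a *: u) w = a * inner G u w.
Proof. by rewrite /inner -!scalemxAl mxE. Qed.

Lemma innerZr G a u w : inner G u (a *: w) = a * inner G u w.
Proof. by rewrite /inner linearZ -scalemxAr mxE. Qed.

Lemma innerNl G u w : inner G (- u) w = - inner G u w.
Proof. by rewrite -scaleN1r innerZl mulN1r. Qed.

Lemma innerBl G u v w : inner G (u - v) w = inner G u w - inner G v w.
Proof. by rewrite innerDl innerNl. Qed.

Lemma inner0l G w : inner G 0 w = 0.
Proof. by rewrite -(scale0r 0) innerZl mul0r. Qed.

Lemma inner0r G w : inner G w 0 = 0.
Proof. by rewrite -(scale0r 0) innerZr mul0r. Qed.

Lemma innerC G u v : G^T = G -> inner G u v = inner G v u.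
Proof.
move=> GT; have -> : inner G u v = ((u *m G *m v^T)^T) 0 0 by rewrite mxE.
by rewrite !trmx_mul trmxK GT mulmxA.
Qed.

Lemma inner_nondeg G u v : G \in unitmx ->
  (forall w, inner G u w = inner G v w) -> u = v.
Proof.
move=> Gu uv; apply: (can_inj (mulmxK Gu)); apply/rowP => j.
have := uv (delta_mx 0 j); rewrite /inner trmx_delta -!colE.
by rewrite !mxE.
Qed.

Lemma pos_def_unitmx G : (forall v, v != 0 -> 0 < inner G v v) -> G \in unitmx.
Proof.
move=> pG; rewrite -row_free_unit -kermx_eq0.
apply/rowV0P => v /sub_kermxP vG; have [//|v0] := eqVneq v 0.
by have := pG v v0; rewrite /inner vG mul0mx mxE ltxx.
Qed.

End Inner.

Section LeviCivita.
Context {R : realType} {n : nat}.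
Variables (G : 'rV[R]_n -> 'M[R]_n) (U : set 'rV[R]_n).
Hypotheses (oU : open U) (sG : forall i j, smooth_on U (fun x => G x i j))
  (symG : forall x, U x -> (G x)^T = G x) (uG : forall x, U x -> G x \in unitmx).
Implicit Types (f g : 'rV[R]_n -> R) (u v w x : 'rV[R]_n)
  (V W Z : 'rV[R]_n -> 'rV[R]_n).

Local Notation chr := (christoffel G).
Local Notation gamma x := (fun i j k => christoffel G i j k x).

(** This is [nabla] with the direction given by a single vector, so that [u |-> cov u X x] is an
    endomorphism that can be iterated. *)
Definition cov u W x : 'rV[R]_n := along_row u W x + trilin (gamma x) u (W x).

Definition bracket V W x : 'rV[R]_n := along_row (V x) W x - along_row (W x) V x.

Lemma nabla_cov V W x : nabla G V W x = cov (V x) W x.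
Proof. by apply/rowP => k; rewrite !mxE. Qed.

Lemma covDl u v W x : cov (u + v) W x = cov u W x + cov v W x.
Proof.
rewrite /cov trilinDl addrACA; congr (_ + _).
by apply/rowP => k; rewrite !mxE alongDl.
Qed.

Lemma covZl a u W x : cov (a *: u) W x = a *: cov u W x.
Proof.
rewrite /cov trilinZl scalerDr; congr (_ + _).
by apply/rowP => k; rewrite !mxE alongZl.
Qed.

Lemma covNl u W x : cov (- u) W x = - cov u W x.
Proof. by rewrite -scaleN1r covZl scaleN1r. Qed.

Lemma covBl u v W x : cov (u - v) W x = cov u W x - cov v W x.
Proof. by rewrite covDl covNl. Qed.

Lemma cov0l W x : cov 0 W x = 0.
Proof. by have := covZl 0 0 W x; rewrite !scale0r. Qed.

Lemma eq_cov u V W x : U x -> (forall y, U y -> V y = W y) -> cov u V x = cov u W x.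
Proof.
move=> Ux VW; rewrite /cov VW //; congr (_ + _).
apply/rowP => k; rewrite !mxE; apply: (eq_along u oU Ux) => y Uy.
by rewrite VW.
Qed.

Lemma cov0r u x : cov u (fun=> 0) x = 0.
Proof.
rewrite /cov -[X in trilin _ _ X](scale0r 0) trilinZr scale0r addr0.
by apply/rowP => k; rewrite !mxE along_cst.
Qed.

Lemma covD u V W x : U x -> smooth_field U V -> smooth_field U W ->
  cov u (fun y => V y + W y) x = cov u V x + cov u W x.
Proof.
move=> Ux sV sW; rewrite /cov trilinDr addrACA; congr (_ + _).
apply/rowP => k; rewrite !mxE -alongD.
- by apply: (eq_along u oU Ux) => y _; rewrite mxE.
- exact: smooth_fieldW Ux k.
- exact: smooth_fieldW Ux k.
Qed.

Lemma covZ u f W x : U x -> smooth_on U f -> smooth_field U W ->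
  cov u (fun y => f y *: W y) x = along u f x *: W x + f x *: cov u W x.
Proof.
move=> Ux sf sW; rewrite /cov trilinZr scalerDr addrA; congr (_ + _).
apply/rowP => k; rewrite !mxE -alongM.
- by apply: (eq_along u oU Ux) => y _; rewrite mxE.
- exact: smooth_differentiable Ux.
- exact: smooth_fieldW Ux k.
Qed.

Lemma covN u W x : U x -> smooth_field U W -> cov u (fun y => - W y) x = - cov u W x.
Proof.
move=> Ux sW; rewrite -scaleN1r -[RHS]add0r -(scale0r (W x)).
rewrite -{1}(along_cst u (-1) x) -covZ //; last exact: smooth_cst.
by apply: eq_cov => // y _; rewrite scaleN1r.
Qed.

Lemma smooth_christoffel i j k : smooth_on U (chr i j k).
Proof.
apply: smoothM => //; first exact: smooth_cst.
apply: smooth_sum => // l; apply: smoothM => //; first exact: smooth_invmx.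
apply: smoothD => //; last by apply: smoothN => //; exact: smooth_partial.
by apply: smoothD => //; exact: smooth_partial.
Qed.

Lemma smooth_cov V W : smooth_field U V -> smooth_field U W ->
  smooth_field U (fun x => cov (V x) W x).
Proof.
move=> sV sW; apply: smooth_fieldD => //; first exact: smooth_along_row.
by apply: smooth_trilin => //; exact: smooth_christoffel.
Qed.

Lemma smooth_bracket V W : smooth_field U V -> smooth_field U W ->
  smooth_field U (bracket V W).
Proof. by move=> sV sW; apply: smooth_fieldB => //; exact: smooth_along_row. Qed.

Lemma smooth_inner V W : smooth_field U V -> smooth_field U W ->
  smooth_on U (fun x => inner (G x) (V x) (W x)).
Proof.
move=> sV sW; apply: (smooth_on_eq oU
  (f := fun x => \sum_i \sum_j V x 0 i * G x i j * W x 0 j)).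
  by move=> x _; rewrite innerE.
by do 2![apply: smooth_sum => // ?]; apply: smoothM => //; apply: smoothM.
Qed.

Lemma near_symG x : U x -> \forall y \near x, (G y)^T = G y.
Proof. by move=> Ux; exact: open_near Ux symG. Qed.

Lemma bracket_cov V W x : U x -> bracket V W x = cov (V x) W x - cov (W x) V x.
Proof.
move=> Ux; rewrite /cov [trilin _ (W x) _]trilinC; last first.
  by move=> i j k; apply: christoffel_sym; exact: near_symG.
by rewrite opprD addrACA subrr addr0.
Qed.

Lemma along_bracket V W f x : U x ->
  smooth_field U V -> smooth_field U W -> smooth_on U f ->
  along (bracket V W x) f x =
  along (V x) (fun y => along (W y) f y) x - along (W x) (fun y => along (V y) f y) x.
Proof. by move=> Ux sV sW sf; rewrite (along_commutator oU Ux). Qed.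

Lemma along_inner u V W x : U x -> smooth_field U V -> smooth_field U W ->
  along u (fun y => inner (G y) (V y) (W y)) x =
  inner (G x) (cov u V x) (W x) + inner (G x) (V x) (cov u W x).
Proof.
move=> Ux sV sW.
(* [N] is the matrix of [w |-> trilin (gamma x) u w]. Metric compatibility then reads dG = N G + G
   N^T, and the connection terms of the two covariant derivatives account exactly for dG. *)
pose N : 'M[R]_n := \matrix_(i, k) \sum_a u 0 a * chr a i k x.
have trilinN w : trilin (gamma x) u w = w *m N.
  apply/rowP => k; rewrite !mxE exchange_big; apply: eq_bigr => i _ /=.
  by rewrite mxE mulr_sumr; apply: eq_bigr => a _; rewrite mulrAC mulrA [w 0 i * _]mulrC mulrAC.
pose dG : 'M[R]_n := \matrix_(i, j) along u (fun y => G y i j) x.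
have dGE : dG = N *m G x + G x *m N^T.
  apply/matrixP => i j; rewrite !mxE.
  transitivity (\sum_k u 0 k *
      \sum_l (chr k i l x * G x l j + chr k j l x * G x i l)).
    apply: eq_bigr => k _; congr (_ * _).
    by apply: christoffel_metric; [exact: near_symG | exact: uG].
  under eq_bigr do rewrite mulr_sumr.
  rewrite exchange_big -big_split; apply: eq_bigr => l _ /=.
  rewrite !mxE mulr_suml mulr_sumr -big_split; apply: eq_bigr => k _ /=.
  by rewrite mulrDr mulrA [G x i l * _]mulrC mulrA.
have dV := smooth_fieldW sV Ux; have dW := smooth_fieldW sW Ux.
have dGd i j := smooth_differentiable (sG i j) Ux.
transitivity (inner (G x) (along_row u V x) (W x) + inner dG (V x) (W x)
   + inner (G x) (V x) (along_row u W x)).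
  rewrite (eq_along u oU Ux (g := fun y => \sum_i \sum_j V y 0 i * G y i j * W y 0 j));
    last by move=> y _; rewrite innerE.
  rewrite !innerE along_sum => [|i]; last first.
    apply: differentiable_bigsum => j; apply: differentiableM => //.
    exact: differentiableM.
  rewrite -!big_split; apply: eq_bigr => i _ /=.
  rewrite along_sum => [|j]; last by do 2![apply: differentiableM => //].
  rewrite -!big_split; apply: eq_bigr => j _ /=.
  rewrite alongM //; last exact: differentiableM.
  by rewrite alongM // !mxE; ring.
have E : inner dG (V x) (W x) = inner (G x) (V x *m N) (W x) +
    inner (G x) (V x) (W x *m N).
  by rewrite dGE /inner mulmxDr mulmxDl [LHS]mxE trmx_mul !mulmxA.
by rewrite /cov innerDl innerDr !trilinN E; ring.
Qed.

Definition dgamma v x i j k : R := along v (chr i j k) x.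

(** The classical coordinate formula for the Riemann tensor. It depends only on the values of the
    three vectors, so that pointwise linear algebra requires no extension to fields. *)
Definition curv u v w x : 'rV[R]_n :=
  trilin (dgamma u x) v w - trilin (dgamma v x) u w
  + trilin (gamma x) u (trilin (gamma x) v w)
  - trilin (gamma x) v (trilin (gamma x) u w).

(** The second derivatives of [Z] reduce to its derivative along the bracket, which the last term
    removes; the derivatives of [V] and [W] inside the Christoffel terms cancel in the same way. *)
Lemma curvE V W Z x : U x -> smooth_field U V -> smooth_field U W ->
  smooth_field U Z ->
  curv (V x) (W x) (Z x) x =
  cov (V x) (fun y => cov (W y) Z y) x - cov (W x) (fun y => cov (V y) Z y) x
  - cov (bracket V W x) Z x.
Proof.
move=> Ux sV sW sZ.
have E Y Y' : smooth_field U Y -> smooth_field U Y' ->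
    cov (Y x) (fun y => cov (Y' y) Z y) x =
    along_row (Y x) (fun y => along_row (Y' y) Z y) x
    + (trilin (gamma x) (along_row (Y x) Y' x) (Z x)
       + trilin (gamma x) (Y' x) (along_row (Y x) Z x)
       + trilin (dgamma (Y x) x) (Y' x) (Z x))
    + (trilin (gamma x) (Y x) (along_row (Y' x) Z x)
       + trilin (gamma x) (Y x) (trilin (gamma x) (Y' x) (Z x))).
  move=> sY sY'; rewrite {1}/cov -trilinDr; congr (_ + _).
  rewrite -(along_trilin _ oU Ux sY' sZ smooth_christoffel).
  apply/rowP => k; rewrite !mxE.
  rewrite -alongD; first 1 last.
  - exact: smooth_fieldW (smooth_along_row oU sY' sZ) Ux k.
  - by apply: smooth_fieldW Ux k; apply: smooth_trilin => //; exact: smooth_christoffel.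
  by apply: (eq_along _ oU Ux) => y _; rewrite mxE.
have C : along_row (V x) (fun y => along_row (W y) Z y) x
    - along_row (W x) (fun y => along_row (V y) Z y) x = along_row (bracket V W x) Z x.
  apply/rowP => k; rewrite !mxE along_bracket //.
  by congr (_ - _); apply: (eq_along _ oU Ux) => y _; rewrite mxE.
rewrite !E // /cov -C /bracket trilinDl trilinNl /curv.
by apply/rowP => k; rewrite !mxE; ring.
Qed.

Lemma bracket_cst u v x : bracket (fun=> u) (fun=> v) x = 0.
Proof.
by apply/rowP => k; rewrite !mxE !along_cst subrr.
Qed.

Lemma riemannE u v w x : U x -> riemann G u v w x = curv u v w x.
Proof.
move=> Ux; have sc a := smooth_field_cst (U := U) a oU.
rewrite (curvE Ux (sc u) (sc v) (sc w)) bracket_cst cov0l subr0 /riemann.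
rewrite !nabla_cov; congr (_ - _).
  by apply: eq_cov => // y _; rewrite nabla_cov.
by apply: eq_cov => // y _; rewrite nabla_cov.
Qed.

End LeviCivita.

(** * Naturality under changes of coordinates *)

Section Naturality.
Context {R : realType} {n : nat}.
Variables (U U' : set 'rV[R]_n) (t s : 'rV[R]_n -> 'rV[R]_n).
Variables (G G' : 'rV[R]_n -> 'M[R]_n).
Hypotheses (oU : open U) (oU' : open U').
Hypotheses (tU : forall x, U x -> U' (t x)) (sU : forall y, U' y -> U (s y)).
Hypotheses (stK : forall x, U x -> s (t x) = x) (tsK : forall y, U' y -> t (s y) = y).
Hypotheses (st : smooth_field U t) (ss : smooth_field U' s).
Implicit Types (u v w x y : 'rV[R]_n) (V W Z : 'rV[R]_n -> 'rV[R]_n).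

Local Notation push x u := (along_row u t x).

Definition related V (V' : 'rV[R]_n -> 'rV[R]_n) := forall x, U x -> V' (t x) = push x (V x).

Lemma along_push (f' : 'rV[R]_n -> R) u x : U x -> smooth_on U' f' ->
  along (push x u) f' (t x) = along u (fun y => f' (t y)) x.
Proof.
move=> Ux sf'; have dt := smooth_fieldW st Ux.
transitivity (\sum_k \sum_i u 0 i * partial i (fun y => t y 0 k) x * partial k f' (t x)).
  by apply: eq_bigr => k _; rewrite mxE /along mulr_suml.
rewrite exchange_big; apply: eq_bigr => i _ /=.
rewrite partial_comp; last 2 first.
- exact: (smooth_differentiable sf' (tU Ux)).
- exact: differentiable_row.
by rewrite mulr_sumr; apply: eq_bigr => l _; rewrite mulrAC mulrA.
Qed.

(** Chain rule for [t] composed with [s]. Every vector at [t x] is thus a push-forward, so testing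
    against push-forwards suffices in [related_cov]. *)
Lemma pushK w x : U x -> push x (along_row w s (t x)) = w.
Proof.
move=> Ux; apply/rowP => k; rewrite !mxE.
have -> : along (along_row w s (t x)) (fun y => t y 0 k) x =
          along w (fun y => t (s y) 0 k) (t x).
  have ds := smooth_fieldW ss (tU Ux).
  transitivity (\sum_l \sum_i w 0 i * partial i (fun y => s y 0 l) (t x)
      * partial l (fun y => t y 0 k) x).
    by apply: eq_bigr => l _; rewrite mxE /along mulr_suml.
  rewrite exchange_big; apply: eq_bigr => i _ /=.
  rewrite (@partial_comp _ _ _ (fun z => t z 0 k)); last 2 first.
  - by rewrite stK //; exact: smooth_fieldW Ux k.
  - exact: differentiable_row.
  by rewrite stK // mulr_sumr; apply: eq_bigr => l _; rewrite mulrAC mulrA.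
rewrite (eq_along w oU' (tU Ux) (g := fun y => y 0 k)); last by move=> y /tsK ->.
rewrite along_derive; last exact: differentiable_coord.
rewrite -(derive_entry (t := id)) ?derive_id //; exact: ex_diff.
Qed.

Lemma pushD x u v : push x (u + v) = push x u + push x v.
Proof. by apply/rowP => k; rewrite !mxE alongDl. Qed.

Lemma pushZ x a u : push x (a *: u) = a *: push x u.
Proof. by apply/rowP => k; rewrite !mxE alongZl. Qed.

Lemma pushB x u v : push x (u - v) = push x u - push x v.
Proof. by rewrite pushD -scaleN1r pushZ scaleN1r. Qed.

Lemma related_push V : related V (fun y => push (s y) (V (s y))).
Proof. by move=> x Ux; rewrite stK. Qed.

Lemma smooth_push V : smooth_field U V ->
  smooth_field U' (fun y => push (s y) (V (s y))).
Proof.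
move=> sV k.
exact: (smooth_comp oU' (smooth_along_row oU sV st k) ss sU).
Qed.

Lemma related_bracket V W V' W' : smooth_field U V -> smooth_field U W ->
  smooth_field U' V' -> smooth_field U' W' -> related V V' -> related W W' ->
  related (bracket V W) (bracket V' W').
Proof.
move=> sV sW sV' sW' rV rW x Ux; apply/rowP => k.
rewrite [RHS]mxE (along_bracket oU Ux sV sW (st k)) !mxE.
rewrite (rV x Ux) (rW x Ux) (along_push _ Ux (sW' k)) (along_push _ Ux (sV' k)).
by congr (_ - _); apply: (eq_along _ oU Ux) => y Uy; rewrite ?rV ?rW // mxE.
Qed.

Hypotheses (sG : forall i j, smooth_on U (fun x => G x i j))
  (symG : forall x, U x -> (G x)^T = G x) (uG : forall x, U x -> G x \in unitmx).
Hypotheses (sG' : forall i j, smooth_on U' (fun x => G' x i j))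
  (symG' : forall x, U' x -> (G' x)^T = G' x) (uG' : forall x, U' x -> G' x \in unitmx).
Hypothesis isom : forall x, U x -> forall u v,
  inner (G x) u v = inner (G' (t x)) (push x u) (push x v).

(** The right-hand side involves only the metric and brackets, both preserved by an isometric change
    of coordinates. Naturality of the connection follows without the transformation law of
    Christoffel symbols. *)
Lemma koszul (O : set 'rV[R]_n) (H : 'rV[R]_n -> 'M[R]_n) V W Z x :
  open O -> (forall i j, smooth_on O (fun x => H x i j)) ->
  (forall x, O x -> (H x)^T = H x) -> (forall x, O x -> H x \in unitmx) ->
  O x -> smooth_field O V -> smooth_field O W -> smooth_field O Z ->
  inner (H x) (cov H (V x) W x) (Z x) *+ 2 =
    along (V x) (fun y => inner (H y) (W y) (Z y)) x
  + along (W x) (fun y => inner (H y) (V y) (Z y)) x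
  - along (Z x) (fun y => inner (H y) (V y) (W y)) x
  + inner (H x) (bracket V W x) (Z x)
  - inner (H x) (bracket V Z x) (W x) - inner (H x) (bracket W Z x) (V x).
Proof.
move=> oO sH symH uH Ox sV sW sZ.
rewrite !(along_inner oO sH symH uH) // !(bracket_cov oO symH) // !innerBl.
have C a b := innerC a b (symH x Ox).
rewrite (C _ (W x)) (C (V x) (cov H (W x) Z x)) (C (V x) (cov H (Z x) W x)).
rewrite (C (W x) (cov H (Z x) V x)) !(C _ (W x)).
by ring.
Qed.

Lemma related_cov V W V' W' : smooth_field U V -> smooth_field U W ->
  smooth_field U' V' -> smooth_field U' W' -> related V V' -> related W W' ->
  related (fun x => cov G (V x) W x) (fun y => cov G' (V' y) W' y).
Proof.
move=> sV sW sV' sW' rV rW x Ux.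
apply: (inner_nondeg (uG' (tU Ux))) => w'.
rewrite -(pushK w' Ux); set w := along_row w' s (t x).
(* The test vector is extended by a constant field and by the push-forward of that field, so that
   the two Koszul formulas are evaluated on related triples. *)
pose Z (_ : 'rV[R]_n) := w; pose Z' y := push (s y) (Z (s y)).
have sZ : smooth_field U Z by exact: smooth_field_cst.
have sZ' : smooth_field U' Z' by exact: smooth_push.
have rZ : related Z Z' by exact: related_push.
have Z'x : push x w = Z' (t x) by rewrite rZ.
rewrite -(isom Ux) Z'x.
suff : inner (G' (t x)) (cov G' (V' (t x)) W' (t x)) (Z' (t x)) *+ 2 =
       inner (G x) (cov G (V x) W x) w *+ 2.
  by move=> E; exact: (pmulrnI (ltn0Sn 1) E).
rewrite (koszul oU' sG' symG' uG' (tU Ux) sV' sW' sZ').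
rewrite (koszul oU sG symG uG Ux sV sW sZ).
rewrite (related_bracket sV sW sV' sW' rV rW Ux).
rewrite (related_bracket sV sZ sV' sZ' rV rZ Ux).
rewrite (related_bracket sW sZ sW' sZ' rW rZ Ux).
rewrite (rV x Ux) (rW x Ux) (rZ x Ux) -!(isom Ux).
rewrite (along_push _ Ux (smooth_inner oU' sG' sW' sZ')).
rewrite (along_push _ Ux (smooth_inner oU' sG' sV' sZ')).
rewrite (along_push _ Ux (smooth_inner oU' sG' sV' sW')).
have E Y Y' X X' : related Y Y' -> related X X' -> forall y, U y ->
    inner (G' (t y)) (Y' (t y)) (X' (t y)) = inner (G y) (Y y) (X y).
  by move=> rY rX y Uy; rewrite (rY y Uy) (rX y Uy) -(isom Uy).
rewrite (eq_along _ oU Ux (E _ _ _ _ rW rZ)) (eq_along _ oU Ux (E _ _ _ _ rV rZ)).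
by rewrite (eq_along _ oU Ux (E _ _ _ _ rV rW)).
Qed.

Lemma related_curv V W Z V' W' Z' x : smooth_field U V -> smooth_field U W ->
  smooth_field U Z -> smooth_field U' V' -> smooth_field U' W' ->
  smooth_field U' Z' -> related V V' -> related W W' -> related Z Z' -> U x ->
  curv G' (V' (t x)) (W' (t x)) (Z' (t x)) (t x) = push x (curv G (V x) (W x) (Z x) x).
Proof.
move=> sV sW sZ sV' sW' sZ' rV rW rZ Ux.
rewrite (curvE oU' sG' uG' (tU Ux) sV' sW' sZ').
rewrite (curvE oU sG uG Ux sV sW sZ) !pushB.
congr (_ - _ - _).
- exact: (related_cov sV (smooth_cov oU sG uG sW sZ) sV'
    (smooth_cov oU' sG' uG' sW' sZ') rV (related_cov sW sZ sW' sZ' rW rZ) Ux).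
- exact: (related_cov sW (smooth_cov oU sG uG sV sZ) sW'
    (smooth_cov oU' sG' uG' sV' sZ') rW (related_cov sV sZ sV' sZ' rV rZ) Ux).
- exact: (related_cov (smooth_bracket oU sV sW) sZ
    (smooth_bracket oU' sV' sW') sZ' (related_bracket sV sW sV' sW' rV rW) rZ Ux).
Qed.

End Naturality.

(** * Orthonormal frames *)

Section MetricTrace.
Context {R : realType} {n : nat}.
Implicit Types (G : 'M[R]_n) (u v w : 'rV[R]_n) (q : 'rV[R]_n -> 'rV[R]_n -> R)
  (e : 'I_n -> 'rV[R]_n).

Definition bilinear_form q :=
  (forall a u v w, q (a *: u + v) w = a * q u w + q v w) /\
  (forall a u v w, q w (a *: u + v) = a * q w u + q w v).

Lemma linear_form_sum (h : 'rV[R]_n -> R) (I : Type) (r : seq I) (c : I -> R) (v : I -> 'rV[R]_n) :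
  (forall a u v, h (a *: u + v) = a * h u + h v) ->
  h (\sum_(i <- r) c i *: v i) = \sum_(i <- r) c i * h (v i).
Proof.
move=> hl; have h0 : h 0 = 0.
  by have := hl (-1) 0 0; rewrite scaler0 addr0 mulN1r addNr.
by elim: r => [|i r IH]; rewrite ?big_nil // !big_cons hl IH.
Qed.

Lemma bilinear_form_sum q (I : Type) (r : seq I) (c d : I -> R) (u v : I -> 'rV[R]_n) :
  bilinear_form q ->
  q (\sum_(i <- r) c i *: u i) (\sum_(j <- r) d j *: v j) =
  \sum_(i <- r) \sum_(j <- r) c i * d j * q (u i) (v j).
Proof.
move=> [ql qr]; rewrite (@linear_form_sum (q ^~ _)) //; apply: eq_bigr => i _.
rewrite (@linear_form_sum (q (u i))) // mulr_sumr.
by apply: eq_bigr => j _; rewrite mulrA.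
Qed.

Definition orthonormal_frame G e := forall a b, inner G (e a) (e b) = (a == b)%:R.

(** Trace with an index raised by the inverse metric: given in coordinates, hence manifestly smooth,
    yet computable in any orthonormal frame by [metric_trace_frame]. *)
Definition metric_trace G q : R :=
  \sum_k \sum_l invmx G k l * q (delta_mx 0 k) (delta_mx 0 l).

Definition frame_mx e : 'M[R]_n := \matrix_a e a.

Lemma frame_mxP G e : orthonormal_frame G e -> frame_mx e *m G *m (frame_mx e)^T = 1%:M.
Proof.
move=> oe; apply/matrixP => a b.
have -> : (frame_mx e *m G *m (frame_mx e)^T) a b = inner G (e a) (e b).
  rewrite innerE mxE exchange_big; apply: eq_bigr => j _ /=.
  rewrite !mxE mulr_suml; apply: eq_bigr => i _.
  by rewrite !mxE.
by rewrite oe !mxE.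
Qed.

(** With the frame as the rows of E, orthonormality is E G E^T = 1; for square matrices this gives G
    E^T E = 1. *)
Lemma invmx_frame G e : orthonormal_frame G e -> invmx G = (frame_mx e)^T *m frame_mx e.
Proof.
move=> /frame_mxP; rewrite -mulmxA => /mulmx1C; rewrite -mulmxA => E.
have [Gu _] := mulmx1_unit E.
by rewrite -[RHS](mulKmx Gu) E mulmx1.
Qed.

Lemma invmx_frameE G e k l : orthonormal_frame G e ->
  invmx G k l = \sum_a e a 0 k * e a 0 l.
Proof.
by move=> /invmx_frame ->; rewrite mxE; apply: eq_bigr => a _; rewrite !mxE.
Qed.

Lemma frame_expand G e u : orthonormal_frame G e -> u = \sum_a inner G u (e a) *: e a.
Proof.
move=> oe; have := frame_mxP oe; rewrite -mulmxA => /mulmx1C; rewrite -mulmxA => E.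
rewrite -[LHS]mulmx1 -E !mulmxA; apply/rowP => k; rewrite summxE mxE.
apply: eq_bigr => a _; rewrite !mxE; congr (_ * _).
by rewrite /inner [RHS]mxE; apply: eq_bigr => j _; rewrite !mxE.
Qed.

Lemma metric_trace_frame G q e : bilinear_form q -> orthonormal_frame G e ->
  metric_trace G q = \sum_a q (e a) (e a).
Proof.
move=> bq oe; under [RHS]eq_bigr => a _.
  rewrite [X in q X _]rowE_delta [X in q _ X]rowE_delta bilinear_form_sum //.
  over.
rewrite exchange_big; apply: eq_bigr => k _ /=.
rewrite exchange_big; apply: eq_bigr => l _ /=.
by rewrite (invmx_frameE _ _ oe) mulr_suml.
Qed.

(** Lowering and raising an index cancel out. This converts the coordinate traces behind
    [divergence] and [ricci] into frame sums. *)
Lemma metric_trace_endo G (T : 'rV[R]_n -> 'rV[R]_n) : G^T = G -> G \in unitmx ->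
  metric_trace G (fun u v => inner G (T u) v) = \sum_k T (delta_mx 0 k) 0 k.
Proof.
move=> GT Gu; apply: eq_bigr => k _; set w := T _.
transitivity ((w *m G *m invmx G) 0 k); last by rewrite mulmxK.
rewrite mxE; apply: eq_bigr => l _; rewrite mulrC.
have -> : invmx G k l = invmx G l k by rewrite -{1}GT -trmx_inv mxE.
congr (_ * _); rewrite innerE mxE; apply: eq_bigr => i _.
rewrite (bigD1 l) //= mxE !eqxx mulr1 big1 ?addr0 // => j jl.
by rewrite mxE eqxx /= (negbTE jl) mulr0.
Qed.

End MetricTrace.

(** * Algebraic symmetries of the curvature tensor *)

Section CurvatureSymmetries.
Context {R : realType} {n : nat}.
Variables (G : 'rV[R]_n -> 'M[R]_n) (U : set 'rV[R]_n).
Implicit Types (u v w x : 'rV[R]_n).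

Lemma trilin_dgammaP a u u' v w x :
  trilin (dgamma G (a *: u + u') x) v w =
  a *: trilin (dgamma G u x) v w + trilin (dgamma G u' x) v w.
Proof.
apply/rowP => k; rewrite !mxE mulr_sumr -big_split; apply: eq_bigr => i _ /=.
rewrite mulr_sumr -big_split; apply: eq_bigr => j _ /=.
by rewrite /dgamma alongDl alongZl; ring.
Qed.

Lemma curv_antisym u v w x : curv G u v w x = - curv G v u w x.
Proof. by apply/rowP => k; rewrite /curv !mxE; ring. Qed.

Lemma curv_linear1 a u u' v w x :
  curv G (a *: u + u') v w x = a *: curv G u v w x + curv G u' v w x.
Proof.
rewrite /curv trilin_dgammaP !trilinDl !trilinZl !trilinDr !trilinZr.
by apply/rowP => k; rewrite !mxE; ring.
Qed.

Lemma curv_linear2 a u v v' w x :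
  curv G u (a *: v + v') w x = a *: curv G u v w x + curv G u v' w x.
Proof.
rewrite curv_antisym curv_linear1 [curv G u v _ _]curv_antisym.
by rewrite [curv G u v' _ _]curv_antisym scalerN opprD.
Qed.

Lemma curv_linear3 a u v w w' x :
  curv G u v (a *: w + w') x = a *: curv G u v w x + curv G u v w' x.
Proof.
rewrite /curv !trilinDr !trilinZr.
by apply/rowP => k; rewrite !mxE; ring.
Qed.

Lemma curv0l v w x : curv G 0 v w x = 0.
Proof. by have := curv_linear1 (-1) 0 0 v w x; rewrite scaler0 addr0 scaleN1r addNr. Qed.

Lemma curv0r u v x : curv G u v 0 x = 0.
Proof. by have := curv_linear3 (-1) u v 0 0 x; rewrite scaler0 addr0 scaleN1r addNr. Qed.

Hypotheses (oU : open U) (sG : forall i j, smooth_on U (fun x => G x i j))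
  (symG : forall x, U x -> (G x)^T = G x) (uG : forall x, U x -> G x \in unitmx).

Lemma curv_cst u v w x : U x ->
  curv G u v w x = cov G u (cov G v (fun=> w)) x - cov G v (cov G u (fun=> w)) x.
Proof.
move=> Ux; have sc a := smooth_field_cst (U := U) a oU.
by rewrite (curvE oU sG uG Ux (sc u) (sc v) (sc w)) bracket_cst cov0l subr0.
Qed.

(** Derivatives of [inner (G y) w z] along the constant fields [u] and [v] commute. Expanding both
    orders by metric compatibility, the products of first derivatives cancel and the curvature terms
    remain. *)
Lemma curv_skew u v w z x : U x ->
  inner (G x) (curv G u v w x) z = - inner (G x) (curv G u v z x) w.
Proof.
move=> Ux; have sc a := smooth_field_cst (U := U) a oU.
have E a b : along a (fun y => along b (fun y => inner (G y) w z) y) x =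
    inner (G x) (cov G a (cov G b (fun=> w)) x) z
    + inner (G x) (cov G b (fun=> w) x) (cov G a (fun=> z) x)
    + (inner (G x) (cov G a (fun=> w) x) (cov G b (fun=> z) x)
    + inner (G x) w (cov G a (cov G b (fun=> z)) x)).
  have sb c := smooth_cov oU sG uG (sc b) (sc c).
  rewrite (eq_along a oU Ux (g := fun y => inner (G y) (cov G b (fun=> w) y) z
      + inner (G y) w (cov G b (fun=> z) y))); last first.
    by move=> y Uy; rewrite (along_inner oU sG symG uG b Uy (sc w) (sc z)).
  rewrite alongD; first 1 last.
  - exact: smooth_differentiable (smooth_inner oU sG (sb w) (sc z)) Ux.
  - exact: smooth_differentiable (smooth_inner oU sG (sc w) (sb z)) Ux.
  by rewrite (along_inner oU sG symG uG a Ux (sb w) (sc z))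
    (along_inner oU sG symG uG a Ux (sc w) (sb z)).
have C : along u (fun y => along v (fun y => inner (G y) w z) y) x =
         along v (fun y => along u (fun y => inner (G y) w z) y) x.
  have := along_commutator oU Ux (sc u) (sc v) (smooth_inner oU sG (sc w) (sc z)).
  have -> : along_row u (fun=> v) x - along_row v (fun=> u) x = 0.
    exact: (bracket_cst u v x).
  by rewrite along0l => /eqP; rewrite subr_eq0 => /eqP.
rewrite !curv_cst // !innerBl [in RHS](innerC _ w (symG Ux)).
rewrite [X in _ = - (_ - X)](innerC _ w (symG Ux)).
by move: C; rewrite !E => C; lra.
Qed.

(** Constant fields have zero bracket, so by torsion-freeness the derivative of [c] along [b] equals
    that of [b] along [c], and the six second derivatives cancel in pairs. *)
Lemma curv_bianchi u v w x : U x ->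
  curv G u v w x + curv G v w u x + curv G w u v x = 0.
Proof.
move=> Ux; have sc a := smooth_field_cst (U := U) a oU.
have S a b c : cov G a (cov G b (fun=> c)) x = cov G a (cov G c (fun=> b)) x.
  apply: (eq_cov G oU a Ux) => y Uy; apply/eqP; rewrite -subr_eq0; apply/eqP.
  have := bracket_cov oU symG (fun=> b) (fun=> c) Uy.
  by rewrite bracket_cst => <-.
rewrite !curv_cst // (S u v w) (S v w u) (S w u v).
do 3![move: (cov G _ _ x) => ?].
by apply/rowP => k; rewrite !mxE; ring.
Qed.

End CurvatureSymmetries.

Section Frame3.
Context {R : realType}.
Implicit Types (G : 'M[R]_3) (u v w : 'rV[R]_3).

Record ortho3 G (e1 e2 e3 : 'rV[R]_3) : Prop := Ortho3 {
  ortho11 : inner G e1 e1 = 1;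
  ortho22 : inner G e2 e2 = 1;
  ortho33 : inner G e3 e3 = 1;
  ortho12 : inner G e1 e2 = 0;
  ortho13 : inner G e1 e3 = 0;
  ortho23 : inner G e2 e3 = 0 }.

Definition frame3 (e1 e2 e3 : 'rV[R]_3) (a : 'I_3) : 'rV[R]_3 :=
  nth 0 [:: e1; e2; e3] a.

Variables (G : 'M[R]_3) (e1 e2 e3 : 'rV[R]_3).
Hypotheses (GT : G^T = G) (oe : ortho3 G e1 e2 e3).

Lemma ortho3P : orthonormal_frame G (frame3 e1 e2 e3).
Proof.
case: oe => o11 o22 o33 o12 o13 o23.
have o21 := etrans (innerC e2 e1 GT) o12.
have o31 := etrans (innerC e3 e1 GT) o13.
have o32 := etrans (innerC e3 e2 GT) o23.
by case=> [[|[|[|//]]] ?] [[|[|[|//]]] ?].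
Qed.

Lemma sum3 (V : nmodType) (F : 'rV[R]_3 -> V) :
  \sum_a F (frame3 e1 e2 e3 a) = F e1 + F e2 + F e3.
Proof. by rewrite !big_ord_recl big_ord0 /= addr0 addrA. Qed.

Lemma frame3_expand u :
  u = inner G u e1 *: e1 + inner G u e2 *: e2 + inner G u e3 *: e3.
Proof.
by rewrite {1}(frame_expand u ortho3P) (sum3 (fun e => inner G u e *: e)).
Qed.

Lemma metric_trace3 q : bilinear_form q ->
  metric_trace G q = q e1 e1 + q e2 e2 + q e3 e3.
Proof.
by move=> bq; rewrite (metric_trace_frame bq ortho3P) (sum3 (fun e => q e e)).
Qed.

End Frame3.

(** * Structure equations of an adapted frame *)

Section AdaptedFrame.
Context {R : realType}.
Variables (G : 'rV[R]_3 -> 'M[R]_3) (U : set 'rV[R]_3).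
Hypotheses (oU : open U) (sG : forall i j, smooth_on U (fun x => G x i j))
  (symG : forall x, U x -> (G x)^T = G x) (uG : forall x, U x -> G x \in unitmx).
Variables (e1 e2 X : 'rV[R]_3 -> 'rV[R]_3).
Hypotheses (s1 : smooth_field U e1) (s2 : smooth_field U e2) (sX : smooth_field U X).
Hypothesis oe : forall x, U x -> ortho3 (G x) (e1 x) (e2 x) (X x).

Definition coef_b x := inner (G x) (cov G (e2 x) X x) (e1 x).
Definition coef_alpha x := inner (G x) (cov G (e1 x) e1 x) (e2 x).
Definition coef_beta x := inner (G x) (cov G (e2 x) e1 x) (e2 x).
Definition coef_mu x := inner (G x) (cov G (X x) e1 x) (e2 x).
Local Notation b := coef_b.
Local Notation al := coef_alpha.
Local Notation be := coef_beta.
Local Notation mu := coef_mu.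

Hypothesis cov1X : forall x, U x -> cov G (e1 x) X x = 0.
Hypothesis cov2X : forall x, U x -> cov G (e2 x) X x = b x *: e1 x.
Hypothesis covXX : forall x, U x -> cov G (X x) X x = 0.

Lemma smooth_b : smooth_on U b.
Proof. by apply: smooth_inner => //; exact: smooth_cov. Qed.
Lemma smooth_beta : smooth_on U be.
Proof. by apply: smooth_inner => //; exact: smooth_cov. Qed.
Lemma smooth_mu : smooth_on U mu.
Proof. by apply: smooth_inner => //; exact: smooth_cov. Qed.

(** A constant inner product has zero derivative. Applied to the frame, this makes the connection
    matrix antisymmetric, so few coefficients are left. *)
Lemma cov_skew u V W c x : U x -> smooth_field U V -> smooth_field U W ->
  (forall y, U y -> inner (G y) (V y) (W y) = c) ->
  inner (G x) (cov G u V x) (W x) = - inner (G x) (cov G u W x) (V x).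
Proof.
move=> Ux sV sW VWc; apply/eqP; rewrite -addr_eq0; apply/eqP.
rewrite [X in _ + X](innerC _ _ (symG Ux)).
by rewrite -(along_inner oU sG symG uG u Ux sV sW) (eq_along u oU Ux VWc) along_cst.
Qed.

Lemma cov_unit u V c x : U x -> smooth_field U V ->
  (forall y, U y -> inner (G y) (V y) (V y) = c) ->
  inner (G x) (cov G u V x) (V x) = 0.
Proof. by move=> Ux sV Vc; have := cov_skew u Ux sV sV Vc; lra. Qed.

Let o11 x (Ux : U x) := ortho11 (oe Ux).
Let o22 x (Ux : U x) := ortho22 (oe Ux).
Let o33 x (Ux : U x) := ortho33 (oe Ux).
Let o12 x (Ux : U x) := ortho12 (oe Ux).
Let o13 x (Ux : U x) := ortho13 (oe Ux).
Let o23 x (Ux : U x) := ortho23 (oe Ux).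
Let o21 x (Ux : U x) := etrans (innerC (e2 x) (e1 x) (symG Ux)) (o12 Ux).
Let o31 x (Ux : U x) := etrans (innerC (X x) (e1 x) (symG Ux)) (o13 Ux).
Let o32 x (Ux : U x) := etrans (innerC (X x) (e2 x) (symG Ux)) (o23 Ux).
Let expand x (Ux : U x) u := frame3_expand (symG Ux) (oe Ux) u.

Lemma cov11 x : U x -> cov G (e1 x) e1 x = al x *: e2 x.
Proof.
move=> Ux; rewrite [LHS](expand Ux) (cov_unit _ Ux s1 o11).
rewrite (cov_skew _ Ux s1 sX o13) (cov1X Ux) inner0l oppr0.
by rewrite !scale0r add0r addr0.
Qed.

Lemma cov12 x : U x -> cov G (e1 x) e2 x = - al x *: e1 x.
Proof.
move=> Ux; rewrite [LHS](expand Ux) (cov_unit _ Ux s2 o22).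
rewrite (cov_skew _ Ux s2 sX o23) (cov1X Ux) inner0l oppr0.
by rewrite (cov_skew _ Ux s2 s1 o21) !scale0r !addr0.
Qed.

Lemma cov21 x : U x -> cov G (e2 x) e1 x = be x *: e2 x - b x *: X x.
Proof.
move=> Ux; rewrite [LHS](expand Ux) (cov_unit _ Ux s1 o11).
rewrite (cov_skew _ Ux s1 sX o13) -/(b x).
by rewrite !scale0r add0r scaleNr.
Qed.

Lemma cov22 x : U x -> cov G (e2 x) e2 x = - be x *: e1 x.
Proof.
move=> Ux; rewrite [LHS](expand Ux) (cov_unit _ Ux s2 o22).
rewrite (cov_skew _ Ux s2 sX o23) (cov2X Ux) innerZl (o12 Ux) mulr0 oppr0.
by rewrite (cov_skew _ Ux s2 s1 o21) !scale0r !addr0.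
Qed.

Lemma covX1 x : U x -> cov G (X x) e1 x = mu x *: e2 x.
Proof.
move=> Ux; rewrite [LHS](expand Ux) (cov_unit _ Ux s1 o11).
rewrite (cov_skew _ Ux s1 sX o13) (covXX Ux) inner0l oppr0.
by rewrite !scale0r add0r addr0.
Qed.

Lemma covX2 x : U x -> cov G (X x) e2 x = - mu x *: e1 x.
Proof.
move=> Ux; rewrite [LHS](expand Ux) (cov_unit _ Ux s2 o22).
rewrite (cov_skew _ Ux s2 sX o23) (covXX Ux) inner0l oppr0.
by rewrite (cov_skew _ Ux s2 s1 o21) !scale0r !addr0.
Qed.

Lemma bracket12 x : U x ->
  bracket e1 e2 x = - al x *: e1 x - be x *: e2 x + b x *: X x.
Proof.
by move=> Ux; rewrite (bracket_cov oU symG) // cov12 // cov21 // opprB [X in _ + X]addrC addrA.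
Qed.

Lemma bracket1X x : U x -> bracket e1 X x = - mu x *: e2 x.
Proof.
by move=> Ux; rewrite (bracket_cov oU symG) // cov1X // covX1 // sub0r scaleNr.
Qed.

Lemma bracket2X x : U x -> bracket e2 X x = (b x + mu x) *: e1 x.
Proof.
by move=> Ux; rewrite (bracket_cov oU symG) // cov2X // covX2 // scaleNr opprK -scalerDl.
Qed.

Local Notation d1 f x := (along (e1 x) f x).
Local Notation d2 f x := (along (e2 x) f x).
Local Notation d3 f x := (along (X x) f x).

Lemma cov_scale u V W (f : 'rV[R]_3 -> R) x : U x -> smooth_on U f -> smooth_field U W ->
  (forall y, U y -> V y = f y *: W y) ->
  cov G u V x = along u f x *: W x + f x *: cov G u W x.
Proof.
by move=> Ux sf sW VW; rewrite (eq_cov G oU u Ux VW) (covZ G oU u Ux sf sW).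
Qed.

Lemma cov_zero u V x : U x -> (forall y, U y -> V y = 0) -> cov G u V x = 0.
Proof. by move=> Ux V0; rewrite (eq_cov G oU u Ux V0) cov0r. Qed.

Lemma curv12X x : U x ->
  curv G (e1 x) (e2 x) (X x) x =
  (d1 b x + be x * b x) *: e1 x + (b x * al x) *: e2 x.
Proof.
move=> Ux; rewrite (curvE oU sG uG Ux s1 s2 sX).
rewrite (cov_scale _ Ux smooth_b s1 cov2X) (cov_zero _ Ux cov1X) bracket12 //.
rewrite !covDl !covNl !covZl cov1X // cov2X // covXX // cov11 //.
by apply/rowP => k; rewrite !mxE; ring.
Qed.

Lemma curv1XX x : U x ->
  curv G (e1 x) (X x) (X x) x = (b x * mu x) *: e1 x.
Proof.
move=> Ux; rewrite (curvE oU sG uG Ux s1 sX sX).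
rewrite (cov_zero _ Ux covXX) (cov_zero _ Ux cov1X) bracket1X //.
rewrite !covZl cov2X //.
by apply/rowP => k; rewrite !mxE; ring.
Qed.

Lemma curv2XX x : U x ->
  curv G (e2 x) (X x) (X x) x = - d3 b x *: e1 x - (b x * mu x) *: e2 x.
Proof.
move=> Ux; rewrite (curvE oU sG uG Ux s2 sX sX).
rewrite (cov_zero _ Ux covXX) (cov_scale _ Ux smooth_b s1 cov2X) bracket2X //.
rewrite !covZl cov1X // covX1 //.
by apply/rowP => k; rewrite !mxE; ring.
Qed.

(* The trace conditions Ric(X, e1) = Ric(X, e2) = 0 and K(e1, e2) = 0. *)
Hypothesis ric1 : forall x, U x ->
  inner (G x) (curv G (e1 x) (X x) (e2 x) x) (e1 x) = 0.
Hypothesis ric2 : forall x, U x ->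
  inner (G x) (curv G (e2 x) (X x) (e1 x) x) (e2 x) = 0.
Hypothesis sec12 : forall x, U x ->
  inner (G x) (curv G (e1 x) (e2 x) (e2 x) x) (e1 x) = 0.
Hypothesis b_neq0 : forall x, U x -> b x != 0.

Lemma bianchi_along z x : U x ->
  inner (G x) (curv G (e1 x) (e2 x) (X x) x) z
  + inner (G x) (curv G (e2 x) (X x) (e1 x) x) z
  - inner (G x) (curv G (e1 x) (X x) (e2 x) x) z = 0.
Proof.
move=> Ux; have := curv_bianchi oU sG symG uG (e1 x) (e2 x) (X x) Ux.
rewrite [curv G (X x) _ _ _]curv_antisym => E.
by rewrite -innerDl -innerBl E inner0l.
Qed.

Lemma curv_skew_diag u v z x : U x -> inner (G x) (curv G u v z x) z = 0.
Proof. by move=> Ux; have := curv_skew oU sG symG uG u v z z Ux; lra. Qed.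

Lemma d1b x : U x -> d1 b x = - be x * b x.
Proof.
move=> Ux; have := bianchi_along (e1 x) Ux.
rewrite ric1 // curv_skew_diag // curv12X // innerDl !innerZl o11 // o21 //.
lra.
Qed.

(** Since Ric(X, e1) = 0, the Bianchi identity reduces to [b x * al x = 0]. The integral curves of
    e1 are therefore geodesics, and this coefficient disappears from all later equations. *)
Lemma alpha0 x : U x -> al x = 0.
Proof.
move=> Ux; have := bianchi_along (e2 x) Ux.
rewrite ric2 // curv_skew_diag // curv12X // innerDl !innerZl o12 // o22 //.
rewrite mulr0 add0r mulr1 !addr0 oppr0 addr0 => /eqP.
by rewrite mulf_eq0 (negbTE (b_neq0 Ux)) => /eqP.
Qed.

(** The Bianchi identity makes the operator R(_, X)X symmetric on e1 and e2; one off-diagonal entry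
    is [- d3 b], and the other is 0. *)
Lemma d3b x : U x -> d3 b x = 0.
Proof.
move=> Ux; have := bianchi_along (X x) Ux.
rewrite curv_skew_diag // add0r.
rewrite (curv_skew oU sG symG uG _ _ (e1 x) (X x) Ux).
rewrite (curv_skew oU sG symG uG _ _ (e2 x) (X x) Ux).
rewrite curv1XX // curv2XX // innerBl !innerZl o11 // o12 // o21 //.
lra.
Qed.

Let cov11' x : U x -> cov G (e1 x) e1 x = 0.
Proof. by move=> Ux; rewrite cov11 // alpha0 // scale0r. Qed.
Let cov12' x : U x -> cov G (e1 x) e2 x = 0.
Proof. by move=> Ux; rewrite cov12 // alpha0 // oppr0 scale0r. Qed.

Lemma bracket12_simpl x : U x -> bracket e1 e2 x = - be x *: e2 x + b x *: X x.
Proof. by move=> Ux; rewrite bracket12 // alpha0 // oppr0 scale0r sub0r scaleNr. Qed.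

Let smooth_opp (f : 'rV[R]_3 -> R) : smooth_on U f -> smooth_on U (fun y => - f y).
Proof. exact: smoothN. Qed.

(** This equation and the next two are [ric1], [ric2] and [sec12] rewritten in terms of the
    connection coefficients. *)
Lemma d1mu x : U x -> d1 mu x = - be x * mu x.
Proof.
move=> Ux; have := ric1 Ux; rewrite (curvE oU sG uG Ux s1 sX s2).
rewrite (cov_scale _ Ux (smooth_opp smooth_mu) s1 covX2) (cov_zero _ Ux cov12').
rewrite bracket1X // covZl cov22 // cov11' // alongN; last first.
  exact: smooth_differentiable smooth_mu Ux.
rewrite scaler0 addr0 subr0 innerBl !innerZl o11 //.
lra.
Qed.

Lemma d2mu x : U x -> d2 mu x = d3 be x.
Proof.
move=> Ux.
have sbe2 : smooth_field U (fun y => be y *: e2 y).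
  exact: smooth_fieldZ smooth_beta.
have sbX : smooth_field U (fun y => b y *: X y).
  exact: smooth_fieldZ smooth_b.
have E1 : cov G (e2 x) (fun y => cov G (X y) e1 y) x =
    d2 mu x *: e2 x - (mu x * be x) *: e1 x.
  by rewrite (cov_scale _ Ux smooth_mu s2 covX1) (cov22 Ux) scalerA mulrN scaleNr.
have E2 : cov G (X x) (fun y => cov G (e2 y) e1 y) x =
    d3 be x *: e2 x - (be x * mu x) *: e1 x.
  rewrite (eq_cov G oU (X x) Ux cov21) (covD G oU _ Ux sbe2 (smooth_fieldN oU sbX)).
  rewrite (covN G oU _ Ux sbX) (covZ G oU _ Ux smooth_b sX) (covXX Ux) (d3b Ux).
  rewrite scaler0 scale0r addr0 oppr0 addr0 (covZ G oU _ Ux smooth_beta s2).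
  by rewrite (covX2 Ux) scalerA mulrN scaleNr.
have := ric2 Ux; rewrite (curvE oU sG uG Ux s2 sX s1) E1 E2 (bracket2X Ux) covZl.
rewrite (cov11' Ux) scaler0 subr0 !innerBl !innerZl (o22 Ux) (o12 Ux).
by rewrite !mulr1 !mulr0 !subr0 => /eqP; rewrite subr_eq0 => /eqP.
Qed.

Lemma d1be x : U x -> d1 be x = b x * mu x - be x ^+ 2.
Proof.
move=> Ux; have := sec12 Ux; rewrite (curvE oU sG uG Ux s1 s2 s2).
rewrite (cov_scale _ Ux (smooth_opp smooth_beta) s1 cov22) (cov_zero _ Ux cov12').
rewrite bracket12_simpl // covDl !covZl cov22 // covX2 // cov11' //.
rewrite alongN; last exact: smooth_differentiable smooth_beta Ux.
rewrite scaler0 addr0 subr0 innerBl innerDl !innerZl o11 //.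
lra.
Qed.

End AdaptedFrame.

(** * Consequences of the structure equations *)

Section FrameIdentities.
Context {R : realType} {n : nat}.
Variables (U : set 'rV[R]_n) (e1 e2 X : 'rV[R]_n -> 'rV[R]_n).
Variables (b mu be : 'rV[R]_n -> R).
Implicit Types (f g : 'rV[R]_n -> R) (x : 'rV[R]_n).
Hypothesis oU : open U.
Hypotheses (s1 : smooth_field U e1) (s2 : smooth_field U e2) (sX : smooth_field U X).
Hypotheses (sb : smooth_on U b) (smu : smooth_on U mu) (sbe : smooth_on U be).

Local Notation d1 f x := (along (e1 x) f x).
Local Notation d2 f x := (along (e2 x) f x).
Local Notation d3 f x := (along (X x) f x).

Hypothesis br12 : forall x, U x -> bracket e1 e2 x = - be x *: e2 x + b x *: X x.
Hypothesis br13 : forall x, U x -> bracket e1 X x = - mu x *: e2 x.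
Hypothesis br23 : forall x, U x -> bracket e2 X x = (b x + mu x) *: e1 x.
Hypothesis d1b : forall x, U x -> d1 b x = - be x * b x.
Hypothesis d3b : forall x, U x -> d3 b x = 0.
Hypothesis d1mu : forall x, U x -> d1 mu x = - be x * mu x.
Hypothesis d2mu : forall x, U x -> d2 mu x = d3 be x.
Hypothesis d1be : forall x, U x -> d1 be x = b x * mu x - be x ^+ 2.
Hypothesis b_neq0 : forall x, U x -> b x != 0.
Hypothesis mu_neq0 : forall x, U x -> mu x != 0.

Let df f x (sf : smooth_on U f) (Ux : U x) : differentiable f x :=
  smooth_differentiable sf Ux.

Lemma comm12 f x : U x -> smooth_on U f ->
  d1 (fun y => d2 f y) x - d2 (fun y => d1 f y) x = - be x * d2 f x + b x * d3 f x.
Proof.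
by move=> Ux sf; rewrite -(along_bracket oU Ux s1 s2 sf) br12 // alongDl !alongZl.
Qed.

Lemma comm13 f x : U x -> smooth_on U f ->
  d1 (fun y => d3 f y) x - d3 (fun y => d1 f y) x = - mu x * d2 f x.
Proof.
by move=> Ux sf; rewrite -(along_bracket oU Ux s1 sX sf) br13 // alongZl.
Qed.

Lemma comm23 f x : U x -> smooth_on U f ->
  d2 (fun y => d3 f y) x - d3 (fun y => d2 f y) x = (b x + mu x) * d1 f x.
Proof.
by move=> Ux sf; rewrite -(along_bracket oU Ux s2 sX sf) br23 // alongZl.
Qed.

Definition frame_lambda x := b x * mu x.
Definition frame_zeta x := d2 be x / b x.
Local Notation la := frame_lambda.
Local Notation ze := frame_zeta.

Lemma smooth_lambda : smooth_on U la. Proof. exact: smoothM. Qed.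

Lemma smooth_zeta : smooth_on U ze.
Proof. by apply: smoothM => //; [exact: smooth_along | exact: smoothV]. Qed.

Let dP v f g x (Ux : U x) (sf : smooth_on U f) (sg : smooth_on U g) :
  along v (fun y => f y * g y) x = along v f x * g x + f x * along v g x.
Proof. by rewrite alongM //; exact: df. Qed.

(** Comes from [e1, X] applied to b, using X b = 0. *)
Lemma d3be_d2b x : U x -> b x * d3 be x = - mu x * d2 b x.
Proof.
move=> Ux; have := comm13 Ux sb.
rewrite (eq_along _ oU Ux d3b) along_cst (eq_along _ oU Ux d1b).
rewrite (dP _ Ux (smoothN oU sbe) sb) (alongN _ (df sbe Ux)) d3b //.
lra.
Qed.

Lemma d2la x : U x -> d2 la x = 0.
Proof.
move=> Ux; rewrite (dP _ Ux sb smu) d2mu //.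
have := d3be_d2b Ux; lra.
Qed.

Lemma d1la x : U x -> d1 la x = - 2 * (be x * la x).
Proof. by move=> Ux; rewrite (dP _ Ux sb smu) d1mu // d1b // /la; ring. Qed.

Lemma d3la x : U x -> d3 la x = b x * d3 mu x.
Proof. by move=> Ux; rewrite (dP _ Ux sb smu) d3b // mul0r add0r. Qed.

(** Comes from [e1, e2] applied to lambda, whose e2 derivative vanishes. *)
Lemma d3mu_d2be x : U x -> b x * d3 mu x = 2 * (mu x * d2 be x).
Proof.
move=> Ux; have := comm12 Ux smooth_lambda.
rewrite (eq_along _ oU Ux d2la) along_cst (eq_along _ oU Ux d1la) d2la // d3la //.
have sbl := smoothM oU sbe smooth_lambda.
rewrite (dP _ Ux (smooth_cst oU (-2)) sbl) along_cst (dP _ Ux sbe smooth_lambda).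
rewrite d2la // => E; apply: (mulfI (b_neq0 Ux)).
by move: E; rewrite /frame_lambda; lra.
Qed.

Lemma d1d2be x : U x ->
  d1 (fun y => d2 be y) x = - 3 * (be x * d2 be x) + b x * d3 be x.
Proof.
move=> Ux; have := comm12 Ux sbe.
rewrite (eq_along (e2 x) oU Ux (g := fun y => la y + - (be y * be y))); last first.
  by move=> y Uy; rewrite d1be // expr2.
have sbb := smoothM oU sbe sbe.
rewrite alongD; [|exact: df smooth_lambda Ux|exact: df (smoothN oU sbb) Ux].
rewrite alongN; last exact: df sbb Ux.
rewrite (dP _ Ux sbe sbe) d2la //.
lra.
Qed.

Lemma d1d3mu x : U x ->
  d1 (fun y => d3 mu y) x = - 2 * (mu x * d3 be x) - be x * d3 mu x.
Proof.
move=> Ux; have := comm13 Ux smu.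
rewrite (eq_along (X x) oU Ux d1mu) (dP _ Ux (smoothN oU sbe) smu).
rewrite (alongN _ (df sbe Ux)) d2mu //.
lra.
Qed.

(** Both sides of [d3mu_d2be] are differentiated along e1. The inner derivatives are known from
    [d1d2be] and [d1d3mu], and everything reduces to 4 mu times the claim. The unknown derivatives
    of beta and mu then become multiples of zeta. *)
Lemma d2be_d3be x : U x -> be x * d2 be x = b x * d3 be x.
Proof.
move=> Ux.
have s2be := smooth_along oU s2 sbe; have s3mu := smooth_along oU sX smu.
have := eq_along (e1 x) oU Ux d3mu_d2be.
rewrite (dP _ Ux sb s3mu) (dP _ Ux (smooth_cst oU 2) (smoothM oU smu s2be)).
rewrite along_cst (dP _ Ux smu s2be) d1b // d1mu // d1d2be // d1d3mu //.
have E4 := d3mu_d2be Ux => E.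
apply: (mulfI (mu_neq0 Ux)).
have : be x * (b x * d3 mu x) = be x * (2 * (mu x * d2 be x)) by rewrite E4.
by move: E; lra.
Qed.

Lemma d2beE x : U x -> d2 be x = b x * ze x.
Proof. by move=> Ux; rewrite /ze mulrC divfK // b_neq0. Qed.

Lemma d3beE x : U x -> d3 be x = be x * ze x.
Proof.
move=> Ux; apply: (mulfI (b_neq0 Ux)); rewrite -d2be_d3be // d2beE //; ring.
Qed.

Lemma d3muE x : U x -> d3 mu x = 2 * (ze x * mu x).
Proof.
move=> Ux; apply: (mulfI (b_neq0 Ux)); rewrite d3mu_d2be // d2beE //; ring.
Qed.

Lemma d3laE x : U x -> d3 la x = 2 * (ze x * la x).
Proof. by move=> Ux; rewrite d3la // d3muE // /la; ring. Qed.

Lemma d2bE x : U x -> d2 b x = - (b x * be x * ze x / mu x).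
Proof.
move=> Ux; apply: (mulfI (mu_neq0 Ux)).
rewrite mulrN [mu x * (_ / _)]mulrC divfK ?mu_neq0 //.
have := d3be_d2b Ux; rewrite d3beE //; lra.
Qed.

(** The derivatives of zeta are forced by known ones: here e1 (e2 beta) is computed in two ways; in
    [d2ze] and [d3ze] the commutator [e2, X] is applied to lambda and to beta. *)
Lemma d1ze x : U x -> d1 ze x = - be x * ze x.
Proof.
move=> Ux; have := eq_along (e1 x) oU Ux d2beE.
rewrite (dP _ Ux sb smooth_zeta) d1d2be // d1b // d3beE // d2beE // => E.
by apply: (mulfI (b_neq0 Ux)); move: E; lra.
Qed.

Lemma lambda_neq0 x : U x -> la x != 0.
Proof. by move=> Ux; rewrite mulf_neq0 ?b_neq0 ?mu_neq0. Qed.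

Lemma d2ze x : U x -> d2 ze x = - (b x + mu x) * be x.
Proof.
move=> Ux; have := comm23 Ux smooth_lambda.
rewrite (eq_along _ oU Ux d2la) along_cst (eq_along _ oU Ux d3laE) d1la //.
have szl := smoothM oU smooth_zeta smooth_lambda.
rewrite (dP _ Ux (smooth_cst oU 2) szl) along_cst (dP _ Ux smooth_zeta smooth_lambda).
rewrite d2la // => E; apply: (mulfI (lambda_neq0 Ux)).
by move: E; lra.
Qed.

Lemma d3ze x : U x -> d3 ze x = ze x ^+ 2 - mu x * (b x + mu x).
Proof.
move=> Ux; have := comm23 Ux sbe.
rewrite (eq_along _ oU Ux d3beE) (eq_along _ oU Ux d2beE) d1be //.
rewrite (dP _ Ux sbe smooth_zeta) (dP _ Ux sb smooth_zeta) d2beE // d2ze // d3b //.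
move=> E; apply: (mulfI (b_neq0 Ux)).
by move: E; lra.
Qed.

(** The derivatives of the two summands are opposite in each direction: 2 beta along e1, 2 beta zeta
    / mu along e2, and 0 along X, up to sign. *)
Definition frame_eps x := be x * be x * (la x)^-1 + ln (b x * b x).

(** This is mu / b, expressed through lambda and b^2, which do not depend on the signs of e1 and
    e2. *)
Definition frame_ratio x := la x * (b x * b x)^-1.

(** Write r for the ratio. Along e1 both zeta^2 / lambda and r are constant. Along e2 and X, the
    change of zeta^2 / lambda compensates that of ln r + r, whose derivative is 1 + r times that of
    ln r. The logarithm is only differentiated where lambda > 0. *)
Definition frame_kappa x :=
  ze x * ze x * (la x)^-1 + ln (frame_ratio x) + frame_ratio x.

Let dV v f x (Ux : U x) (sf : smooth_on U f) (f0 : f x != 0) :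
  along v (fun y => (f y)^-1) x = - (f x)^-1 ^+ 2 * along v f x.
Proof.
rewrite mulr_sumr; apply: eq_bigr => k _.
by rewrite (partialV _ (df sf Ux) f0) mulrCA.
Qed.

Let b2_gt0 x : U x -> 0 < b x * b x.
Proof. by move=> Ux; rewrite -expr2 exprn_even_gt0 //= b_neq0. Qed.

Lemma smooth_ratio : smooth_on U frame_ratio.
Proof.
apply: smoothM => //; first exact: smooth_lambda.
apply: smoothV => //; first exact: smoothM.
by move=> y /b2_gt0; rewrite lt0r => /andP[].
Qed.

Let bN x (Ux : U x) := b_neq0 Ux.
Let lN x (Ux : U x) := lambda_neq0 Ux.
Let slV : smooth_on U (fun y => (la y)^-1).
Proof. by apply: smoothV => //; exact: smooth_lambda. Qed.

Let along_quotient v f x (Ux : U x) (sf : smooth_on U f) :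
  along v (fun y => f y * f y * (la y)^-1) x =
  2 * (f x * along v f x) / la x - f x ^+ 2 * along v la x / la x ^+ 2.
Proof.
rewrite (dP _ Ux (smoothM oU sf sf) slV) (dP _ Ux sf sf).
rewrite (dV _ Ux smooth_lambda (lN Ux)); field; exact: lN.
Qed.

Lemma differentiable_eps x : U x -> differentiable frame_eps x.
Proof.
move=> Ux; have sbb := smoothM oU sb sb.
have lnd := is_derive1_ln (b2_gt0 Ux).
have sq := smoothM oU (smoothM oU sbe sbe) slV.
by apply: differentiableD; [exact: df sq Ux|exact: differentiable_comp1 (df sbb Ux) lnd].
Qed.

Lemma differentiable_kappa x : U x -> 0 < la x -> differentiable frame_kappa x.
Proof.
move=> Ux l0.
have r0 : 0 < frame_ratio x by rewrite mulr_gt0 // invr_gt0 b2_gt0.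
have lnd := is_derive1_ln r0.
have sz := smooth_zeta.
have sq := smoothM oU (smoothM oU sz sz) slV.
have dln := differentiable_comp1 (df smooth_ratio Ux) lnd.
by apply: differentiableD (df smooth_ratio Ux); apply: differentiableD (df sq Ux) dln.
Qed.

Lemma along_eps v x : U x -> along v frame_eps x =
  2 * (be x * along v be x) / la x - be x ^+ 2 * along v la x / la x ^+ 2
  + 2 * along v b x / b x.
Proof.
move=> Ux; have sbb := smoothM oU sb sb.
have lnd := is_derive1_ln (b2_gt0 Ux).
have sq := smoothM oU (smoothM oU sbe sbe) slV.
rewrite alongD; [|exact: df sq Ux|exact: differentiable_comp1 (df sbb Ux) lnd].
rewrite along_quotient // (along_comp1 _ (df sbb Ux) lnd) (dP _ Ux sb sb).
congr (_ + _); field; exact: bN.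
Qed.

Lemma along_ratio v x : U x -> along v frame_ratio x =
  (along v la x / la x - 2 * along v b x / b x) * frame_ratio x.
Proof.
move=> Ux; have sbb := smoothM oU sb sb.
have bb0 : b x * b x != 0 by rewrite mulf_neq0 // bN.
have sV : smooth_on U (fun y => (b y * b y)^-1).
  by apply: smoothV => // y Uy; rewrite mulf_neq0 // bN.
rewrite (dP _ Ux smooth_lambda sV) (dV _ Ux sbb bb0) (dP _ Ux sb sb) /frame_ratio.
field; by rewrite bN // lN.
Qed.

Lemma along_kappa v x : U x -> 0 < la x -> along v frame_kappa x =
  2 * (ze x * along v ze x) / la x - ze x ^+ 2 * along v la x / la x ^+ 2
  + (along v la x / la x - 2 * along v b x / b x) * (1 + frame_ratio x).
Proof.
move=> Ux l0.
have r0 : 0 < frame_ratio x by rewrite mulr_gt0 // invr_gt0 b2_gt0.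
have lnd := is_derive1_ln r0.
have sz := smooth_zeta.
have sq := smoothM oU (smoothM oU sz sz) slV.
have dln := differentiable_comp1 (df smooth_ratio Ux) lnd.
rewrite alongD; [|exact: differentiableD (df sq Ux) dln|exact: df smooth_ratio Ux].
rewrite alongD; [|exact: df sq Ux|exact: dln].
rewrite along_quotient // (along_comp1 _ (df smooth_ratio Ux) lnd) along_ratio //.
rewrite -addrA; congr (_ + _); field; by rewrite bN // lN // gt_eqF.
Qed.

Let mN x (Ux : U x) := mu_neq0 Ux.

Lemma d1eps x : U x -> d1 frame_eps x = 0.
Proof.
move=> Ux; rewrite along_eps // d1be // d1la // d1b // /la.
field; by rewrite bN // mN.
Qed.

Lemma d2eps x : U x -> d2 frame_eps x = 0.
Proof.
move=> Ux; rewrite along_eps // d2beE // d2la // d2bE // /la.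
field; by rewrite bN // mN.
Qed.

Lemma d3eps x : U x -> d3 frame_eps x = 0.
Proof.
move=> Ux; rewrite along_eps // d3beE // d3laE // d3b // /la.
field; by rewrite bN // mN.
Qed.

Lemma d1kappa x : U x -> 0 < la x -> d1 frame_kappa x = 0.
Proof.
move=> Ux l0; rewrite along_kappa // d1ze // d1la // d1b // /frame_ratio /la.
field; by rewrite bN // mN.
Qed.

Lemma d2kappa x : U x -> 0 < la x -> d2 frame_kappa x = 0.
Proof.
move=> Ux l0; rewrite along_kappa // d2ze // d2la // d2bE // /frame_ratio /la.
field; by rewrite bN // mN.
Qed.

Lemma d3kappa x : U x -> 0 < la x -> d3 frame_kappa x = 0.
Proof.
move=> Ux l0; rewrite along_kappa // d3ze // d3laE // d3b // /frame_ratio /la.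
field; by rewrite bN // mN.
Qed.

Definition frame_F x := b x * b x * la x.

Lemma smooth_F : smooth_on U frame_F.
Proof. by apply: smoothM smooth_lambda => //; exact: smoothM. Qed.

Lemma d1F x : U x -> d1 frame_F x = - 4 * be x * frame_F x.
Proof.
move=> Ux; rewrite (dP _ Ux (smoothM oU sb sb) smooth_lambda) (dP _ Ux sb sb).
rewrite d1la // d1b // /frame_F; ring.
Qed.

Lemma d1d1F x : U x -> d1 (fun y => d1 frame_F y) x =
  (16 * be x ^+ 2 - 4 * (la x - be x ^+ 2)) * frame_F x.
Proof.
move=> Ux; rewrite (eq_along _ oU Ux d1F).
rewrite (dP _ Ux (smoothM oU (smooth_cst oU (-4)) sbe) smooth_F).
rewrite (dP _ Ux (smooth_cst oU (-4)) sbe) along_cst d1F // d1be // /la.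
by rewrite /frame_F /la; ring.
Qed.

End FrameIdentities.

(** * Charts of a manifold with a unit geodesic Ricci-null field *)

Section ChartGeometry.
Context {R : realType}.
Variables (G : 'rV[R]_3 -> 'M[R]_3) (U : set 'rV[R]_3) (X : 'rV[R]_3 -> 'rV[R]_3).
Implicit Types (x u v w : 'rV[R]_3).

(** The hypotheses of the theorem on one open set of coordinates, bundled so that they can be
    restricted to the domain of a local frame. *)
Record critical_data : Prop := CriticalData {
  data_open : open U;
  data_smooth : forall i j, smooth_on U (fun x => G x i j);
  data_sym : forall x, U x -> (G x)^T = G x;
  data_pos : forall x, U x -> forall v, v != 0 -> 0 < inner (G x) v v;
  data_field : smooth_field U X;
  data_norm : forall x, U x -> inner (G x) (X x) (X x) = 1;
  data_ricci : forall x, U x -> forall v, ricci G (X x) v x = 0;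
  data_geod : forall x, U x -> cov G (X x) X x = 0;
  data_div : forall x, U x -> \sum_k cov G (delta_mx 0 k) X x 0 k = 0;
  data_scal : forall x, U x -> scalar_curvature G x = 0 }.

Hypothesis cd : critical_data.

Let oU := data_open cd.
Let sG := data_smooth cd.
Let symG := data_sym cd.
Let sX := data_field cd.

Lemma data_unit x : U x -> G x \in unitmx.
Proof. by move=> Ux; apply: pos_def_unitmx; exact: data_pos cd _ Ux. Qed.

Let uG := data_unit.

Lemma cov_linear u v a W x : cov G (a *: u + v) W x = a *: cov G u W x + cov G v W x.
Proof. by rewrite covDl covZl. Qed.

Lemma bilinear_cov x (W : 'rV[R]_3 -> 'rV[R]_3) :
  bilinear_form (fun u v => inner (G x) (cov G u W x) v).
Proof.
split=> a u v w; first by rewrite cov_linear innerDl innerZl.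
by rewrite innerDr innerZr.
Qed.

Lemma bilinear_curv x v w :
  bilinear_form (fun u z => inner (G x) (curv G u v w x) z).
Proof.
split=> a u z t; first by rewrite curv_linear1 innerDl innerZl.
by rewrite innerDr innerZr.
Qed.

Lemma ricciE v w x : U x ->
  ricci G v w x = metric_trace (G x) (fun u z => inner (G x) (curv G u v w x) z).
Proof.
move=> Ux; rewrite (metric_trace_endo (fun u => curv G u v w x) (symG Ux) (uG Ux)).
by apply: eq_bigr => k _; rewrite (riemannE oU sG uG).
Qed.

Lemma bilinear_ricci x : U x -> bilinear_form (fun v w => ricci G v w x).
Proof.
move=> Ux; split=> a u v w; rewrite !ricciE //.
  rewrite /metric_trace mulr_sumr -big_split; apply: eq_bigr => k _ /=.
  rewrite mulr_sumr -big_split; apply: eq_bigr => l _ /=.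
  by rewrite curv_linear2 innerDl innerZl; ring.
rewrite /metric_trace mulr_sumr -big_split; apply: eq_bigr => k _ /=.
rewrite mulr_sumr -big_split; apply: eq_bigr => l _ /=.
by rewrite curv_linear3 innerDl innerZl; ring.
Qed.

Lemma cov_perp u x : U x -> inner (G x) (cov G u X x) (X x) = 0.
Proof. by move=> Ux; apply: (cov_unit oU sG symG uG u Ux sX (data_norm cd)). Qed.

(** Trace of the Riccati equation: as X is geodesic, R(u, X)X = - (nabla_X B) u - B^2 u, hence
    Ric(X, X) = - X (div X) - tr B^2. *)
Lemma trace_cov_sqr x : U x -> \sum_k cov G (cov G (delta_mx 0 k) X x) X x 0 k = 0.
Proof.
move=> Ux; have sc a := smooth_field_cst (U := U) a oU.
pose gX u := trilin (fun i j k => christoffel G i j k x) (X x) u.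
have R_k k : curv G (delta_mx 0 k) (X x) (X x) x =
    - cov G (X x) (fun y => cov G (delta_mx 0 k) X y) x
    - cov G (cov G (delta_mx 0 k) X x) X x + cov G (gX (delta_mx 0 k)) X x.
  rewrite (curvE oU sG uG Ux (sc (delta_mx 0 k)) sX sX).
  rewrite (cov_zero G oU _ Ux (data_geod cd)) (bracket_cov oU symG _ _ Ux) covBl.
  have -> : cov G (X x) (fun=> delta_mx 0 k) x = gX (delta_mx 0 k).
    rewrite /cov (_ : along_row _ _ _ = 0) ?add0r //.
    by apply/rowP => j; rewrite !mxE along_cst.
  by rewrite opprB sub0r addrA addrAC.
(* Coordinate fields are not parallel along X: [Nm] is the matrix of their derivatives. It enters
   once as tr(B N) and once, with the opposite sign, as tr(N B), so it drops out. *)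
pose Bm : 'M[R]_3 := \matrix_k cov G (delta_mx 0 k) X x.
pose Nm : 'M[R]_3 := \matrix_k gX (delta_mx 0 k).
have BmE u : cov G u X x = u *m Bm.
  rewrite {1}[u]rowE_delta mulmx_sum_row.
  rewrite (big_morph _ (fun a b => covDl G a b X x) (cov0l G X x)).
  by apply: eq_bigr => k _; rewrite covZl rowK.
have NmE u : gX u = u *m Nm.
  rewrite {1}[u]rowE_delta mulmx_sum_row /gX.
  have g0 : gX 0 = 0 by have := trilinZr (fun i j k => christoffel G i j k x) 0 (X x) 0; rewrite !scale0r.
  rewrite (big_morph _ (fun a b => trilinDr _ (X x) a b) g0).
  by apply: eq_bigr => k _; rewrite trilinZr rowK.
have tr0 : \sum_k (cov G (X x) (fun y => cov G (delta_mx 0 k) X y) x) 0 k =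
    \tr (Bm *m Nm).
  have sB k := smooth_cov oU sG uG (sc (delta_mx 0 k)) sX.
  transitivity (\sum_k along (X x) (fun y => cov G (delta_mx 0 k) X y 0 k) x
      + \sum_k gX (cov G (delta_mx 0 k) X x) 0 k).
    by rewrite -big_split; apply: eq_bigr => k _; rewrite [LHS]mxE [X in X + _]mxE.
  rewrite -along_sum => [|k]; last exact: smooth_fieldW (sB k) Ux k.
  rewrite (eq_along (X x) oU Ux (data_div cd)) along_cst add0r.
  by apply: eq_bigr => k _; rewrite NmE BmE -mulmxA -rowE [LHS]mxE.
have entry (a c d : 'rV[R]_3) k : (- a - c + d) 0 k = - a 0 k - c 0 k + d 0 k.
  by rewrite !mxE.
have := data_ricci cd Ux (X x); rewrite /ricci.
under eq_bigr => k _.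
  rewrite (riemannE oU sG uG _ _ _ Ux) R_k entry.
  over.
rewrite big_split big_split /= !sumrN tr0.
have -> : \sum_k (cov G (gX (delta_mx 0 k)) X x) 0 k = \tr (Nm *m Bm).
  by apply: eq_bigr => k _; rewrite NmE BmE -mulmxA -rowE [LHS]mxE.
rewrite mxtrace_mulC => /eqP; rewrite addrAC addNr add0r oppr_eq0 => /eqP.
exact.
Qed.

Section PointFrame.
Variables (x e1 e2 : 'rV[R]_3).
Hypotheses (Ux : U x) (oe : ortho3 (G x) e1 e2 (X x)).
Let GT := symG Ux.

Let trace3 q (bq : bilinear_form q) := metric_trace3 GT oe bq.

Lemma trace_cov_frame :
  inner (G x) (cov G e1 X x) e1 + inner (G x) (cov G e2 X x) e2 = 0.
Proof.
have := metric_trace_endo (fun u => cov G u X x) GT (uG Ux).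
rewrite (trace3 (bilinear_cov x X)) (data_geod cd Ux) inner0l addr0 => ->.
exact: data_div cd _ Ux.
Qed.

Lemma trace_cov2_frame :
  inner (G x) (cov G (cov G e1 X x) X x) e1
  + inner (G x) (cov G (cov G e2 X x) X x) e2 = 0.
Proof.
have := metric_trace_endo (fun u => cov G (cov G u X x) X x) GT (uG Ux).
rewrite trace3; last first.
  split=> a u v w; first by rewrite !cov_linear innerDl innerZl.
  by rewrite innerDr innerZr.
rewrite (data_geod cd Ux) cov0l inner0l addr0 => ->.
exact: trace_cov_sqr.
Qed.

Let skew u v w z := curv_skew oU sG symG uG u v w z Ux.
Let skew_diag u v w := curv_skew_diag oU sG symG uG u v w Ux.
Lemma curv_diag u w : curv G u u w x = 0.
Proof.
have := curv_antisym G u u w x => /eqP; rewrite -addr_eq0 -mulr2n => /eqP E.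
by apply/rowP => k; apply/eqP; move/rowP/(_ k)/eqP: E; rewrite !mxE -mulr2n mulrn_eq0.
Qed.

Lemma ricci_frame v w : ricci G v w x = inner (G x) (curv G e1 v w x) e1
  + inner (G x) (curv G e2 v w x) e2 + inner (G x) (curv G (X x) v w x) (X x).
Proof. by rewrite ricciE // (trace3 (bilinear_curv x v w)). Qed.

Lemma ric2_frame : inner (G x) (curv G e2 (X x) e1 x) e2 = 0.
Proof.
have := data_ricci cd Ux e1.
by rewrite ricci_frame skew_diag curv_diag inner0l add0r addr0.
Qed.

Lemma ric1_frame : inner (G x) (curv G e1 (X x) e2 x) e1 = 0.
Proof.
have := data_ricci cd Ux e2.
by rewrite ricci_frame skew_diag curv_diag inner0l !addr0.
Qed.

Lemma ricX_frame : inner (G x) (curv G e1 (X x) (X x) x) e1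
  + inner (G x) (curv G e2 (X x) (X x) x) e2 = 0.
Proof.
have := data_ricci cd Ux (X x).
by rewrite ricci_frame curv_diag inner0l addr0.
Qed.

(** The scalar curvature is twice the sum of the three sectional curvatures of the frame planes, and
    the two planes containing X contribute Ric(X, X) = 0. *)
Lemma sec12_frame : inner (G x) (curv G e1 e2 e2 x) e1 = 0.
Proof.
have := data_scal cd Ux.
rewrite -[scalar_curvature G x]/(metric_trace (G x) (fun v w => ricci G v w x)).
rewrite (trace3 (bilinear_ricci Ux)) (data_ricci cd Ux) !ricci_frame !curv_diag !inner0l.
rewrite [curv G e2 e1 _ _]curv_antisym [curv G (X x) e1 _ _]curv_antisym.
rewrite [curv G (X x) e2 _ _]curv_antisym !innerNl.
rewrite (skew e1 e2 e1 e2) (skew e1 (X x) e1) (skew e2 (X x) e2).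
have := ricX_frame; lra.
Qed.

End PointFrame.

End ChartGeometry.

(** * Cross products and completion to orthonormal frames *)

Section CrossProduct.
Context {R : realType}.
Implicit Types (a b c d : 'rV[R]_3).

Definition dot3 a b : R := \sum_k a 0 k * b 0 k.

Let i0 : 'I_3 := ord0.
Let i1 : 'I_3 := lift ord0 ord0.
Let i2 : 'I_3 := lift ord0 (lift ord0 ord0).

Definition cross3 a b : 'rV[R]_3 :=
  (a 0 i1 * b 0 i2 - a 0 i2 * b 0 i1) *: delta_mx 0 i0
  + (a 0 i2 * b 0 i0 - a 0 i0 * b 0 i2) *: delta_mx 0 i1
  + (a 0 i0 * b 0 i1 - a 0 i1 * b 0 i0) *: delta_mx 0 i2.

Lemma dot3E a b : dot3 a b = a 0 i0 * b 0 i0 + a 0 i1 * b 0 i1 + a 0 i2 * b 0 i2.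
Proof. by rewrite /dot3 !big_ord_recl big_ord0 addr0 addrA. Qed.

Lemma cross3E a b :
  (cross3 a b 0 i0 = a 0 i1 * b 0 i2 - a 0 i2 * b 0 i1) *
  (cross3 a b 0 i1 = a 0 i2 * b 0 i0 - a 0 i0 * b 0 i2) *
  (cross3 a b 0 i2 = a 0 i0 * b 0 i1 - a 0 i1 * b 0 i0).
Proof. by rewrite !mxE /=; do ![split]; ring. Qed.

Lemma dot3_cross_l a b : dot3 a (cross3 a b) = 0.
Proof. by rewrite dot3E !cross3E; ring. Qed.

Lemma dot3_cross_r a b : dot3 b (cross3 a b) = 0.
Proof. by rewrite dot3E !cross3E; ring. Qed.

Lemma dot3_cross a b c d :
  dot3 (cross3 a b) (cross3 c d) = dot3 a c * dot3 b d - dot3 a d * dot3 b c.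
Proof. by rewrite !dot3E !cross3E; ring. Qed.

Lemma inner_dot3 (G : 'M[R]_3) a b : inner G a b = dot3 (a *m G) b.
Proof.
rewrite /dot3 /inner mxE; apply: eq_bigr => k _; by rewrite [_^T _ _]mxE.
Qed.

Lemma smooth_cross3 (U : set 'rV[R]_3) (V W : 'rV[R]_3 -> 'rV[R]_3) : open U ->
  smooth_field U V -> smooth_field U W -> smooth_field U (fun y => cross3 (V y) (W y)).
Proof.
move=> oU sV sW.
have sm i j : smooth_on U (fun y => V y 0 i * W y 0 j - V y 0 j * W y 0 i).
  by apply: smoothD => //; [exact: smoothM | apply: smoothN => //; exact: smoothM].
have sd i : smooth_field U (fun=> delta_mx 0 i : 'rV[R]_3) by exact: smooth_field_cst.
by do 2?[apply: smooth_fieldD => //]; apply: smooth_fieldZ => //; exact: sm.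
Qed.

Lemma smooth_mulmx (U : set 'rV[R]_3) (V : 'rV[R]_3 -> 'rV[R]_3) (G : 'rV[R]_3 -> 'M[R]_3) :
  open U -> smooth_field U V -> (forall i j, smooth_on U (fun x => G x i j)) ->
  smooth_field U (fun y => V y *m G y).
Proof.
move=> oU sV sG k; apply: (smooth_on_eq oU (f := fun y => \sum_j V y 0 j * G y j k)).
  by move=> y _; rewrite mxE.
by apply: smooth_sum => // j; exact: smoothM.
Qed.

End CrossProduct.

Section OrthonormalCompletion.
Context {R : realType}.
Variables (H : 'M[R]_3) (e1 e3 : 'rV[R]_3).
Hypotheses (HT : H^T = H) (Hpos : forall v, v != 0 -> 0 < inner H v v).
Hypotheses (n1 : inner H e1 e1 = 1) (n3 : inner H e3 e3 = 1) (n13 : inner H e1 e3 = 0).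

(** Multiplication by [H] lowers indices: the cross product of two covectors is a vector annihilated
    by both, that is, orthogonal to [e3] and [e1]. Being polynomial in the data, it varies smoothly
    with them. *)
Let z := cross3 (e3 *m H) (e1 *m H).

(** By the Lagrange identity, [z] paired with the cross product of [e3] and [e1] gives 1, so [z] is
    nonzero. *)
Lemma cross_pos : 0 < inner H z z.
Proof.
apply: Hpos; apply/eqP => z0; have := dot3_cross (e3 *m H) (e1 *m H) e3 e1.
rewrite -/z z0 -!inner_dot3 n1 n13 n3 mulr1 mulr0 subr0 /dot3.
rewrite big1 => [/eqP|k _]; last by rewrite mxE mul0r.
by rewrite eq_sym oner_eq0.
Qed.

Lemma cross_ortho3 : ortho3 H e1 ((Num.sqrt (inner H z z))^-1 *: z) e3.
Proof.
have z0 := cross_pos.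
have z1 : inner H e1 z = 0 by rewrite inner_dot3 dot3_cross_r.
have z3 : inner H e3 z = 0 by rewrite inner_dot3 dot3_cross_l.
split => //; last 2 first.
- by rewrite innerZr z1 mulr0.
- by rewrite innerC // innerZr z3 mulr0.
rewrite innerZl innerZr mulrA -invfM -expr2 sqr_sqrtr ?ltW //.
by rewrite mulVf // gt_eqF.
Qed.

End OrthonormalCompletion.

Lemma ortho3_completion (R : realType) (H : 'M[R]_3) (e3 : 'rV[R]_3) :
  H^T = H -> (forall v, v != 0 -> 0 < inner H v v) -> inner H e3 e3 = 1 ->
  exists e1 e2, ortho3 H e1 e2 e3.
Proof.
move=> HT Hpos n3; pose p u := u - inner H u e3 *: e3.
have [u pu] : exists u, p u != 0.
  (* Otherwise every vector is a multiple of [e3], including two independent basis vectors. *)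
  apply: contrapT => np; have e3E u : u = inner H u e3 *: e3.
    by apply/eqP; rewrite -subr_eq0; apply: contrapT => /negP ?; apply: np; exists u.
  pose i := lift ord0 ord0 : 'I_3.
  have := e3E (delta_mx 0 i); have := e3E (delta_mx 0 ord0).
  set a := inner _ _ _; set b := inner _ _ _ => E0 Ei.
  have := congr1 (fun w : 'rV[R]_3 => w 0 i) E0.
  have := congr1 (fun w : 'rV[R]_3 => w 0 ord0) E0.
  have := congr1 (fun w : 'rV[R]_3 => w 0 i) Ei.
  rewrite !mxE /= => h1 h2 h3.
  have E1 : b * e3 0 i = 1 := esym h1.
  have E2 : a * e3 0 ord0 = 1 := esym h2.
  have E3 : a * e3 0 i = 0 := esym h3.
  have a0 : a = 0 by rewrite -[a]mulr1 -E1 mulrCA E3 mulr0.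
  by move: E2; rewrite a0 mul0r => /esym/eqP; rewrite oner_eq0.
have pp := Hpos _ pu; have pe : inner H (p u) e3 = 0.
  by rewrite innerBl innerZl n3 mulr1 subrr.
exists ((Num.sqrt (inner H (p u) (p u)))^-1 *: p u); eexists; apply: cross_ortho3 => //.
  rewrite innerZl innerZr mulrA -invfM -expr2 sqr_sqrtr ?ltW //.
  by rewrite mulVf // gt_eqF.
by rewrite innerZl pe mulr0.
Qed.

(** * Existence of adapted frames *)

Section AdaptedFrameExistence.
Context {R : realType}.
Implicit Types (G : 'rV[R]_3 -> 'M[R]_3) (U : set 'rV[R]_3).

Lemma open_gt0 U (f : 'rV[R]_3 -> R) : open U -> smooth_on U f ->
  open [set x | U x /\ 0 < f x].
Proof.
move=> oU sf; rewrite openE => x [Ux fx]; rewrite /interior.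
have cf := differentiable_continuous (smooth_differentiable sf Ux).
have n1 : \forall y \near x, 0 < f y.
  by move/cvgr_gt: cf; apply.
exact: filterS2 (open_nbhs_nbhs (conj oU Ux)) n1 => y Uy fy.
Qed.

Variables (G : 'rV[R]_3 -> 'M[R]_3) (U : set 'rV[R]_3) (X : 'rV[R]_3 -> 'rV[R]_3).
Hypothesis cd : critical_data G U X.

Lemma critical_data_sub (V : set 'rV[R]_3) : open V -> V `<=` U -> critical_data G V X.
Proof.
move=> oV VU; split => //.
- by move=> i j; apply: smooth_on_sub VU _; exact: data_smooth cd i j.
- by move=> x /VU; exact: data_sym cd x.
- by move=> x /VU; exact: data_pos cd x.
- by move=> k; apply: smooth_on_sub VU _; exact: data_field cd k.
- by move=> x /VU; exact: data_norm cd x.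
- by move=> x /VU; exact: data_ricci cd x.
- by move=> x /VU; exact: data_geod cd x.
- by move=> x /VU; exact: data_div cd x.
- by move=> x /VU; exact: data_scal cd x.
Qed.

Record adapted_frame (V : set 'rV[R]_3) (e1 e2 : 'rV[R]_3 -> 'rV[R]_3) : Prop :=
  AdaptedFrame {
    adapted_open : open V;
    adapted_sub : V `<=` U;
    adapted_smooth1 : smooth_field V e1;
    adapted_smooth2 : smooth_field V e2;
    adapted_ortho : forall x, V x -> ortho3 (G x) (e1 x) (e2 x) (X x);
    adapted_cov1 : forall x, V x -> cov G (e1 x) X x = 0;
    adapted_cov2 : forall x, V x ->
      cov G (e2 x) X x = coef_b G e1 e2 X x *: e1 x;
    adapted_b : forall x, V x -> coef_b G e1 e2 X x != 0 }.

(* The shape operator [u |-> cov G u X] is trace-free with trace-free square,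
   hence nilpotent on the orthogonal complement of [X]. *)
Lemma adapted_at_point x v s e1 e2 : U x -> ortho3 (G x) e1 e2 (X x) ->
  s != 0 -> cov G v X x = s *: e1 ->
  [/\ cov G e1 X x = 0, cov G e2 X x = inner (G x) (cov G e2 X x) e1 *: e1 &
      inner (G x) (cov G e2 X x) e1 != 0].
Proof.
move=> Ux oe s0 vE; have GT := data_sym cd Ux.
have ex u := frame3_expand GT oe u.
have o21 := etrans (innerC e2 e1 GT) (ortho12 oe).
pose p := inner (G x) (cov G e1 X x) e1; pose q := inner (G x) (cov G e1 X x) e2.
pose r := inner (G x) (cov G e2 X x) e1; pose t := inner (G x) (cov G e2 X x) e2.
have B1 : cov G e1 X x = p *: e1 + q *: e2.
  by rewrite [LHS]ex (cov_perp cd e1 Ux) scale0r addr0.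
have B2 : cov G e2 X x = r *: e1 + t *: e2.
  by rewrite [LHS]ex (cov_perp cd e2 Ux) scale0r addr0.
have tr1 : p + t = 0 by exact: (trace_cov_frame cd Ux oe).
have tr2 : p * p + q * r + (r * q + t * t) = 0.
  have := trace_cov2_frame cd Ux oe.
  rewrite {1}B1 B2 !covDl !covZl B1 B2 !innerDl !innerZl !innerDl !innerZl.
  rewrite (ortho11 oe) (ortho22 oe) (ortho12 oe) o21; lra.
(* On the span of e1 and e2 the traces give p + t = 0 and p^2 + q r = 0, so B^2 = 0 there. As
   [s *: e1] is a value of B, B e1 must vanish, which means p = q = 0. *)
pose v1 := inner (G x) v e1; pose v2 := inner (G x) v e2.
have vB : s *: e1 = v1 *: cov G e1 X x + v2 *: cov G e2 X x.
  rewrite -vE {1}[v]ex !covDl !covZl (data_geod cd Ux) scaler0 addr0 //.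
have E1 : s = v1 * p + v2 * r.
  have := congr1 (fun u => inner (G x) u e1) vB.
  rewrite B1 B2 innerDl !innerZl !innerDl !innerZl (ortho11 oe) o21; lra.
have E2 : 0 = v1 * q + v2 * t.
  have := congr1 (fun u => inner (G x) u e2) vB.
  rewrite B1 B2 innerDl !innerZl !innerDl !innerZl (ortho22 oe) (ortho12 oe); lra.
have p0 : p = 0.
  apply: (mulfI s0); rewrite mulr0 E1.
  have tE : t = - p by lra.
  have h1 : p * p + q * r = 0 by move: tr2; rewrite tE; lra.
  have h2 : v2 * p - v1 * q = 0 by move: E2; rewrite tE; lra.
  have -> : (v1 * p + v2 * r) * p = v1 * (p * p + q * r) + r * (v2 * p - v1 * q).
    by ring.
  by rewrite h1 h2 !mulr0 addr0.
have t0 : t = 0 by lra.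
have s0' := s0.
rewrite p0 t0 !mulr0 add0r addr0 in E1 E2.
have r0 : r != 0 by apply: contraNneq s0 => r0; rewrite E1 r0 mulr0.
have q0 : q = 0.
  have /eqP : q * r = 0 by move: tr2; rewrite p0 t0; lra.
  by rewrite mulf_eq0 (negbTE r0) orbF => /eqP.
split; [by rewrite B1 p0 q0 !scale0r addr0 | | exact: r0].
by rewrite -/r B2 t0 scale0r addr0.
Qed.

(** On the complement of X, a nonzero nilpotent B has its image equal to its kernel. Normalizing the
    derivative of X along one fixed coordinate vector [v] thus gives a smooth e1 wherever that
    derivative is nonzero, without solving for eigenvectors. *)
Lemma adapted_frame_exists v x0 : U x0 -> cov G v X x0 != 0 ->
  exists V e1 e2, adapted_frame V e1 e2 /\ V x0.
Proof.
move=> Ux0 w0.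
have oU := data_open cd; have sG := data_smooth cd; have sX := data_field cd.
have symG := data_sym cd; have uG := data_unit cd.
pose w y := cov G v X y.
have sw : smooth_field U w := smooth_cov oU sG uG (smooth_field_cst v oU) sX.
pose V := [set x | U x /\ 0 < inner (G x) (w x) (w x)].
have oV : open V by exact: open_gt0 oU (smooth_inner oU sG sw sw).
have VU : V `<=` U by move=> x [].
have sub := smooth_on_sub VU.
have sGV i j := sub _ (sG i j).
pose e1 y := (Num.sqrt (inner (G y) (w y) (w y)))^-1 *: w y.
have sqw y : V y -> 0 < Num.sqrt (inner (G y) (w y) (w y)).
  by case=> _; rewrite sqrtr_gt0.
have swV : smooth_field V w by move=> k; exact: sub.
have sXV : smooth_field V X by move=> k; exact: sub.
have s1 : smooth_field V e1.
  apply: smooth_fieldZ => //; apply: smoothV => //.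
    by apply: smooth_sqrt => // [|y []//]; exact: smooth_inner.
  by move=> y Vy; rewrite gt_eqF // sqw.
have n1 y : V y -> inner (G y) (e1 y) (e1 y) = 1.
  move=> Vy; have s0 := sqw y Vy; rewrite innerZl innerZr mulrA -invfM -expr2.
  by rewrite sqr_sqrtr ?mulVf //; [rewrite gt_eqF //; case: Vy | rewrite ltW //; case: Vy].
have n13 y : V y -> inner (G y) (e1 y) (X y) = 0.
  by move=> Vy; rewrite innerZl (cov_perp cd v (VU _ Vy)) mulr0.
pose z y := cross3 (X y *m G y) (e1 y *m G y).
have sz : smooth_field V z.
  by apply: smooth_cross3 => //; exact: smooth_mulmx.
have zpos y : V y -> 0 < inner (G y) (z y) (z y).
  move=> Vy; have Uy := VU _ Vy.
  exact: cross_pos (data_pos cd Uy) (n1 y Vy) (data_norm cd Uy) (n13 y Vy).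
pose e2 y := (Num.sqrt (inner (G y) (z y) (z y)))^-1 *: z y.
have sqz y : V y -> 0 < Num.sqrt (inner (G y) (z y) (z y)).
  by move=> Vy; rewrite sqrtr_gt0 zpos.
have s2 : smooth_field V e2.
  apply: smooth_fieldZ => //; apply: smoothV => //.
    by apply: smooth_sqrt => //; exact: smooth_inner.
  by move=> y Vy; rewrite gt_eqF // sqz.
have oe y : V y -> ortho3 (G y) (e1 y) (e2 y) (X y).
  move=> Vy; have Uy := VU _ Vy.
  exact: cross_ortho3 (symG y Uy) (data_pos cd Uy) (n1 y Vy) (data_norm cd Uy) (n13 y Vy).
have pt y (Vy : V y) : [/\ cov G (e1 y) X y = 0,
    cov G (e2 y) X y = coef_b G e1 e2 X y *: e1 y & coef_b G e1 e2 X y != 0].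
  have sn : Num.sqrt (inner (G y) (w y) (w y)) != 0 by rewrite gt_eqF // sqw.
  apply: (adapted_at_point (v := v) (VU _ Vy) (oe y Vy) sn).
  by rewrite /e1 scalerA mulfV // scale1r.
exists V, e1, e2; split.
  split => //; by move=> y /pt[].
by split => //; apply: (data_pos cd Ux0).
Qed.

End AdaptedFrameExistence.

(** * Local minima and propagation along segments *)

Section Descent.
Context {R : realType} {n : nat}.
Implicit Types (x v : 'rV[R]_n).

Lemma near_segment x v (P : 'rV[R]_n -> Prop) : (\forall y \near x, P y) ->
  exists2 d : R, 0 < d & forall s, 0 <= s <= d -> P (x + s *: v).
Proof.
move=> /nbhs_ballP[e /= e0 eP].
have N0 : 0 < 1 + `|v| by rewrite ltr_wpDr.
exists (e / (1 + `|v|) / 2) => [|s /andP[s0 sd]]; first by rewrite !divr_gt0.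
apply: eP; rewrite -ball_normE /= opprD addrA subrr add0r normrN normrZ ger0_norm //.
apply: (@le_lt_trans _ _ (e / (1 + `|v|) / 2 * (1 + `|v|))).
  by apply: ler_pM => //; rewrite ler_wpDl.
rewrite mulrAC divfK ?gt_eqF //; lra.
Qed.

Variables (U : set 'rV[R]_n) (f : 'rV[R]_n -> R).
Hypotheses (oU : open U) (sf : smooth_on U f).

Lemma near_along_lt0 x v : U x -> along v f x < 0 ->
  \forall y \near x, U y /\ along v f y < 0.
Proof.
move=> Ux fv.
have sv := smooth_along oU (smooth_field_cst v oU) sf.
have cv := differentiable_continuous (smooth_differentiable sv Ux).
have n1 : \forall y \near x, along v f y < 0 by move/cvgr_lt: cv; apply.
exact: filterS2 (open_nbhs_nbhs (conj oU Ux)) n1 => y Uy fy.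
Qed.

Lemma MVT_along x v (t : R) : 0 < t -> (forall s, 0 <= s <= t -> U (x + s *: v)) ->
  exists2 s, 0 < s < t & f (x + t *: v) - f x = t * along v f (x + s *: v).
Proof.
move=> t0 tU.
have [s st E] := MVT_line t0 (fun s sI => smooth_differentiable sf (tU s sI)).
exists s => //; rewrite E along_derive //; apply: (smooth_differentiable sf).
by apply: tU; case/andP: st => ? ?; rewrite !ltW.
Qed.

Definition local_min x := \forall y \near x, f x <= f y.

(** A negative derivative would persist on a short segment, where the mean value theorem yields a
    smaller value. Both [v] and [- v] are tested. *)
Lemma local_min_along x v : U x -> local_min x -> along v f x = 0.
Proof.
move=> Ux mx.
have H w : 0 <= along w f x.
  rewrite leNgt; apply/negP => /(near_along_lt0 Ux) nw.
  have [d d0 dP] := near_segment w (filterI nw mx).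
  have [|s /andP[s0 sd] E] := @MVT_along x w d d0.
    by move=> s /dP[[]].
  have [|_ h1] := dP d; first by rewrite (ltW d0) lexx.
  have [|[_ h2] _] := dP s; first by rewrite !ltW.
  move: h1; rewrite -subr_ge0 E leNgt => /negP; apply.
  by rewrite pmulr_rlt0.
have := H v; have := H (- v); rewrite alongNl; lra.
Qed.

End Descent.

Section SecondOrder.
Context {R : realType} {n : nat}.
Variables (U : set 'rV[R]_n) (f : 'rV[R]_n -> R).
Hypotheses (oU : open U) (sf : smooth_on U f).

(** The first derivative vanishes at [x]. A negative second derivative would make it negative just
    after [x] on the ray, and [f] would decrease; this is the mean value theorem applied twice. *)
Lemma local_min_along2 x v : U x -> local_min f x ->
  0 <= along v (fun y => along v f y) x.
Proof.
move=> Ux mx; have fv0 := local_min_along oU sf v Ux mx.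
have sv := smooth_along oU (smooth_field_cst v oU) sf.
rewrite leNgt; apply/negP => /(near_along_lt0 oU sv Ux) nw.
have [d d0 dP] := near_segment v (filterI nw mx).
have Ud s : 0 <= s <= d -> U (x + s *: v) by move=> /dP[[]].
have [s /andP[s0 sd] E] := MVT_along sf d0 Ud.
have Us r : 0 <= r <= s -> U (x + r *: v).
  by move=> /andP[r0 rs]; apply: Ud; rewrite r0 (le_trans rs) // ltW.
have [r /andP[r0 rs] E'] := MVT_along sv s0 Us.
have [|_ h1] := dP d; first by rewrite (ltW d0) lexx.
have [|[_ h2] _] := dP r; first by rewrite ltW //= ltW // (lt_trans rs).
move: E' E h1; rewrite fv0 subr0 => -> E; rewrite -subr_ge0 E leNgt => /negP; apply.
by rewrite pmulr_rlt0 // pmulr_rlt0.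
Qed.

End SecondOrder.

(** * Frame-free invariants and their values in a frame *)

Section ChartInvariants.
Context {R : realType}.
Variables (G : 'rV[R]_3 -> 'M[R]_3) (X : 'rV[R]_3 -> 'rV[R]_3).
Implicit Types (x u v : 'rV[R]_3).

(** |B|^2, which is b^2 in an adapted frame. *)
Definition shape_norm x : R :=
  metric_trace (G x) (fun u v => inner (G x) (cov G u X x) (cov G v X x)).

(** The function F of the overview, as a metric trace. *)
Definition shape_curv x : R :=
  metric_trace (G x) (fun u v =>
    inner (G x) (curv G (cov G u X x) (X x) (X x) x) (cov G v X x)).

(** Equal to lambda where B is nonzero; where B = 0 the quotient takes the conventional value 0. *)
Definition ricci_eigen x : R := shape_curv x / shape_norm x.

Definition grad_norm (f : 'rV[R]_3 -> R) x : R :=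
  metric_trace (G x) (fun u v => along u f x * along v f x).

Local Notation la := ricci_eigen.

(* The quantities below are written without a frame, since adapted frames only
   exist locally while conservation is used along a whole segment of a chart. *)

Definition zeta x : R := along (X x) la x / (2 * la x).

Definition beta_sqr x : R := grad_norm la x / (4 * la x ^+ 2) - zeta x ^+ 2.

Definition eps_inv x : R := beta_sqr x / la x + ln (shape_norm x).

Definition kappa_inv x : R :=
  zeta x ^+ 2 / la x + ln (la x / shape_norm x) + la x / shape_norm x.

Lemma bilinear_shape_norm x :
  bilinear_form (fun u v => inner (G x) (cov G u X x) (cov G v X x)).
Proof.
split=> a u v w; rewrite cov_linear; first by rewrite innerDl innerZl.
by rewrite innerDr innerZr.
Qed.

Lemma bilinear_shape_curv x : bilinear_form (fun u v =>
  inner (G x) (curv G (cov G u X x) (X x) (X x) x) (cov G v X x)).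
Proof.
split=> a u v w; rewrite cov_linear; first by rewrite curv_linear1 innerDl innerZl.
by rewrite innerDr innerZr.
Qed.

Lemma bilinear_grad (f : 'rV[R]_3 -> R) x :
  bilinear_form (fun u v => along u f x * along v f x).
Proof. by split=> a u v w; rewrite alongDl alongZl; ring. Qed.

Variable (U : set 'rV[R]_3).
Hypothesis cd : critical_data G U X.

Section InFrame.
Variables (V : set 'rV[R]_3) (e1 e2 : 'rV[R]_3 -> 'rV[R]_3).
Hypothesis af : adapted_frame G U X V e1 e2.

Local Notation b := (coef_b G e1 e2 X).
Local Notation mu := (coef_mu G e1 e2 X).
Local Notation be := (coef_beta G e1 e2).

Let oV := adapted_open af.
Let VU := adapted_sub af.
Let s1 := adapted_smooth1 af.
Let s2 := adapted_smooth2 af.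
Let oe := adapted_ortho af.
Let c1 := adapted_cov1 af.
Let c2 := adapted_cov2 af.
Let bN := adapted_b af.
Let cdV := critical_data_sub cd oV VU.
Let sG := data_smooth cdV.
Let symG := data_sym cdV.
Let uG := data_unit cdV.
Let sX := data_field cdV.
Let cX := data_geod cdV.

Lemma shape_norm_frame x : V x -> shape_norm x = b x * b x.
Proof.
move=> Vx; rewrite /shape_norm (metric_trace3 (symG Vx) (oe Vx) (bilinear_shape_norm x)).
rewrite (c1 Vx) (c2 Vx) (cX Vx) !inner0l innerZl innerZr (ortho11 (oe Vx)).
by rewrite mulr1 add0r addr0.
Qed.

Lemma curv1XX_frame x : V x -> curv G (e1 x) (X x) (X x) x = (b x * mu x) *: e1 x.
Proof. exact: (curv1XX oV sG symG uG s1 sX oe c1 c2 cX). Qed.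

Lemma shape_curv_frame x : V x -> shape_curv x = b x * b x * (b x * mu x).
Proof.
move=> Vx; rewrite /shape_curv (metric_trace3 (symG Vx) (oe Vx) (bilinear_shape_curv x)).
rewrite (c1 Vx) (c2 Vx) (cX Vx) !inner0r innerZr add0r addr0.
have := curv_linear1 G (b x) (e1 x) 0 (X x) (X x) x.
rewrite curv0l !addr0 => ->; rewrite curv1XX_frame // !innerZl (ortho11 (oe Vx)); ring.
Qed.

Let r1 x (Vx : V x) := ric1_frame cdV Vx (oe Vx).
Let r2 x (Vx : V x) := ric2_frame cdV Vx (oe Vx).
Let s12 x (Vx : V x) := sec12_frame cdV Vx (oe Vx).
Let sb : smooth_on V b := smooth_b oV sG uG s1 s2 sX.
Let smu : smooth_on V mu := smooth_mu oV sG uG s1 s2 sX.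
Let sbe : smooth_on V be := smooth_beta oV sG uG s1 s2.
Let br12 := bracket12_simpl oV sG symG uG s1 s2 sX oe c1 c2 cX r2 bN.
Let br13 := bracket1X oV sG symG uG s1 sX oe c1 cX.
Let br23 := bracket2X oV sG symG uG s1 s2 sX oe c2 cX.
Let D1b := d1b oV sG symG uG s1 s2 sX oe c1 c2 cX r1.
Let D3b := d3b oV sG symG uG s1 s2 sX oe c1 c2 cX.
Let D1mu := d1mu oV sG symG uG s1 s2 sX oe c1 c2 cX r1 r2 bN.
Let D2mu := d2mu oV sG symG uG s1 s2 sX oe c1 c2 cX r2 bN.
Let D1be := d1be oV sG symG uG s1 s2 sX oe c1 c2 cX r2 s12 bN.

Hypothesis mN : forall x, V x -> mu x != 0.

Local Notation frame_la := (frame_lambda b mu).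
Local Notation frame_ze := (frame_zeta e2 b be).

Lemma ricci_eigen_frame x : V x -> la x = frame_la x.
Proof.
move=> Vx; rewrite /ricci_eigen shape_curv_frame // shape_norm_frame //.
by rewrite [_ * (b x * mu x)]mulrC mulfK // mulf_neq0 // bN.
Qed.

Lemma frame_la_neq0 x : V x -> frame_la x != 0.
Proof. by move=> Vx; exact: mulf_neq0 (bN Vx) (mN Vx). Qed.

Lemma along_ricci_eigen v x : V x -> along v la x = along v frame_la x.
Proof. by move=> Vx; exact: (eq_along v oV Vx ricci_eigen_frame). Qed.

Lemma differentiable_ricci_eigen x : V x -> differentiable la x.
Proof.
move=> Vx.
have : differentiable frame_la x by exact: smooth_differentiable (smooth_lambda oV sb smu) Vx.
by apply: (eq_differentiable oV Vx) => y Vy; rewrite ricci_eigen_frame.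
Qed.

Let D1la x (Vx : V x) := d1la sb smu D1b D1mu Vx.
Let D2la x (Vx : V x) := d2la oV s1 sX sb smu sbe br13 D1b D3b D2mu Vx.
Let D3la x (Vx : V x) :=
  d3laE oV s1 s2 sX sb smu sbe br12 br13 D1b D3b D1mu D2mu bN Vx.

Lemma zeta_frame x : V x -> zeta x = frame_ze x.
Proof.
move=> Vx; have l0 := frame_la_neq0 Vx.
rewrite /zeta along_ricci_eigen // ricci_eigen_frame // (D3la Vx).
by field.
Qed.

(** In the frame, grad lambda = - 2 beta lambda e1 + 2 zeta lambda X, of squared norm 4 lambda^2
    (beta^2 + zeta^2); [beta_sqr] is this relation solved for beta^2. *)
Lemma beta_sqr_frame x : V x -> beta_sqr x = be x * be x.
Proof.
move=> Vx; have l0 := frame_la_neq0 Vx; rewrite /beta_sqr zeta_frame //.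
rewrite /grad_norm (metric_trace3 (symG Vx) (oe Vx) (bilinear_grad _ x)).
rewrite !along_ricci_eigen // (D1la Vx) (D2la Vx) (D3la Vx) ricci_eigen_frame //.
by field.
Qed.

Lemma eps_inv_frame x : V x -> eps_inv x = frame_eps b mu be x.
Proof.
by move=> Vx; rewrite /eps_inv beta_sqr_frame // shape_norm_frame // ricci_eigen_frame.
Qed.

Lemma kappa_inv_frame x : V x -> kappa_inv x = frame_kappa e2 b mu be x.
Proof.
by move=> Vx; rewrite /kappa_inv zeta_frame // shape_norm_frame // ricci_eigen_frame.
Qed.

Lemma along_span (f : 'rV[R]_3 -> R) v x : V x -> along v f x =
  inner (G x) v (e1 x) * along (e1 x) f x + inner (G x) v (e2 x) * along (e2 x) f x
  + inner (G x) v (X x) * along (X x) f x.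
Proof.
move=> Vx; rewrite {1}[v](frame3_expand (symG Vx) (oe Vx)).
by rewrite !alongDl !alongZl.
Qed.

Lemma eps_inv_constant v x : V x ->
  differentiable eps_inv x /\ along v eps_inv x = 0.
Proof.
move=> Vx; split.
  have := differentiable_eps oV sb smu sbe bN mN Vx.
  by apply: (eq_differentiable oV Vx) => y Vy; rewrite eps_inv_frame.
rewrite (eq_along v oV Vx eps_inv_frame) along_span //.
rewrite (d1eps oV sb smu sbe D1b D1mu D1be bN mN Vx).
rewrite (d2eps oV s1 s2 sX sb smu sbe br12 br13 D1b D3b D1mu D2mu D1be bN mN Vx).
rewrite (d3eps oV s1 s2 sX sb smu sbe br12 br13 D1b D3b D1mu D2mu D1be bN mN Vx).
by rewrite !mulr0 !addr0.
Qed.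

Lemma kappa_inv_constant v x : V x -> 0 < la x ->
  differentiable kappa_inv x /\ along v kappa_inv x = 0.
Proof.
move=> Vx; rewrite ricci_eigen_frame // => l0; split.
  have := differentiable_kappa oV s2 sb smu sbe bN mN Vx l0.
  by apply: (eq_differentiable oV Vx) => y Vy; rewrite kappa_inv_frame.
rewrite (eq_along v oV Vx kappa_inv_frame) along_span //.
rewrite (d1kappa oV s1 s2 sX sb smu sbe br12 br13 D1b D3b D1mu D2mu D1be bN mN Vx l0).
rewrite (d2kappa oV s1 s2 sX sb smu sbe br12 br13 br23 D1b D3b D1mu D2mu D1be bN mN Vx l0).
rewrite (d3kappa oV s1 s2 sX sb smu sbe br12 br13 br23 D1b D3b D1mu D2mu D1be bN mN Vx l0).
by rewrite !mulr0 !addr0.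
Qed.

(** Cauchy-Schwarz for grad lambda and [v]; the defect is exhibited as a sum of three squares. *)
Lemma gradient_bound v x : V x ->
  along v la x ^+ 2 <= 4 * la x ^+ 2 * (beta_sqr x + zeta x ^+ 2) * inner (G x) v v.
Proof.
move=> Vx; rewrite beta_sqr_frame // zeta_frame // along_ricci_eigen // ricci_eigen_frame //.
have oex := oe Vx; have GT := symG Vx.
have -> : inner (G x) v v = inner (G x) v (e1 x) ^+ 2 + inner (G x) v (e2 x) ^+ 2
    + inner (G x) v (X x) ^+ 2.
  rewrite {2}[v](frame3_expand GT oex) !innerDr !innerZr; ring.
rewrite along_span // (D1la Vx) (D2la Vx) (D3la Vx).
set p := inner _ _ (e1 x); set q := inner _ _ (e2 x); set r := inner _ _ (X x).
set l := frame_la x; set B := be x; set Z := frame_ze x; rewrite -subr_ge0.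
have -> : 4 * l ^+ 2 * (B * B + Z ^+ 2) * (p ^+ 2 + q ^+ 2 + r ^+ 2)
    - (p * (- 2 * (B * l)) + q * 0 + r * (2 * (Z * l))) ^+ 2
  = (2 * l * (p * Z + r * B)) ^+ 2 + (2 * l * B * q) ^+ 2 + (2 * l * Z * q) ^+ 2.
  by ring.
by rewrite !addr_ge0 // sqr_ge0.
Qed.

(** At a critical point e1 F = - 4 beta F forces beta = 0, and then e1 e1 F = - 4 (b lambda)^2,
    which is negative whatever the sign of lambda. *)
Lemma shape_curv_not_local_min x : V x -> ~ local_min shape_curv x.
Proof.
move=> Vx mx; have sF := smooth_F oV sb smu.
have FE y : V y -> frame_F b mu y = shape_curv y.
  by move=> Vy; rewrite shape_curv_frame.
have {}mx : local_min (frame_F b mu) x.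
  apply: filterS2 mx (open_nbhs_nbhs (conj oV Vx)) => y h Vy.
  by rewrite !FE.
have F0 : frame_F b mu x != 0 by exact: mulf_neq0 (mulf_neq0 (bN Vx) (bN Vx)) (frame_la_neq0 Vx).
have crit v := local_min_along oV sF v Vx mx.
(* All first derivatives of F vanish at [x], so e1 may be replaced by its constant extension in the
   second derivative; the minimum test is available for constant directions only. *)
have := along_bracket oV Vx s1 (smooth_field_cst (e1 x) oV) sF.
rewrite crit => /esym/eqP; rewrite subr_eq0 => /eqP E.
have := local_min_along2 oV sF (e1 x) Vx mx.
rewrite E (d1d1F oV sb smu sbe D1b D1mu D1be Vx).
have := d1F oV sb smu D1b D1mu Vx; rewrite crit => /esym/eqP.
rewrite mulf_eq0 (negbTE F0) orbF mulf_eq0 oppr_eq0 pnatr_eq0 /= => /eqP ->.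
rewrite expr0n /= mulr0 subr0 sub0r /frame_F leNgt => /negP; apply.
have -> : - (4 * frame_la x) * (b x * b x * frame_la x) =
  - (4 * (b x * frame_la x) ^+ 2) by ring.
by rewrite oppr_lt0 mulr_gt0 // exprn_even_gt0 //= (mulf_neq0 (bN Vx) (frame_la_neq0 Vx)).
Qed.

End InFrame.

End ChartInvariants.

(** * Real-variable estimates *)

Section FirstCrossing.
Context {R : realType}.

Lemma first_nonpositive (h : R -> R) : (forall s, 0 <= s <= 1 -> {for s, continuous h}) ->
  0 < h 0 -> h 1 <= 0 ->
  exists t, [/\ 0 < t <= 1, h t <= 0 & forall s, 0 <= s < t -> 0 < h s].
Proof.
move=> ch h0 h1; pose S := [set s | 0 <= s <= 1 /\ h s <= 0].
have S1 : S 1 by rewrite /S /= ler01 lexx.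
have lbS : lbound S 0 by move=> s [/andP[]].
have infS : has_inf S by split; [exists 1 | exists 0].
pose t := inf S.
have t0 : 0 <= t by exact: lb_le_inf (ex_intro _ 1 S1) lbS.
have t1 : t <= 1 by apply: ge_inf S1; exact: infS.2.
have before s : 0 <= s < t -> 0 < h s.
  move=> /andP[s0 st]; rewrite ltNge; apply/negP => hs.
  have Ss : S s by split=> //; rewrite s0 (le_trans (ltW st)).
  by have := ge_inf infS.2 Ss; rewrite leNgt st.
have ct : {for t, continuous h} by apply: ch; rewrite t0.
have ht : h t <= 0.
  rewrite leNgt; apply/negP => ht.
  have : \forall y \near t, 0 < h y by move/cvgr_gt: ct; apply.
  move=> /nbhs_ballP[e /= e0 eP].
  have [s Ss st] := inf_adherent e0 infS.
  have : 0 < h s.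
    apply: eP; rewrite /ball /= ltr_distlC; apply/andP; split.
      by apply: lt_le_trans (ge_inf infS.2 Ss); rewrite gtrBl.
    by rewrite -/t in st.
  by case: Ss => _; rewrite leNgt => /negP.
exists t; split => //; rewrite t1 andbT lt_neqAle t0 andbT.
apply/eqP => t00; move: h0; rewrite ltNge; have -> : h 0 = h t by congr h.
by rewrite ht.
Qed.

Lemma ge_at_end (h : R -> R) (t d : R) : 0 < t -> {for t, continuous h} ->
  (forall s, 0 <= s < t -> d <= h s) -> d <= h t.
Proof.
move=> t0 ct hd; rewrite leNgt; apply/negP => htd.
have : \forall y \near t, h y < d by move/cvgr_lt: ct; apply.
move=> /nbhs_ballP[e /= e0 eP].
pose s := Num.max 0 (t - e / 2).
have st : s < t by rewrite gt_max t0 gtrBl divr_gt0.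
have s0 : 0 <= s by rewrite le_max lexx.
have : h s < d.
  apply: eP; rewrite /ball /= gtr0_norm ?subr_gt0 //.
  have : t - e / 2 <= s by rewrite le_max lexx orbT.
  lra.
by apply/negP; rewrite -leNgt; apply: hd; rewrite s0.
Qed.

Lemma ln_le_subr1 (x : R) : 0 < x -> ln x <= x - 1.
Proof.
move=> x0; have := @le_ln1Dx R (x - 1); rewrite [1 + _]addrC subrK; apply.
lra.
Qed.

(** Follows from - ln x = ln (1 / x) <= 1 / x - 1. *)
Lemma mul_opp_ln_le1 (x : R) : 0 < x -> x * (- ln x) <= 1.
Proof.
move=> x0; have xV0 : 0 < x^-1 by rewrite invr_gt0.
have := ln_le_subr1 xV0.
rewrite lnV ?posrE // -(ler_pM2l x0) => /le_trans; apply.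
by rewrite mulrBr mulfV ?gt_eqF // mulr1 lerBlDr lerDl ltW.
Qed.

(** Here l, g, B and Z stand for lambda, b^2, beta^2 and zeta, and c = l / g for mu / b. If c
    exceeded 1 + |K0|, then ln c >= 0 would contradict the second relation; the first gives g <= exp
    E0. Writing l = c g, both B and Z^2 become products of a bounded factor with an expression x
    (const - ln x), itself bounded above. *)
Lemma conserved_bound (l g B Z E0 K0 : R) : 0 < l -> 0 < g -> 0 <= B ->
  B / l + ln g = E0 -> Z ^+ 2 / l + ln (l / g) + l / g = K0 ->
  let C := 1 + `|K0| in
  l <= C * g /\ B + Z ^+ 2 <= expR E0 * (C + (C * `|K0| + 1)).
Proof.
move=> l0 g0 b0 EE; set c := l / g => KE C; set eE := expR E0.
have K0n := ler_norm K0; have K0p := normr_ge0 K0.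
have C1 : 1 <= C by rewrite lerDl.
have eE0 : 0 < eE by exact: expR_gt0.
have c0 : 0 < c by rewrite divr_gt0.
have lE : l = c * g by rewrite /c divfK // gt_eqF.
have Z0 : 0 <= Z ^+ 2 / l by rewrite divr_ge0 ?sqr_ge0 // ltW.
have B0 : 0 <= B / l by rewrite divr_ge0 // ltW.
have cC : c <= C.
  rewrite leNgt; apply/negP => Cc; have c1 : 1 <= c by rewrite (le_trans C1) // ltW.
  by have := ln_ge0 c1; move: Cc; rewrite /C; lra.
have gE : g <= eE by rewrite -[g]lnK ?posrE // ler_expR; lra.
have BE : B = l * (E0 - ln g) by rewrite -EE addrK mulrC divfK // gt_eqF.
have ZE : Z ^+ 2 = l * (K0 - ln c - c).
  have -> : K0 - ln c - c = Z ^+ 2 / l by rewrite -KE; ring.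
  by rewrite mulrC divfK // gt_eqF.
have hB : g * (E0 - ln g) <= eE.
  have : ln (eE / g) <= eE / g - 1 by apply: ln_le_subr1; rewrite divr_gt0.
  rewrite ln_div ?posrE // expRK -(ler_pM2l g0) => /le_trans; apply.
  by rewrite mulrBr mulrC divfK ?gt_eqF // mulr1 lerBlDr lerDl ltW.
have hZ : c * (K0 - ln c - c) <= C * `|K0| + 1.
  have h1 := mul_opp_ln_le1 c0.
  have h2 : c * K0 <= C * `|K0|.
    apply: (@le_trans _ _ (c * `|K0|)); first by rewrite ler_pM2l.
    by apply: ler_wpM2r.
  have h3 : 0 <= c * c by rewrite mulr_ge0 // ltW.
  lra.
have CK : 0 <= C * `|K0| + 1 by rewrite addr_ge0 // mulr_ge0 // (le_trans _ C1).
split; first by rewrite lE ler_pM2r.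
rewrite BE ZE [X in _ <= X]mulrDr lE; apply: lerD.
  rewrite -mulrA [eE * C]mulrC; apply: (@le_trans _ _ (c * eE)).
    by rewrite ler_pM2l.
  by rewrite ler_pM2r.
rewrite [c * g]mulrC -mulrA; apply: (@le_trans _ _ (g * (C * `|K0| + 1))).
  by rewrite ler_pM2l.
by apply: ler_wpM2r.
Qed.

(** The constant K = 1 + 4 M W avoids a square root: as K >= 1, a^2 <= 4 M W l^2 <= K^2 l^2. *)
Lemma slope_bound (a l B q M W : R) : 0 < l -> a ^+ 2 <= 4 * l ^+ 2 * B * q ->
  B <= M -> 0 <= q -> q <= W -> 0 <= M -> 0 <= W -> - (1 + 4 * M * W) * l <= a.
Proof.
move=> l0 aB BM q0 qW M0 W0; pose K := 1 + 4 * M * W; rewrite -/K.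
have MW0 : 0 <= 4 * M * W by apply: mulr_ge0 W0; apply: mulr_ge0 M0; rewrite ler0n.
have K1 : 1 <= K by rewrite lerDl.
suff : `|a| <= K * l by rewrite ler_norml mulNr => /andP[].
have Kl : 0 <= K * l by rewrite mulr_ge0 ?ltW // (lt_le_trans ltr01).
rewrite -(ler_pXn2r (ltn0Sn 1)) ?nnegrE //.
rewrite real_normK ?num_real //; apply: (le_trans aB).
have l2 : 0 <= 4 * l ^+ 2 by rewrite mulr_ge0 // sqr_ge0.
apply: (@le_trans _ _ (4 * l ^+ 2 * M * W)).
  apply: (@le_trans _ _ (4 * l ^+ 2 * M * q)).
    by apply: ler_wpM2r => //; exact: ler_wpM2l.
  by apply: ler_wpM2l => //; exact: mulr_ge0.
have -> : 4 * l ^+ 2 * M * W = (4 * M * W) * l ^+ 2 by ring.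
rewrite exprMn; apply: ler_wpM2r; first exact: sqr_ge0.
apply: (@le_trans _ _ K); first by rewrite lerDr.
by rewrite expr2 ler_peMr // (le_trans ler01).
Qed.

(** [E] is the mean value theorem for ln lambda on a segment of length at most 1, with [l'] and [a]
    the value and slope of lambda at the intermediate point. *)
Lemma ln_lower_bound (l0 l l' s K a : R) : 0 < l0 -> 0 < l -> 0 < l' ->
  0 < s -> s <= 1 -> 1 <= K -> ln l - ln l0 = s * (l'^-1 * a) -> - K * l' <= a ->
  l0 * expR (- K) <= l.
Proof.
move=> l00 lp l'0 s0 s1 K1 E aK.
have h : - K <= l'^-1 * a by rewrite mulrC ler_pdivlMr.
have h2 : - K <= s * (l'^-1 * a).
  have [p|n] := lerP 0 (l'^-1 * a).
    by apply: (@le_trans _ _ 0); [lra | rewrite mulr_ge0 // ltW].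
  apply: (le_trans h); rewrite -subr_ge0.
  have -> : s * (l'^-1 * a) - l'^-1 * a = (1 - s) * - (l'^-1 * a) by ring.
  by rewrite mulr_ge0 ?subr_ge0 // oppr_ge0 ltW.
rewrite -[l0]lnK ?posrE // -expRD -[l]lnK ?posrE // ler_expR; lra.
Qed.

End FirstCrossing.

(** * Positivity of F along segments *)

Section Propagation.
Context {R : realType}.
Variables (G : 'rV[R]_3 -> 'M[R]_3) (X : 'rV[R]_3 -> 'rV[R]_3) (U : set 'rV[R]_3).
Hypothesis cd : critical_data G U X.
Implicit Types (x u v : 'rV[R]_3).

Local Notation F := (shape_curv G X).
Local Notation f := (shape_norm G X).
Local Notation la := (ricci_eigen G X).

Lemma curved_frame_exists x : U x -> F x != 0 ->
  exists V e1 e2, [/\ adapted_frame G U X V e1 e2, V x &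
    forall y, V y -> coef_mu G e1 e2 X y != 0].
Proof.
move=> Ux F0.
have [v v0] : exists v, cov G v X x != 0.
  apply: contrapT => nv; case/negP: F0; apply/eqP; rewrite /F /metric_trace.
  have B0 u : cov G u X x = 0.
    by apply: contrapT => /eqP u0; apply: nv; exists u.
  by do 2![rewrite big1 // => ? _]; rewrite !B0 inner0r mulr0.
have [V [e1 [e2 [af Vx]]]] := adapted_frame_exists cd Ux v0.
have oV := adapted_open af; have VU := adapted_sub af.
have cdV := critical_data_sub cd oV VU.
pose mu := coef_mu G e1 e2 X.
have smu : smooth_on V mu.
  exact: (smooth_mu oV (data_smooth cdV) (data_unit cdV) (adapted_smooth1 af)
    (adapted_smooth2 af) (data_field cdV)).
pose W := [set y | V y /\ 0 < mu y * mu y].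
have oW : open W by apply: open_gt0 => //; exact: smoothM.
have WV : W `<=` V by move=> y [].
have muN y : W y -> mu y != 0.
  by case=> _; apply: contraTneq => ->; rewrite mulr0 ltxx.
exists W, e1, e2; split => //.
- split => //.
  + by move=> y /WV /VU.
  + by move=> k; apply: smooth_on_sub WV _; exact: (adapted_smooth1 af).
  + by move=> k; apply: smooth_on_sub WV _; exact: (adapted_smooth2 af).
  + by move=> y /WV; exact: (adapted_ortho af).
  + by move=> y /WV; exact: (adapted_cov1 af).
  + by move=> y /WV; exact: (adapted_cov2 af).
  + by move=> y /WV; exact: (adapted_b af).
- split => //; rewrite -expr2 exprn_even_gt0 //=.
  by apply: contraNneq F0 => m0; rewrite (shape_curv_frame cd af Vx) -/mu m0 !mulr0.
Qed.

Lemma shape_curv_not_min x : U x -> F x != 0 -> ~ local_min F x.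
Proof.
move=> Ux F0; have [V [e1 [e2 [af Vx mN]]]] := curved_frame_exists Ux F0.
exact: (shape_curv_not_local_min cd af mN Vx).
Qed.

(** States the outcome of the frame computation without mentioning the frame, which may differ from
    point to point of a segment. *)
Lemma positive_facts x : U x -> 0 < F x ->
  [/\ 0 < la x, 0 < f x, 0 <= beta_sqr G X x & differentiable la x] /\
  (forall v,
    [/\ differentiable (eps_inv G X) x, along v (eps_inv G X) x = 0,
        differentiable (kappa_inv G X) x, along v (kappa_inv G X) x = 0 &
      along v la x ^+ 2 <=
        4 * la x ^+ 2 * (beta_sqr G X x + zeta G X x ^+ 2) * inner (G x) v v]).
Proof.
move=> Ux F0; have [|V [e1 [e2 [af Vx mN]]]] := curved_frame_exists Ux (_ : F x != 0).
  by rewrite gt_eqF.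
have bN := adapted_b af Vx.
have f0 : 0 < f x.
  by rewrite (shape_norm_frame cd af Vx) -expr2 exprn_even_gt0.
have l0 : 0 < la x by rewrite divr_gt0.
split.
  split => //; first by rewrite (beta_sqr_frame cd af mN Vx) -expr2 sqr_ge0.
  exact: (differentiable_ricci_eigen cd af Vx).
move=> v; have [de ae] := eps_inv_constant cd af mN v Vx.
have [dk ak] := kappa_inv_constant cd af mN v Vx l0.
by split => //; exact: (gradient_bound cd af mN v Vx).
Qed.

Lemma smooth_curv V W Z : smooth_field U V -> smooth_field U W -> smooth_field U Z ->
  smooth_field U (fun y => curv G (V y) (W y) (Z y) y).
Proof.
have oU := data_open cd; have sG := data_smooth cd; have uG := data_unit cd.
move=> sV sW sZ k; apply: (smooth_on_eq oU (f := fun y =>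
  (cov G (V y) (fun y => cov G (W y) Z y) y - cov G (W y) (fun y => cov G (V y) Z y) y
  - cov G (bracket V W y) Z y) 0 k)).
  by move=> y Uy; rewrite (curvE oU sG uG Uy sV sW sZ).
have sc := smooth_cov oU sG uG.
have h := smooth_fieldB oU (sc _ _ sV (sc _ _ sW sZ)) (sc _ _ sW (sc _ _ sV sZ)).
exact: (smooth_fieldB oU h (sc _ _ (smooth_bracket oU sV sW) sZ)).
Qed.

Lemma smooth_shape_curv : smooth_on U F.
Proof.
have oU := data_open cd; have sG := data_smooth cd; have uG := data_unit cd.
have sX := data_field cd; have sc a := smooth_field_cst (U := U) a oU.
apply: smooth_sum => // k; apply: smooth_sum => // l; apply: smoothM => //.
  exact: smooth_invmx.
apply: smooth_inner => //; last exact: smooth_cov.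
by apply: smooth_curv => //; exact: smooth_cov.
Qed.

Lemma continuous_line (h : 'rV[R]_3 -> R) x v s : smooth_on U h -> U (x + s *: v) ->
  {for s, continuous (fun r : R => h (x + r *: v))}.
Proof.
move=> sh Us; apply: differentiable_continuous; apply/derivable1_diffP.
by have [] := is_derive_line (smooth_differentiable sh Us).
Qed.

(* Along a segment where [F > 0], the conserved quantities bound the gradient
   of [ln la], so that [F] stays bounded away from 0. *)
Lemma positive_segment x v : (forall s, 0 <= s <= 1 -> U (x + s *: v)) ->
  0 < F x -> 0 < F (x + v).
Proof.
move=> Us Fx; rewrite ltNge; apply/negP => Fv.
have oU := data_open cd; have sF := smooth_shape_curv.
pose p s := x + s *: v.
have p0 : p 0 = x by rewrite /p scale0r addr0.
have p1 : p 1 = x + v by rewrite /p scale1r.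
have cF s : 0 <= s <= 1 -> {for s, continuous (fun r : R => F (p r))}.
  by move=> /Us; exact: continuous_line sF.
have [t [/andP[t0 t1] Ft Fpos]] : exists t, [/\ 0 < t <= 1, F (p t) <= 0 &
    forall s, 0 <= s < t -> 0 < F (p s)].
  have h0 : 0 < F (p 0) by rewrite p0.
  have h1 : F (p 1) <= 0 by rewrite p1.
  exact: (first_nonpositive cF h0 h1).
have Ut s : 0 <= s < t -> U (p s).
  by move=> /andP[s0 st]; apply: Us; rewrite s0 (le_trans (ltW st)).
pose E0 := eps_inv G X x; pose K0 := kappa_inv G X x.
(* Zero derivative at each point before [t] pins a conserved quantity to its value at the starting
   point, by the mean value theorem. *)
have const h : (forall s, 0 <= s < t -> differentiable h (p s) /\ along v h (p s) = 0) ->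
    forall s, 0 <= s < t -> h (p s) = h x.
  move=> hP s /andP[s0 st]; have [<-|sN] := eqVneq 0 s; first by rewrite p0.
  have {}s0 : 0 < s by rewrite lt_neqAle sN.
  have [r rI|r /andP[r0 rs] E] := @MVT_line _ _ h x v s s0.
    have [] := hP r; first by case/andP: rI => -> /le_lt_trans; apply.
    by [].
  have [|dr ar] := hP r; first by rewrite ltW //= (lt_trans rs).
  by apply/eqP; rewrite -subr_eq0 -/(p s) E -along_derive // ar mulr0.
have Econst s (sI : 0 <= s < t) : eps_inv G X (p s) = E0.
  apply: const sI => r rI; have [_ /(_ v)[]] := positive_facts (Ut r rI) (Fpos r rI).
  by [].
have Kconst s (sI : 0 <= s < t) : kappa_inv G X (p s) = K0.
  apply: const sI => r rI; have [_ /(_ v)[]] := positive_facts (Ut r rI) (Fpos r rI).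
  by [].
pose C := 1 + `|K0|.
pose M := expR E0 * (C + (C * `|K0| + 1)).
have bounds s : 0 <= s < t -> [/\ la (p s) <= C * f (p s) &
    beta_sqr G X (p s) + zeta G X (p s) ^+ 2 <= M].
  move=> sI; have [[l0 f0 b0 _] _] := positive_facts (Ut s sI) (Fpos s sI).
  by have [] := conserved_bound l0 f0 b0 (Econst s sI) (Kconst s sI).
have sq : smooth_on U (fun y => inner (G y) v v).
  by apply: (smooth_inner oU (data_smooth cd)); exact: smooth_field_cst.
(* [W] bounds the squared metric length of the constant velocity [v], which varies along a
   coordinate segment. *)
have [c _ Wmax] : exists2 c, c \in `[0, 1]%R & forall s, s \in `[0, 1]%R ->
    inner (G (p s)) v v <= inner (G (p c)) v v.
  apply: (@EVT_max R (fun s => inner (G (p s)) v v) 0 1 ler01).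
  apply: derivable_within_continuous => s; rewrite in_itv /= => /Us Ups.
  by have [] := is_derive_line (smooth_differentiable sq Ups).
set W := inner (G (p c)) v v in Wmax.
have q0 s : 0 <= s <= 1 -> 0 <= inner (G (p s)) v v.
  move=> /Us Ups; have [->|vN] := eqVneq v 0; first by rewrite inner0l.
  exact: ltW (data_pos cd Ups vN).
have W0 : 0 <= W.
  have I0 : 0 <= (0 : R) <= 1 by rewrite lexx ler01.
  by apply: le_trans (q0 0 I0) _; apply: Wmax; rewrite in_itv.
have C0 : 0 < C by rewrite ltr_pwDl.
have M0 : 0 <= M.
  by rewrite mulr_ge0 ?expR_ge0 // addr_ge0 ?ltW // ltr_wpDl // mulr_ge0 // ltW.
pose K := 1 + 4 * M * W.
have MW0 : 0 <= 4 * M * W by apply: mulr_ge0 W0; apply: mulr_ge0 M0; rewrite ler0n.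
have K1 : 1 <= K by rewrite lerDl.
have Ux : U x by rewrite -p0; apply: Us; rewrite lexx ler01.
have [[lx0 _ _ _] _] := positive_facts Ux Fx.
have slope r : 0 <= r < t -> - K * la (p r) <= along v la (p r).
  move=> rI; have [[l0 f0 b0 _] /(_ v)[_ _ _ _ gb]] := positive_facts (Ut r rI) (Fpos r rI).
  have [_ bM] := bounds r rI.
  have I1 : 0 <= r <= 1 by case/andP: rI => -> rt; rewrite (le_trans (ltW rt)).
  have qW : inner (G (p r)) v v <= W by apply: Wmax; rewrite in_itv.
  exact: (slope_bound l0 gb bM (q0 r I1) qW M0 W0).
have la_ge s : 0 <= s < t -> la x * expR (- K) <= la (p s).
  move=> /andP[s0 st]; have [<-|sN] := eqVneq 0 s.
    by rewrite p0 ler_piMr ?(ltW lx0) // expR_le1 oppr_le0 (le_trans ler01).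
  have {}s0 : 0 < s by rewrite lt_neqAle sN.
  have dln r : 0 <= r < t -> differentiable (fun y => ln (la y)) (p r) /\
      along v (fun y => ln (la y)) (p r) = (la (p r))^-1 * along v la (p r).
    move=> rI; have [[l0 _ _ dl] _] := positive_facts (Ut r rI) (Fpos r rI).
    have hd := is_derive1_ln l0; split; first exact: (differentiable_comp1 dl hd).
    exact: (along_comp1 v dl hd).
  have rI r : 0 <= r <= s -> 0 <= r < t.
    by move=> /andP[-> rs]; exact: le_lt_trans rs st.
  have [r /andP[r0 rs] E] := MVT_line s0 (fun r rs => (dln r (rI r rs)).1).
  have rI' : 0 <= r < t by apply: rI; rewrite !ltW.
  have [[lr0 _ _ _] _] := positive_facts (Ut r rI') (Fpos r rI').
  have sI : 0 <= s < t by rewrite (ltW s0).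
  have [[ls0 _ _ _] _] := positive_facts (Ut s sI) (Fpos s sI).
  have [dr ar] := dln r rI'.
  rewrite -(along_derive _ dr) ar -/(p s) in E.
  have s1 : s <= 1 by rewrite (le_trans (ltW st)).
  exact: (ln_lower_bound lx0 ls0 lr0 s0 s1 K1 E (slope r rI')).
pose L := la x * expR (- K).
have L0 : 0 < L by rewrite mulr_gt0 // expR_gt0.
(* Before [t], F = lambda |B|^2 >= lambda^2 / C >= L^2 / C; continuity carries this positive bound
   to [t], where F was assumed nonpositive. *)
have Fge : L ^+ 2 / C <= F (p t).
  have It : 0 <= t <= 1 by rewrite ltW.
  apply: (ge_at_end t0 (cF t It)) => s sI.
  have [[l0 f0 _ _] _] := positive_facts (Ut s sI) (Fpos s sI).
  have FE : F (p s) = la (p s) * f (p s) by rewrite divfK // gt_eqF.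
  rewrite ler_pdivrMr // FE.
  have [lC _] := bounds s sI; have Ll := la_ge s sI.
  apply: (@le_trans _ _ (la (p s) * la (p s))).
    by rewrite expr2; apply: ler_pM => //; exact: ltW.
  by rewrite -[leRHS]mulrA [f _ * C]mulrC; exact: (ler_wpM2l (ltW l0) lC).
have : 0 < L ^+ 2 / C by rewrite divr_gt0 // exprn_gt0.
by rewrite ltNge (le_trans Fge Ft).
Qed.

End Propagation.

(** * Flatness and globalization *)

Section Flatness.
Context {R : realType}.
Variables (G : 'rV[R]_3 -> 'M[R]_3) (X : 'rV[R]_3 -> 'rV[R]_3) (U : set 'rV[R]_3).
Hypothesis cd : critical_data G U X.
Implicit Types (x u v w : 'rV[R]_3).

(* The three trace conditions leave only [R(., X)X] undetermined. *)
Lemma curv_eq0_at x : U x -> (forall u, curv G u (X x) (X x) x = 0) ->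
  forall u v w, curv G u v w x = 0.
Proof.
move=> Ux T0; have GT := data_sym cd Ux.
have [e1 [e2 oe]] := ortho3_completion GT (data_pos cd Ux) (data_norm cd Ux).
have ex := frame3_expand GT oe.
have sk u v w z : inner (G x) (curv G u v w x) z = - inner (G x) (curv G u v z x) w.
  exact: (curv_skew (data_open cd) (data_smooth cd) (data_sym cd) (data_unit cd)).
have dg u v w : inner (G x) (curv G u v w x) w = 0.
  exact: (curv_skew_diag (data_open cd) (data_smooth cd) (data_sym cd) (data_unit cd)).
have bi u v w := curv_bianchi (data_open cd) (data_smooth cd) (data_sym cd)
  (data_unit cd) u v w Ux.
have r1 := ric1_frame cd Ux oe; have r2 := ric2_frame cd Ux oe.
have s12 := sec12_frame cd Ux oe.
have zero u : inner (G x) u e1 = 0 -> inner (G x) u e2 = 0 ->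
    inner (G x) u (X x) = 0 -> u = 0.
  by move=> h1 h2 h3; rewrite [u]ex h1 h2 h3 !scale0r !addr0.
have a1 : curv G e1 (X x) e1 x = 0.
  by apply: zero; [exact: dg|rewrite sk r1 oppr0|rewrite sk T0 inner0l oppr0].
have a2 : curv G e1 (X x) e2 x = 0.
  by apply: zero; [exact: r1|exact: dg|rewrite sk T0 inner0l oppr0].
have b1 : curv G e2 (X x) e1 x = 0.
  by apply: zero; [exact: dg|exact: r2|rewrite sk T0 inner0l oppr0].
have b2 : curv G e2 (X x) e2 x = 0.
  by apply: zero; [rewrite sk r2 oppr0|exact: dg|rewrite sk T0 inner0l oppr0].
(* By the Bianchi identity this is a combination of [a2] and [b1], already known to vanish. *)
have c3 : curv G e1 e2 (X x) x = 0.
  by have := bi e1 e2 (X x); rewrite b1 curv_antisym [X in _ + X]curv_antisym a2 oppr0 !addr0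
    -curv_antisym.
have c1 : curv G e1 e2 e1 x = 0.
  by apply: zero; [exact: dg|rewrite sk s12 oppr0|rewrite sk c3 inner0l oppr0].
have c2 : curv G e1 e2 e2 x = 0.
  by apply: zero; [exact: s12|exact: dg|rewrite sk c3 inner0l oppr0].
have lin3 a b w : curv G a b e1 x = 0 -> curv G a b e2 x = 0 ->
    curv G a b (X x) x = 0 -> curv G a b w x = 0.
  move=> h1 h2 h3; rewrite [w]ex -addrA !curv_linear3 h1 h2 !scaler0 !add0r.
  by have := curv_linear3 G (inner (G x) w (X x)) a b (X x) 0 x;
    rewrite curv0r !addr0 h3 scaler0.
have A w : curv G e1 (X x) w x = 0 by exact: lin3.
have B w : curv G e2 (X x) w x = 0 by exact: lin3.
have C w : curv G e1 e2 w x = 0 by exact: lin3.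
have D u w : curv G u u w x = 0 by exact: curv_diag.
have lin2 a v w : curv G a e1 w x = 0 -> curv G a e2 w x = 0 ->
    curv G a (X x) w x = 0 -> curv G a v w x = 0.
  move=> h1 h2 h3; rewrite [v]ex -addrA !curv_linear2 h1 h2 !scaler0 !add0r.
  have := curv_linear2 G (inner (G x) v (X x)) a (X x) 0 w x.
  by rewrite [curv G a 0 _ _]curv_antisym curv0l oppr0 !addr0 h3 scaler0.
have E1 v w : curv G e1 v w x = 0 by exact: lin2.
have E2 v w : curv G e2 v w x = 0 by apply: lin2 => //; rewrite curv_antisym C oppr0.
have E3 v w : curv G (X x) v w x = 0.
  by apply: lin2 => //; rewrite curv_antisym ?A ?B oppr0.
move=> u v w; rewrite curv_antisym lin2 ?oppr0 //.
- by rewrite curv_antisym E1 oppr0.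
- by rewrite curv_antisym E2 oppr0.
- by rewrite curv_antisym E3 oppr0.
Qed.

(** A field that is parallel near a point is annihilated by the curvature there. *)
Lemma curvXX_eq0_parallel x u : U x -> (\forall y \near x, forall v, cov G v X y = 0) ->
  curv G u (X x) (X x) x = 0.
Proof.
move=> Ux nB.
have nU := open_nbhs_nbhs (conj (data_open cd) Ux).
have [W [oW Wx] WP] : exists2 W, open_nbhs x W &
    forall y, W y -> U y /\ forall v, cov G v X y = 0.
  have : nbhs x (U `&` [set y | forall v, cov G v X y = 0]) by exact: filterI.
  move=> /nbhs_ballP[e /= e0 eP].
  exists (ball x e) => [|y /eP//]; split; [exact: ball_open | exact: ballxx].
have WU : W `<=` U by move=> y /WP[].
have cdW := critical_data_sub cd oW WU; have sX := data_field cdW.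
have su := smooth_field_cst (U := W) u oW.
rewrite (curvE oW (data_smooth cdW) (data_unit cdW) Wx su sX sX).
rewrite (cov_zero G oW _ Wx (data_geod cdW)).
rewrite (cov_zero G oW _ Wx (fun y Wy => (WP y Wy).2 u)).
by rewrite (WP x Wx).2 !subr0.
Qed.

(** In an adapted frame F = b^3 mu with b nonzero, so mu = 0; together with X b = 0 this kills R(e1,
    X)X and R(e2, X)X. *)
Lemma curvXX_eq0_twisting x u v : U x -> cov G v X x != 0 -> shape_curv G X x = 0 ->
  curv G u (X x) (X x) x = 0.
Proof.
move=> Ux vN F0; have [V [e1 [e2 [af Vx]]]] := adapted_frame_exists cd Ux vN.
have VU := adapted_sub af; have cdV := critical_data_sub cd (adapted_open af) VU.
have bN := adapted_b af Vx.
have m0 : coef_mu G e1 e2 X x = 0.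
  move/eqP: F0; rewrite (shape_curv_frame cd af Vx) !mulf_eq0 !(negbTE bN) /=.
  by move/eqP.
have oV := adapted_open af.
have r1 y (Vy : V y) := ric1_frame cdV Vy (adapted_ortho af Vy).
have h1 : curv G (e1 x) (X x) (X x) x = 0.
  by rewrite (curv1XX_frame cd af Vx) m0 mulr0 scale0r.
have h2 : curv G (e2 x) (X x) (X x) x = 0.
  rewrite (curv2XX oV (data_smooth cdV) (data_sym cdV) (data_unit cdV)
    (adapted_smooth1 af) (adapted_smooth2 af) (data_field cdV) (adapted_ortho af)
    (adapted_cov1 af) (adapted_cov2 af) (data_geod cdV) Vx).
  rewrite (d3b oV (data_smooth cdV) (data_sym cdV) (data_unit cdV)
    (adapted_smooth1 af) (adapted_smooth2 af) (data_field cdV) (adapted_ortho af)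
    (adapted_cov1 af) (adapted_cov2 af) (data_geod cdV) Vx).
  by rewrite m0 mulr0 !scale0r oppr0 scale0r subr0.
rewrite [u](frame3_expand (data_sym cd Ux) (adapted_ortho af Vx)) -addrA.
rewrite !curv_linear1 h1 h2 !scaler0 !add0r -[_ *: X x]addr0 curv_linear1 curv0l.
by rewrite curv_diag scaler0 addr0.
Qed.

Lemma flat_of_shape_curv0 x : (forall y, U y -> shape_curv G X y = 0) -> U x ->
  forall u v w, curv G u v w x = 0.
Proof.
move=> F0 Ux; apply: curv_eq0_at => // u; apply/rowP => k; rewrite [RHS]mxE.
apply: contrapT => /eqP hk.
have sX := data_field cd; have oU := data_open cd.
have sh := smooth_curv cd (smooth_field_cst u oU) sX sX k.
have ch := differentiable_continuous (smooth_differentiable sh Ux).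
(* A nonzero component persists nearby. There B must vanish by [curvXX_eq0_twisting], so X is
   parallel on a neighbourhood, and [curvXX_eq0_parallel] contradicts the nonzero component at [x].
   This covers limits of points where B is nonzero. *)
have nh : \forall y \near x, curv G u (X y) (X y) y 0 k != 0.
  by move/cvgr_neq0: ch; apply.
case/eqP: hk; rewrite curvXX_eq0_parallel ?mxE //.
have nU := open_nbhs_nbhs (conj oU Ux).
apply: filterS2 nU nh => y Uy hy v; apply: contrapT => /eqP vN.
by move/eqP: hy; rewrite (curvXX_eq0_twisting u Uy vN (F0 y Uy)) mxE.
Qed.

End Flatness.

(** * Independence of F from the chart *)

Section ShapeCurvInvariance.
Context {R : realType}.
Variables (U U' : set 'rV[R]_3) (t s : 'rV[R]_3 -> 'rV[R]_3).
Variables (G G' : 'rV[R]_3 -> 'M[R]_3) (X X' : 'rV[R]_3 -> 'rV[R]_3).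
Hypotheses (cd : critical_data G U X) (cd' : critical_data G' U' X').
Hypotheses (tU : forall x, U x -> U' (t x)) (sU : forall y, U' y -> U (s y)).
Hypotheses (stK : forall x, U x -> s (t x) = x) (tsK : forall y, U' y -> t (s y) = y).
Hypotheses (st : smooth_field U t) (ss : smooth_field U' s).
Hypothesis isom : forall x, U x -> forall u v,
  inner (G x) u v = inner (G' (t x)) (along_row u t x) (along_row v t x).
Hypothesis rX : related U t X X'.

(** An orthonormal frame containing X is pushed to another one, and the traces are compared term by
    term using naturality of [cov] and [curv]; the X terms vanish on both sides since X is
    geodesic. *)
Lemma shape_curv_invariant x : U x -> shape_curv G X x = shape_curv G' X' (t x).
Proof.
move=> Ux; have Ux' := tU Ux.
have oU := data_open cd; have oU' := data_open cd'.
have sG := data_smooth cd; have sG' := data_smooth cd'.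
have symG := data_sym cd; have symG' := data_sym cd'.
have uG := data_unit cd; have uG' := data_unit cd'.
have sX := data_field cd; have sX' := data_field cd'.
pose push u := along_row u t x.
pose ext u y := along_row ((fun=> u : 'rV[R]_3) (s y)) t (s y).
have sc u := smooth_field_cst (U := U) u oU.
have sext u : smooth_field U' (ext u) := smooth_push oU oU' sU st ss (sc u).
have rext u : related U t (fun=> u) (ext u) := related_push stK (fun=> u).
have extx u : ext u (t x) = push u by rewrite (rext u x Ux).
have covp u : cov G' (push u) X' (t x) = push (cov G u X x).
  have := related_cov oU oU' tU sU stK tsK st ss sG symG uG sG' symG' uG' isom
    (sc u) sX (sext u) sX' (rext u) rX Ux.
  by rewrite extx.
have curvp u : curv G' (push u) (X' (t x)) (X' (t x)) (t x) =
    push (curv G u (X x) (X x) x).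
  have := related_curv oU oU' tU sU stK tsK st ss sG symG uG sG' symG' uG' isom
    (sc u) sX sX (sext u) sX' sX' (rext u) rX rX Ux.
  by rewrite extx.
have [e1 [e2 oe]] := ortho3_completion (symG x Ux) (data_pos cd Ux) (data_norm cd Ux).
have oe' : ortho3 (G' (t x)) (push e1) (push e2) (X' (t x)).
  by case: oe => o1 o2 o3 o4 o5 o6; split; rewrite ?(rX Ux) -(isom Ux).
rewrite /shape_curv (metric_trace3 (symG x Ux) oe (bilinear_shape_curv G X x)).
rewrite (metric_trace3 (symG' _ Ux') oe' (bilinear_shape_curv G' X' (t x))).
have q u : inner (G' (t x))
    (curv G' (cov G' (push u) X' (t x)) (X' (t x)) (X' (t x)) (t x))
    (cov G' (push u) X' (t x)) =
  inner (G x) (curv G (cov G u X x) (X x) (X x) x) (cov G u X x).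
  by rewrite !covp curvp -(isom Ux).
have vanish (H : 'M[R]_3) (u v : 'rV[R]_3) : v = 0 -> inner H u v = 0.
  by move=> ->; rewrite inner0r.
rewrite (q e1) (q e2) (vanish _ _ _ (data_geod cd Ux)).
by rewrite (vanish _ _ _ (data_geod cd' Ux')).
Qed.

End ShapeCurvInvariance.

Section SmoothEntries.
Context {R : realType} {m n : nat}.

(** Bridges the vector-valued smoothness of transition maps and the componentwise smoothness used
    for fields. *)
Lemma smooth_on_entry (U : set 'rV[R]_m) (t : 'rV[R]_m -> 'rV[R]_n) :
  open U -> smooth_on U t -> forall k, smooth_on U (fun x => t x 0 k).
Proof.
move=> oU st k s.
have E : forall y, U y ->
    foldr partial (fun z => t z 0 k) s y = (foldr partial t s y) 0 k.
  elim: s => [//|a s IH] y Uy /=.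
  rewrite (eq_partial a oU Uy IH).
  by rewrite /partial derive_entry //; exact: st.
move=> x Ux; apply: (eq_differentiable oU Ux (f := fun y => (foldr partial t s y) 0 k)).
  by move=> y Uy; rewrite E.
by apply: differentiable_entry; exact: st.
Qed.

End SmoothEntries.

(* [coord] alone denotes coordinates in a basis, from [vector]. *)
Local Notation coord := Defs.coord.

(** * Charts, overlaps and transition maps *)

Section Atlas.
Context {R : realType} {n : nat} {M : topologicalType}.
Variable A : smooth_atlas R n M.
Implicit Types (i j : chart A).

Lemma range_of_coord i p : dom i p -> range_of i (coord i p).
Proof. by move=> ip; exists p. Qed.

Lemma overlap_coord i j p : dom i p -> dom j p -> overlap i j (coord i p).
Proof. by move=> ip jp; exists p. Qed.

(** Openness of overlaps is not a field of the atlas; it follows from openness of ranges and domains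
    and continuity of [param]. *)
Lemma overlap_open i j : open (overlap i j).
Proof.
rewrite openE => _ [p [ip jp] <-].
have rx := range_of_coord ip.
have n1 := open_nbhs_nbhs (conj (@range_open _ _ _ A i) rx).
have n2 : \forall y \near coord i p, dom j (param i y).
  apply: (param_continuous rx); rewrite coordK //.
  exact: open_nbhs_nbhs (conj (@dom_open _ _ _ A j) jp).
apply: filterS2 n1 n2 => _ [q iq <-]; rewrite coordK // => jq.
exact: overlap_coord.
Qed.

Lemma overlap_range i j : overlap i j `<=` range_of i.
Proof. by move=> _ [p [ip _] <-]; exact: range_of_coord. Qed.

Lemma transition_coord i j p : dom i p -> transition i j (coord i p) = coord j p.
Proof. by move=> ip; rewrite /transition /= coordK. Qed.

Lemma transition_overlap i j x : overlap i j x -> overlap j i (transition i j x).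
Proof.
by move=> [p [ip jp] <-]; rewrite transition_coord //; exact: overlap_coord.
Qed.

Lemma transitionK i j x : overlap i j x -> transition j i (transition i j x) = x.
Proof. by move=> [p [ip jp] <-]; rewrite !transition_coord. Qed.

Lemma smooth_transition i j : smooth_field (overlap i j) (transition i j).
Proof. exact: smooth_on_entry (@overlap_open i j) (@transition_smooth _ _ _ A i j). Qed.

Lemma diff_transition i j x u : overlap i j x ->
  'd (transition i j) x u = along_row u (transition i j) x.
Proof.
move=> ox; have dt : differentiable (transition i j) x.
  exact: (@transition_smooth _ _ _ A i j [::] x ox).
apply/rowP => k; rewrite -deriveE // derive_entry // mxE along_derive //.
exact: (smooth_fieldW (@smooth_transition i j) ox k).
Qed.

Lemma coord_near i p (P : 'rV[R]_n -> Prop) : dom i p ->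
  (\forall y \near coord i p, P y) -> \forall q \near p, dom i q /\ P (coord i q).
Proof.
move=> ip nP; have nd := open_nbhs_nbhs (conj (@dom_open _ _ _ A i) ip).
have nc : \forall q \near p, P (coord i q) by exact: (Defs.coord_continuous ip nP).
exact: filterS2 nd nc => q iq Pq.
Qed.

Lemma param_near i p (P : M -> Prop) : dom i p ->
  (\forall q \near p, P q) ->
  \forall y \near coord i p, exists q, [/\ dom i q, P q & y = coord i q].
Proof.
move=> ip nP; have rx := range_of_coord ip.
have n1 := open_nbhs_nbhs (conj (@range_open _ _ _ A i) rx).
have n2 : \forall y \near coord i p, P (param i y).
  by apply: (param_continuous rx); rewrite coordK.
apply: filterS2 n1 n2 => _ [q iq <-]; rewrite coordK // => Pq.
by exists q.
Qed.

End Atlas.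

(** * The global minimum and connectedness argument *)

Section Global.
Context {R : realType} {M : topologicalType}.
Variables (A : smooth_atlas R 3 M) (g : riemannian_metric A) (X : vector_field A).
Hypothesis M_closed : closed_manifold M.
Hypothesis cd : forall i, critical_data (gram g i) (range_of i) (coef X i).
Implicit Types (i j : chart A) (p q : M).

Local Notation F i := (shape_curv (gram g i) (coef X i)).

Lemma shape_curv_chart i j p : dom i p -> dom j p ->
  F i (coord i p) = F j (coord j p).
Proof.
move=> ip jp; rewrite -(transition_coord j ip).
have oi := @overlap_open _ _ _ A i j; have oj := @overlap_open _ _ _ A j i.
have cdi := critical_data_sub (cd i) oi (@overlap_range _ _ _ A i j).
have cdj := critical_data_sub (cd j) oj (@overlap_range _ _ _ A j i).
apply: (shape_curv_invariant cdi cdj (@transition_overlap _ _ _ A i j)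
  (@transition_overlap _ _ _ A j i) (@transitionK _ _ _ A i j)
  (@transitionK _ _ _ A j i) (@smooth_transition _ _ _ A i j)
  (@smooth_transition _ _ _ A j i)).
- by move=> x ox u v; rewrite (gram_transition g ox) !diff_transition.
- by move=> x ox; rewrite (coef_transition X ox) diff_transition.
- exact: overlap_coord.
Qed.

Definition chart_at p : chart A := sval (cid (dom_cover A p)).

Lemma chart_atP p : dom (chart_at p) p.
Proof. exact: svalP (cid (dom_cover A p)). Qed.

(** The chart is picked by choice; [global_shape_curvE] shows the choice to be immaterial. *)
Definition global_shape_curv p : R := F (chart_at p) (coord (chart_at p) p).

Lemma global_shape_curvE i p : dom i p -> global_shape_curv p = F i (coord i p).
Proof. by move=> ip; apply: shape_curv_chart => //; exact: chart_atP. Qed.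

Lemma continuous_shape_curv : continuous global_shape_curv.
Proof.
move=> p; pose i := chart_at p; have ip := chart_atP p.
have cF := differentiable_continuous
  (smooth_differentiable (smooth_shape_curv (cd i)) (range_of_coord ip)).
move=> B; rewrite /= (global_shape_curvE ip) => nB.
have := coord_near ip (cF _ nB).
by apply: filterS => q [iq]; rewrite /= -global_shape_curvE.
Qed.

Lemma global_min_eq0 p : (forall q, global_shape_curv p <= global_shape_curv q) ->
  global_shape_curv p = 0.
Proof.
move=> pmin; apply: contrapT => /eqP pN; have ip := chart_atP p.
have := shape_curv_not_min (cd (chart_at p)) (range_of_coord ip); apply.
  by rewrite -(global_shape_curvE ip).
(* The trivial property suffices: [param_near] is needed only to write nearby coordinates as those
   of points of M. *)
have nT : \forall q \near p, True by exact: filterT.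
apply: filterS (param_near ip nT) => _ [q [iq _ ->]].
by rewrite -!global_shape_curvE.
Qed.

Lemma open_positive : open [set p | 0 < global_shape_curv p].
Proof.
by apply: open_comp (@open_gt R 0) => p _; exact: continuous_shape_curv.
Qed.

(** Around a limit point take a coordinate ball. If F were positive at some [y] in it, the segment
    from [y] to the centre would stay in the ball and carry positivity to the centre. *)
Lemma closed_positive : closed [set p | 0 < global_shape_curv p].
Proof.
rewrite -openC openE => p pN; have ip := chart_atP p.
set i := chart_at p in ip; set x := coord i p.
have rx := range_of_coord ip.
have : \forall y \near x, range_of i y.
  exact: open_nbhs_nbhs (conj (@range_open _ _ _ A i) rx).
move=> /nbhs_ballP[d /= d0 dr].
suff nF : \forall y \near x, ~ (0 < F i y).
  have := coord_near ip nF; apply: filterS => q [iq] /=.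
  by rewrite -global_shape_curvE.
apply/nbhs_ballP; exists d => [//|y]; rewrite -ball_normE => xy Fy.
apply: pN => /=; rewrite (global_shape_curvE ip) -/x.
have -> : x = y + (x - y) by rewrite addrC subrK.
apply: (positive_segment (cd i)) => // s /andP[s0 s1].
apply: dr; rewrite -ball_normE /=.
have -> : x - (y + s *: (x - y)) = (1 - s) *: (x - y).
  by rewrite scalerBl scale1r opprD addrA.
rewrite normrZ ger0_norm ?subr_ge0 //; apply: le_lt_trans xy.
by rewrite ler_piMl // gerBl.
Qed.

(** The minimum exists by compactness and has value 0, so F >= 0. A positive value somewhere would
    make the open and closed set F > 0 all of M, against the minimum point. *)
Lemma global_shape_curv_eq0 p : global_shape_curv p = 0.
Proof.
have [_ cM conM] := M_closed.
have cont : {within [set: M], continuous global_shape_curv}.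
  exact: continuous_subspaceT continuous_shape_curv.
have [|p0 _ pmin] := compact_EVT_min _ cM cont; first by exists p.
have {}pmin q : global_shape_curv p0 <= global_shape_curv q.
  by apply: pmin; rewrite inE.
have p00 := global_min_eq0 pmin.
have := pmin p; rewrite p00 => p_ge0.
apply/le_anti/andP; split; last exact: p_ge0.
rewrite leNgt; apply/negP => pp.
have : [set q | 0 < global_shape_curv q] = [set: M].
  apply: conM; first by exists p.
    by exists [set q | 0 < global_shape_curv q]; [exact: open_positive | rewrite setTI].
  by exists [set q | 0 < global_shape_curv q]; [exact: closed_positive | rewrite setTI].
by move=> /seteqP[_ /(_ p0 I)] /=; rewrite p00 ltxx.
Qed.

Lemma critical_flat i x u v w : range_of i x -> riemann (gram g i) u v w x = 0.
Proof.
move=> rx; have cdi := cd i.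
rewrite (riemannE (data_open cdi) (data_smooth cdi) (data_unit cdi) _ _ _ rx).
apply: (flat_of_shape_curv0 cdi _ rx) => _ [p ip <-].
by rewrite -global_shape_curvE // global_shape_curv_eq0.
Qed.

End Global.

Theorem theorem2 (R : realType) (M : topologicalType)
    (A : smooth_atlas R 3 M) (g : riemannian_metric A) (X : vector_field A)
  (M_closed : closed_manifold M)
  (scalar_eq0 : forall (i : chart A) x, range_of i x ->
     scalar_curvature (gram g i) x = 0)
  (X_unit : forall (i : chart A) x, range_of i x ->
     inner (gram g i x) (coef X i x) (coef X i x) = 1)
  (ricci_X : forall (i : chart A) x, range_of i x ->
     forall v, ricci (gram g i) (coef X i x) v x = 0)
  (X_geodesic : forall (i : chart A) x, range_of i x ->
     nabla (gram g i) (coef X i) (coef X i) x = 0)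
  (div_X : forall (i : chart A) x, range_of i x ->
     divergence (gram g i) (coef X i) x = 0) :
  forall (i : chart A) x, range_of i x ->
    forall u v w, riemann (gram g i) u v w x = 0.
Proof.
have cd i : critical_data (gram g i) (range_of i) (coef X i).
  split.
  - exact: (@range_open _ _ _ A i).
  - exact: gram_smooth.
  - exact: gram_sym.
  - exact: gram_pos.
  - exact: coef_smooth.
  - exact: X_unit.
  - exact: ricci_X.
  - by move=> x rx; rewrite -nabla_cov X_geodesic.
  - move=> x rx; rewrite -[RHS](div_X i x rx); apply: eq_bigr => k _.
    by rewrite nabla_cov.
  - exact: scalar_eq0.
by move=> i x rx u v w; exact: (critical_flat M_closed cd).
Qed.
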